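(* Let $k\ge1$ and $\frac12\le\theta\le1$. Let $u$ be the smooth solution of $u_t=-(\partial_x^2+\partial_y^2)^2u$ on a rectangle $\Omega\subset\mathbb{R}^2$, $t>0$, with $u(x,y,0)=u_0(x,y)$ and periodic boundary conditions. Let $(u_h^n,q_h^n)\in Q_h\times Q_h$ be the solution of the fully discrete DG scheme $$\Big(\frac{u_h^{n+1}-u_h^n}{\Delta t},\phi\Big)=-A(q_h^{n+\theta},\phi),\qquad (q_h^n,\psi)=A(u_h^n,\psi)\qquad\text{for all }\phi,\psi\in Q_h,\ n\ge0,$$ where $v^{n+\theta}=(1-\theta)v^n+\theta v^{n+1}$ and $u_h^0$ is the $L^2$ projection of $u_0$ onto $Q_h$. Then, with $t^n=n\Delta t\le T$, $$\|u(\cdot,t^n)-u_h^n\|\le C\big(h^{k+1}+(\theta-\tfrac12)\Delta t+(\Delta t)^2\big),$$ where $C$ depends on $\sup_{t\in[0,T]}\|u_t(\cdot,t)\|_{k+1}$, $\sup_{t\in[0,T]}\|u_{tt}(\cdot,t)\|$, $\sup_{t\in[0,T]}\|u_{ttt}(\cdot,t)\|$ and linearly on $T$, but is independent of $h$ and $\Delta t$.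
   Context: $\Omega$ is a rectangle partitioned into rectangular cells $I_{i,j}=[x_{i-1/2},x_{i+1/2}]\times[y_{j-1/2},y_{j+1/2}]$, $1\le i\le N$, $1\le j\le M$, uniform with sizes $\Delta x=x_{i+1/2}-x_{i-1/2}$, $\Delta y=y_{j+1/2}-y_{j-1/2}$; $h=\max\{\Delta x,\Delta y\}$ is the mesh size and $\Delta t>0$ the time step. $Q_h=\{v\in L^2(\Omega): v|_{I_{i,j}}\in Q^k(I_{i,j})\}$, where $Q^k$ denotes tensor-product polynomials of degree at most $k$ in each variable. On a vertical interface $x=x_{i+1/2}$: $\{v\}=\frac12(v(x_{i+1/2}^-,y)+v(x_{i+1/2}^+,y))$, $[v]=v(x_{i+1/2}^+,y)-v(x_{i+1/2}^-,y)$, and analogously on horizontal interfaces $y=y_{j+1/2}$; traces from outside $\Omega$ on the boundary are taken by periodicity. $(\cdot,\cdot)$ and $\|\cdot\|$ are the $L^2(\Omega)$ inner product and norm; $\|\cdot\|_m$ is the $H^m(\Omega)$ norm. The bilinear form is $$A(w,v)=\sum_{i,j=1}^{N,M}\iint_{I_{i,j}}\nabla w\cdot\nabla v\,dxdy+\sum_{i,j=1}^{N,M}\int_{y_{j-1/2}}^{y_{j+1/2}}\big(\{w_x\}[v]+\{v_x\}[w]\big)_{x_{i+1/2}}dy+\sum_{i,j=1}^{N,M}\int_{x_{i-1/2}}^{x_{i+1/2}}\big(\{w_y\}[v]+\{v_y\}[w]\big)_{y_{j+1/2}}dx .$$ *)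

(* Defs.v *)
From Stdlib Require Export Reals.
From Coquelicot Require Export Coquelicot.
Open Scope R_scope.

(** * The rectangle, and functions on it *)

Record rectangle := Rectangle {
  ax : R; bx : R; ay : R; by_ : R;
  ax_lt_bx : ax < bx;
  ay_lt_by : ay < by_ }.

(* Only used for functions continuous on the closed rectangle, where the iterated
   Riemann integral is the Lebesgue integral. *)
Definition L2norm (Om : rectangle) (f : R -> R -> R) : R :=
  sqrt (RInt (fun x => RInt (fun y => (f x y) ^ 2) (ay Om) (by_ Om)) (ax Om) (bx Om)).

Definition partial (a b : nat) (f : R -> R -> R) : R -> R -> R :=
  fun x y => Derive_n (fun x' => Derive_n (fun y' => f x' y') b y) a x.

Definition Hnorm (Om : rectangle) (m : nat) (f : R -> R -> R) : R :=
  sqrt (sum_n (fun a => sum_n (fun b => (L2norm Om (partial a b f)) ^ 2) (m - a)) m).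

Definition laplacian (f : R -> R -> R) : R -> R -> R :=
  fun x y => partial 2 0 f x y + partial 0 2 f x y.

Definition sup_upto (T : R) (f : R -> R) : R :=
  real (Lub_Rbar (fun z => exists t, 0 <= t <= T /\ z = f t)).

(** * Space-time functions [u t x y], smooth on [0,+oo) x R^2 *)

(* [u] is C^oo up to [t = 0], with [D l a b] its derivative of order [l] in t,
   [a] in x and [b] in y.  Only the values at [t >= 0] matter: for [l >= 1] the
   continuity clause makes [D l a b] at [t = 0] the one-sided derivative, which the
   two-sided [Derive] would not give. *)
Definition smooth_with_derivatives
    (u : R -> R -> R -> R) (D : nat -> nat -> nat -> R -> R -> R -> R) : Prop :=
  (forall t x y, 0 <= t -> D 0%nat 0%nat 0%nat t x y = u t x y) /\
  (forall l a b,
     continuous_on (fun p : R * R * R => 0 <= fst (fst p))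
       (fun p : R * R * R => D l a b (fst (fst p)) (snd (fst p)) (snd p))) /\
  (forall l a b t x y, 0 < t ->
     is_derive (fun s => D l a b s x y) t (D (S l) a b t x y)) /\
  (forall l a b t x y, 0 <= t ->
     is_derive (fun s => D l a b t s y) x (D l (S a) b t x y)) /\
  (forall l a b t x y, 0 <= t ->
     is_derive (fun s => D l a b t x s) y (D l a (S b) t x y)).

Definition periodic_in_space (Om : rectangle) (u : R -> R -> R -> R) : Prop :=
  forall t x y, 0 <= t ->
    u t (x + (bx Om - ax Om)) y = u t x y /\
    u t x (y + (by_ Om - ay Om)) = u t x y.

(** * Uniform mesh with N x M cells *)

Definition dx (Om : rectangle) (N : nat) : R := (bx Om - ax Om) / INR N.
Definition dy (Om : rectangle) (M : nat) : R := (by_ Om - ay Om) / INR M.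
Definition mesh_size (Om : rectangle) (N M : nat) : R := Rmax (dx Om N) (dy Om M).

(* [xn Om N i] is x_{i+1/2}: cell (i,j), 1 <= i <= N, 1 <= j <= M, is
   [xn (i-1), xn i] x [yn (j-1), yn j]. *)
Definition xn (Om : rectangle) (N i : nat) : R := ax Om + INR i * dx Om N.
Definition yn (Om : rectangle) (M j : nat) : R := ay Om + INR j * dy Om M.

(** * Cellwise defined functions *)

(* [v i j] is the function (for elements of Q_h, the polynomial) that [v] agrees with
   on cell (i,j).  It is defined on all of R^2, so that the one-sided traces of [v] on
   the edges of the cell are plain values of [v i j].  Indices outside 1..N, 1..M are
   irrelevant. *)
Definition broken := nat -> nat -> R -> R -> R.

Definition is_Qk (k : nat) (p : R -> R -> R) : Prop :=
  exists c : nat -> nat -> R, forall x y,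
    p x y = sum_n (fun a => sum_n (fun b => c a b * x ^ a * y ^ b) k) k.

Definition in_Qh (N M k : nat) (v : broken) : Prop :=
  forall i j, (1 <= i <= N)%nat -> (1 <= j <= M)%nat -> is_Qk k (v i j).

Definition on_cells (f : R -> R -> R) : broken := fun _ _ => f.

Definition bcomb (a : R) (v : broken) (b : R) (w : broken) : broken :=
  fun i j x y => a * v i j x y + b * w i j x y.

Definition bDx (v : broken) : broken := fun i j x y => Derive (fun s => v i j s y) x.
Definition bDy (v : broken) : broken := fun i j x y => Derive (fun s => v i j x s) y.

Definition sum_cells (N M : nat) (F : nat -> nat -> R) : R :=
  sum_n_m (fun i => sum_n_m (fun j => F i j) 1 M) 1 N.

Definition int_cells (Om : rectangle) (N M : nat) (f : broken) : R :=
  sum_cells N M (fun i j =>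
    RInt (fun x => RInt (fun y => f i j x y) (yn Om M (j - 1)) (yn Om M j))
         (xn Om N (i - 1)) (xn Om N i)).

Definition inner (Om : rectangle) (N M : nat) (v w : broken) : R :=
  int_cells Om N M (fun i j x y => v i j x y * w i j x y).

Definition bnorm (Om : rectangle) (N M : nat) (v : broken) : R :=
  sqrt (inner Om N M v v).

(** * Traces, averages and jumps at x = x_{i+1/2} and y = y_{j+1/2} *)

Definition xminus (Om : rectangle) (N : nat) (v : broken) (i j : nat) (y : R) : R :=
  v i j (xn Om N i) y.
Definition xplus (Om : rectangle) (N : nat) (v : broken) (i j : nat) (y : R) : R :=
  if Nat.eqb i N then v 1%nat j (xn Om N 0) y else v (S i) j (xn Om N i) y.
Definition yminus (Om : rectangle) (M : nat) (v : broken) (i j : nat) (x : R) : R :=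
  v i j x (yn Om M j).
Definition yplus (Om : rectangle) (M : nat) (v : broken) (i j : nat) (x : R) : R :=
  if Nat.eqb j M then v i 1%nat x (yn Om M 0) else v i (S j) x (yn Om M j).

Definition xavg Om N v i j y := (xplus Om N v i j y + xminus Om N v i j y) / 2.
Definition xjump Om N v i j y := xplus Om N v i j y - xminus Om N v i j y.
Definition yavg Om M v i j x := (yplus Om M v i j x + yminus Om M v i j x) / 2.
Definition yjump Om M v i j x := yplus Om M v i j x - yminus Om M v i j x.

(** * The bilinear form and the scheme *)

Definition bilinA (Om : rectangle) (N M : nat) (w v : broken) : R :=
  int_cells Om N M (fun i j x y =>
      bDx w i j x y * bDx v i j x y + bDy w i j x y * bDy v i j x y)
  + sum_cells N M (fun i j =>
      RInt (fun y => xavg Om N (bDx w) i j y * xjump Om N v i j y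
                   + xavg Om N (bDx v) i j y * xjump Om N w i j y)
           (yn Om M (j - 1)) (yn Om M j))
  + sum_cells N M (fun i j =>
      RInt (fun x => yavg Om M (bDy w) i j x * yjump Om M v i j x
                   + yavg Om M (bDy v) i j x * yjump Om M w i j x)
           (xn Om N (i - 1)) (xn Om N i)).

Definition is_L2_projection (Om : rectangle) (N M k : nat)
    (f : R -> R -> R) (v : broken) : Prop :=
  in_Qh N M k v /\
  forall phi, in_Qh N M k phi ->
    inner Om N M v phi = inner Om N M (on_cells f) phi.

Definition fully_discrete_solution (Om : rectangle) (N M k : nat) (theta dt : R)
    (u0 : R -> R -> R) (uh qh : nat -> broken) : Prop :=
  is_L2_projection Om N M k u0 (uh 0%nat) /\
  (forall n, in_Qh N M k (uh n) /\ in_Qh N M k (qh n)) /\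
  (forall n phi, in_Qh N M k phi ->
     inner Om N M (bcomb (/ dt) (uh (S n)) (- / dt) (uh n)) phi
     = - bilinA Om N M (bcomb (1 - theta) (qh n) theta (qh (S n))) phi) /\
  (forall n psi, in_Qh N M k psi ->
     inner Om N M (qh n) psi = bilinA Om N M (uh n) psi).

(* Main.v *)
Require Import Defs.
From Stdlib Require Import Lra Lia ClassicalEpsilon.

(** In one variable, the projection on a cell integrates the L2 projection of the
    derivative and corrects it by the two polynomials whose derivatives represent the
    evaluations at the end points, weighted by the averages over adjacent cells of the
    derivative defect at the nodes.  Testing the error in the form [A] then leaves only
    the averages of its derivative at the nodes, and these are a multiple of second
    differences of the defects, hence of order h^(k+2).  The correction is local, and it
    also works for k = 1 on an even number of cells, where the projection with vanishing
    averages is not defined.  In two variables the tensor product is used: its error is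
    (w - Px w) + Px (w - Py w), and x and y play symmetric roles since Px and Py commute.

    With xi and zeta the differences between the projections of u and q = - Laplace u and
    the discrete solutions, testing the two error equations with their theta averages
    cancels A(zeta, xi), and the errors tested against zeta are absorbed by |zeta|^2; this
    gives a growth of |xi| by O(dt) times the consistency error per step.  The norms of u and
    q that occur are bounded by those of u_t = - Laplace^2 u by elliptic regularity and
    Poincare's inequality.  Time averages are estimated by duality, through scalar functions
    t |-> (u(t), v). *)

(** * Continuity and integration *)


(** The form has no penalty term and controls no jumps, so the only stability at hand is that of the
    L2 norm, and consistency errors have to be bounded by the L2 norm of the test function alone.
    The powers of h just suffice: a defect at a node is only of order h^k, its second difference
    gains two powers, and summing its products with the jumps of a test function over the nodes
    loses one. What remains is h^(k+1). Derivatives are counted as tightly. Consistency for q takes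
    order k+3 of q, hence k+5 of u: the four derivatives of Laplace^2 and the k+1 that are
    controlled for u_t. One term of the tensor-product error always has at least two derivatives in
    each variable; for the time averages of u_t this exceeds k+1 when k <= 2, and then the norm of
    u_tt = - Laplace^2 u_t has to take over. Throughout, m = k-1 is the degree of derivatives in one
    variable. Most bounds are uniform in the mesh and chosen before it, which explains the many
    statements that begin with a constant. *)

Definition cont {U : UniformSpace} (f : U -> R) : Prop := forall u, continuous f u.

Notation cont2 f := (cont (fun p : R * R => f (fst p) (snd p))).

Section Continuity.
Context {U : UniformSpace}.

Lemma cont_const (c : R) : cont (fun _ : U => c).
Proof. intros u; apply continuous_const. Qed.

Lemma cont_plus (f g : U -> R) : cont f -> cont g -> cont (fun u => f u + g u).
Proof. intros F G u. apply (continuous_plus (V := R_NormedModule)); [apply F | apply G]. Qed.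

Lemma cont_opp (f : U -> R) : cont f -> cont (fun u => - f u).
Proof. intros F u. apply (continuous_opp (V := R_NormedModule)); apply F. Qed.

Lemma cont_minus (f g : U -> R) : cont f -> cont g -> cont (fun u => f u - g u).
Proof. intros F G. apply cont_plus; [exact F | apply cont_opp, G]. Qed.

Lemma cont_mult (f g : U -> R) : cont f -> cont g -> cont (fun u => f u * g u).
Proof. intros F G u. apply (continuous_mult (K := R_AbsRing)); [apply F | apply G]. Qed.

Lemma cont_pow (f : U -> R) n : cont f -> cont (fun u => f u ^ n).
Proof.
  intros F; induction n as [|n IH]; simpl; [apply cont_const | apply cont_mult; assumption].
Qed.

Lemma cont_div_const (f : U -> R) c : cont f -> cont (fun u => f u / c).
Proof. intros F. apply cont_mult; [exact F | apply cont_const]. Qed.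

Lemma cont_sum_n_m (f : nat -> U -> R) m n :
  (forall i, (m <= i <= n)%nat -> cont (f i)) -> cont (fun u => sum_n_m (fun i => f i u) m n).
Proof.
  intros F u.
  destruct (Nat.le_gt_cases m n) as [mn|nm].
  - revert F; induction n as [|n IH]; intros F.
    + replace m with 0%nat by lia.
      apply continuous_ext with (f 0%nat); [intros; now rewrite sum_n_n | apply F; lia].
    + destruct (Nat.eq_dec m (S n)) as [->|d].
      * apply continuous_ext with (f (S n)); [intros; now rewrite sum_n_n | apply F; lia].
      * apply continuous_ext with (fun u => sum_n_m (fun i => f i u) m n + f (S n) u);
          [intros; symmetry; apply (sum_n_Sm (G := R_AbelianMonoid)); lia |].
        apply (continuous_plus (V := R_NormedModule)); [| apply F; lia].
        apply IH; [lia | intros; apply F; lia].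
  - apply continuous_ext with (fun _ => 0); [| apply continuous_const].
    intros; now rewrite sum_n_m_zero.
Qed.

Lemma cont_comp1 (g : R -> R) (a : U -> R) : cont g -> cont a -> cont (fun u => g (a u)).
Proof. intros G A u. apply continuous_comp; [apply A | apply G]. Qed.

Lemma cont_comp2 (g : R -> R -> R) (a b : U -> R) :
  cont2 g -> cont a -> cont b -> cont (fun u => g (a u) (b u)).
Proof. intros G A B u. apply continuous_comp_2; [apply A | apply B | apply G]. Qed.

Lemma cont_pair {V W : UniformSpace} (g : V * W -> R) (a : U -> V) (b : U -> W) :
  cont g -> (forall u, continuous a u) -> (forall u, continuous b u) ->
  cont (fun u => g (a u, b u)).
Proof.
  intros G A B u.
  apply (continuous_comp_2 a b (fun v w => g (v, w))); [apply A | apply B |].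
  apply continuous_ext with g; [intros []; reflexivity | apply G].
Qed.

(* By the tube lemma over the compact segment. *)
Lemma cont_RInt (f : U -> R -> R) a b :
  a <= b -> cont (fun p : U * R => f (fst p) (snd p)) -> cont (fun u => RInt (f u) a b).
Proof.
  intros ab F u.
  assert (Fu : forall v, cont (f v)).
  { intros v y. apply (continuous_comp (fun y => (v, y)) (fun p => f (fst p) (snd p))).
    - apply continuous_ext with (fun y => (v, y)); [reflexivity|].
      apply continuous_comp_2 with (f := fun _ : R => v) (g := fun y : R => y) (h := fun a b => (a, b));
        [apply continuous_const | apply continuous_id |].
      apply continuous_ext with (fun p : U * R => p); [now intros [] | apply continuous_id].
    - apply F. }
  assert (I : forall v, ex_RInt (f v) a b).
  { intros v. apply (ex_RInt_continuous (V := R_CompleteNormedModule)). intros; apply Fu. }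
  apply (proj2 (filterlim_locally _ _)). intros eps.
  (* Two comparisons with the centre of the tube give [2 * e] pointwise, hence at most [eps / 2] for
     the integral; the [+ 1] keeps the divisor positive when [a = b]. *)
  assert (e1 : 0 < eps / (4 * (b - a + 1))).
  { apply Rdiv_lt_0_compat; [apply eps | lra]. }
  set (e := mkposreal _ e1).
  (* The compactness theorem takes the radius as a function of the centre, so one is chosen at every
     [t]. *)
  assert (D : forall t : R, {d : posreal | forall v y, ball u d v -> Rabs (y - t) < d ->
              Rabs (f v y - f u t) < e}).
  { intros t. apply constructive_indefinite_description.
    destruct (proj1 (filterlim_locally _ _) (F (u, t)) e) as [d Hd].
    exists d. intros v y Hv Hy.
    apply (Hd (v, y)). split; [exact Hv | exact Hy]. }
  destruct (compactness_value_1d a b (fun t => proj1_sig (D t))) as [d Hd].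
  exists d. intros v Hv.
  assert (K : forall y, a <= y <= b -> Rabs (f v y - f u y) <= 2 * e).
  { intros y Hy. apply Rnot_lt_le; intros C. apply (Hd y Hy). intros (t & Ht & yt & dt).
    destruct (D t) as [dd P]; simpl in *.
    assert (Rabs (f v y - f u t) < e).
    { apply P; [|exact yt]. apply ball_le with d; [exact dt | exact Hv]. }
    assert (Rabs (f u y - f u t) < e).
    { apply P; [apply ball_center | exact yt]. }
    apply (Rlt_irrefl (2 * e)). apply Rlt_le_trans with (1 := C).
    replace (f v y - f u y) with ((f v y - f u t) - (f u y - f u t)) by ring.
    apply Rle_trans with (1 := Rabs_triang _ _). rewrite Rabs_Ropp. simpl in *; lra. }
  change (Rabs (RInt (f v) a b - RInt (f u) a b) < eps).
  rewrite <- (RInt_minus (V := R_CompleteNormedModule)) by apply I.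
  apply Rle_lt_trans with ((b - a) * (2 * e)).
  - apply abs_RInt_le_const; [exact ab | | exact K].
    apply (ex_RInt_minus (V := R_NormedModule)); apply I.
  - simpl. apply Rle_lt_trans with ((b - a + 1) * (2 * (eps / (4 * (b - a + 1))))).
    + apply Rmult_le_compat_r; [|lra]. simpl in e1; lra.
    + replace ((b - a + 1) * (2 * (eps / (4 * (b - a + 1))))) with (eps / 2) by (field; lra).
      destruct eps; simpl; lra.
Qed.

End Continuity.

Lemma cont_id : cont (fun x : R => x).
Proof. intros x; apply continuous_id. Qed.

Lemma cont_fst {U : UniformSpace} : cont (fun p : R * U => fst p).
Proof. intros p; apply continuous_fst. Qed.

Lemma cont_snd {U : UniformSpace} : cont (fun p : U * R => snd p).
Proof. intros p; apply continuous_snd. Qed.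

Lemma cont_proj1 {U V : UniformSpace} (g : U -> R) : cont g -> cont (fun p : U * V => g (fst p)).
Proof. intros G p. apply (continuous_comp fst g); [apply continuous_fst | apply G]. Qed.

Lemma cont_ext {U : UniformSpace} (f g : U -> R) : (forall u, f u = g u) -> cont f -> cont g.
Proof. intros E F u. apply continuous_ext with f; [exact E | apply F]. Qed.

Lemma cont2_swap (f : R -> R -> R) : cont2 f -> cont2 (fun x y => f y x).
Proof. intros F. apply (cont_comp2 f); [exact F | apply cont_snd | apply cont_fst]. Qed.

Lemma cont2_l (f : R -> R -> R) y : cont2 f -> cont (fun x => f x y).
Proof. intros F. apply (cont_comp2 f); [exact F | apply cont_id | apply cont_const]. Qed.

Lemma cont2_r (f : R -> R -> R) x : cont2 f -> cont (fun y => f x y).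
Proof. intros F. apply (cont_comp2 f); [exact F | apply cont_const | apply cont_id]. Qed.

Ltac cts :=
  lazymatch goal with
  | |- cont (fun _ => ?c) => apply cont_const
  | |- cont (fun u => u) => apply cont_id
  | |- cont (fun u => fst u) => apply cont_fst
  | |- cont fst => apply cont_fst
  | |- cont snd => apply cont_snd
  | |- cont (fun u => snd u) => apply cont_snd
  | |- cont (fun u => fst (fst u)) => apply (cont_proj1 (fun p => fst p)); cts
  | |- cont (fun u => snd (fst u)) => apply (cont_proj1 (fun p => snd p)); cts
  | |- cont (fun u => @?f u + @?g u) => apply (cont_plus f g); cts
  | |- cont (fun u => @?f u - @?g u) => apply (cont_minus f g); cts
  | |- cont (fun u => - @?f u) => apply (cont_opp f); cts
  | |- cont (fun u => @?f u * @?g u) => apply (cont_mult f g); cts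
  | |- cont (fun u => @?f u / ?c) => apply (cont_div_const f c); cts
  | |- cont (fun u => @?f u ^ ?n) => apply (cont_pow f n); cts
  | |- _ =>
    match goal with
    | H : ?P |- ?P => exact H
    | H : cont ?f |- cont (fun u => ?f (@?a u)) => apply (cont_comp1 f a H); cts
    | H : cont (fun p => ?f (fst p) (snd p)) |- cont (fun u => ?f (@?a u) (@?b u)) =>
        apply (cont_comp2 f a b H); cts
    | |- cont _ => idtac
    end
  end.

(** * Derivatives and Riemann integrals *)

Lemma deriv_plus (f g : R -> R) (x a b : R) :
  is_derive f x a -> is_derive g x b -> is_derive (fun x => f x + g x) x (a + b).
Proof. apply (is_derive_plus (K := R_AbsRing) (V := R_NormedModule)). Qed.

Lemma deriv_minus (f g : R -> R) (x a b : R) :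
  is_derive f x a -> is_derive g x b -> is_derive (fun x => f x - g x) x (a - b).
Proof. apply (is_derive_minus (K := R_AbsRing) (V := R_NormedModule)). Qed.

Lemma deriv_opp (f : R -> R) (x a : R) : is_derive f x a -> is_derive (fun x => - f x) x (- a).
Proof. apply (is_derive_opp (K := R_AbsRing) (V := R_NormedModule)). Qed.

Lemma deriv_scal (f : R -> R) (x c a : R) : is_derive f x a -> is_derive (fun x => c * f x) x (c * a).
Proof. apply is_derive_scal. Qed.

Lemma deriv_mult (f g : R -> R) (x a b : R) :
  is_derive f x a -> is_derive g x b -> is_derive (fun x => f x * g x) x (a * g x + f x * b).
Proof.
  intros F G. apply (is_derive_mult (K := R_AbsRing) f g x a b F G). intros; apply Rmult_comm.
Qed.

Lemma deriv_const (c x : R) : is_derive (fun _ : R => c) x 0.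
Proof. apply (is_derive_const (K := R_AbsRing) (V := R_NormedModule)). Qed.

Lemma deriv_id (x : R) : is_derive (fun x : R => x) x 1.
Proof. apply (is_derive_id (K := R_AbsRing)). Qed.

Lemma deriv_val (f : R -> R) (x a b : R) : is_derive f x a -> a = b -> is_derive f x b.
Proof. now intros D <-. Qed.

Lemma deriv_affine (f : R -> R) (a h x d : R) :
  is_derive f (a + h * x) d -> is_derive (fun x => f (a + h * x)) x (h * d).
Proof.
  intros F. apply (is_derive_comp (K := R_AbsRing) (V := R_NormedModule) f (fun x => a + h * x)); [exact F|].
  apply (deriv_val _ _ (0 + h * 1)); [|ring].
  apply deriv_plus; [apply deriv_const | apply deriv_scal, deriv_id].
Qed.

Lemma ex_integral (f : R -> R) a b : cont f -> ex_RInt f a b.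
Proof.
  intros F. apply (ex_RInt_continuous (V := R_CompleteNormedModule)). intros; apply F.
Qed.

Lemma integral_point (f : R -> R) a : RInt f a a = 0.
Proof. apply (RInt_point (V := R_CompleteNormedModule)). Qed.

Ltac rring := match goal with |- @eq _ ?x ?y => change (@eq R x y); ring end.

Section Integrals.
Variables (f g : R -> R) (a b : R).
Hypotheses (F : cont f) (G : cont g).

Lemma integral_plus : RInt (fun x => f x + g x) a b = RInt f a b + RInt g a b.
Proof. apply (RInt_plus (V := R_CompleteNormedModule)); now apply ex_integral. Qed.

Lemma integral_minus : RInt (fun x => f x - g x) a b = RInt f a b - RInt g a b.
Proof. apply (RInt_minus (V := R_CompleteNormedModule)); now apply ex_integral. Qed.

Lemma integral_scal c : RInt (fun x => c * f x) a b = c * RInt f a b.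
Proof. apply (RInt_scal (V := R_CompleteNormedModule)); now apply ex_integral. Qed.

Lemma integral_le : a <= b -> (forall x, a <= x <= b -> f x <= g x) -> RInt f a b <= RInt g a b.
Proof. intros ab H. apply RInt_le; [exact ab | now apply ex_integral | now apply ex_integral |]. intros; apply H; lra. Qed.

Lemma integral_ge0 : a <= b -> (forall x, a <= x <= b -> 0 <= f x) -> 0 <= RInt f a b.
Proof. intros ab H. apply RInt_ge_0; [exact ab | now apply ex_integral |]. intros; apply H; lra. Qed.

Lemma integral_chasles c : RInt f a b + RInt f b c = RInt f a c.
Proof. apply (RInt_Chasles (V := R_CompleteNormedModule)); now apply ex_integral. Qed.

Lemma integral_derive x : is_derive (fun x => RInt f a x) x (f x).
Proof.
  apply (is_derive_RInt (V := R_NormedModule) f _ a x); [|apply F].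
  apply filter_forall. intros z; apply (RInt_correct (V := R_CompleteNormedModule)), ex_integral, F.
Qed.

End Integrals.

Lemma integral_ext (f g : R -> R) a b :
  (forall x, f x = g x) -> RInt f a b = RInt g a b.
Proof. intros H. apply RInt_ext. intros; apply H. Qed.

Lemma integral_const c a b : RInt (fun _ => c) a b = (b - a) * c.
Proof. apply (RInt_const (V := R_CompleteNormedModule)). Qed.

Lemma integral_ftc (f df : R -> R) a b :
  (forall x, is_derive f x (df x)) -> cont df -> RInt df a b = f b - f a.
Proof.
  intros D C. apply is_RInt_unique. apply (is_RInt_derive (V := R_CompleteNormedModule) f);
    intros; [apply D | apply C].
Qed.

Lemma cont_of_derive (f df : R -> R) : (forall x, is_derive f x (df x)) -> cont f.
Proof.
  intros D x. apply (ex_derive_continuous (V := R_NormedModule) f). exists (df x); apply D.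
Qed.

Lemma integral_affine (f : R -> R) h a c d : cont f ->
  h * RInt (fun s => f (a + h * s)) c d = RInt f (a + h * c) (a + h * d).
Proof.
  intros F. rewrite <- integral_scal by (cts).
  rewrite (Rplus_comm a (h * c)), (Rplus_comm a (h * d)).
  rewrite <- (RInt_comp_lin (V := R_CompleteNormedModule) f) by now apply ex_integral.
  apply integral_ext; intros x. change (h * f (a + h * x) = h * f (h * x + a)). f_equal; f_equal; ring.
Qed.

Lemma integral_shift (f : R -> R) a b c : cont f -> RInt (fun s => f (c + s)) a b = RInt f (c + a) (c + b).
Proof.
  intros F. pose proof (integral_affine f 1 c a b F) as E.
  rewrite Rmult_1_l, !Rmult_1_l in E. rewrite <- E. apply integral_ext; intros x; f_equal; ring.
Qed.

Lemma integral_sum (f : nat -> R -> R) m n a b : (forall i, (m <= i <= n)%nat -> cont (f i)) ->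
  RInt (fun x => sum_n_m (fun i => f i x) m n) a b = sum_n_m (fun i => RInt (f i) a b) m n.
Proof.
  intros F. destruct (Nat.le_gt_cases m n) as [mn|nm].
  - revert F; induction n as [|n IH]; intros F.
    + replace m with 0%nat by lia. rewrite sum_n_n. apply integral_ext; intros; now rewrite sum_n_n.
    + destruct (Nat.eq_dec m (S n)) as [->|d].
      * rewrite sum_n_n. apply integral_ext; intros; now rewrite sum_n_n.
      * rewrite sum_n_Sm by lia. rewrite <- IH; [| lia | intros; apply F; lia].
        change (@plus R_AbelianMonoid) with Rplus.
        rewrite <- integral_plus; [| apply cont_sum_n_m; intros; apply F; lia | apply F; lia].
        apply integral_ext; intros x. apply (sum_n_Sm (G := R_AbelianMonoid)); lia.
  - rewrite sum_n_m_zero by lia. change zero with 0. rewrite <- (Rmult_0_r (b - a)), <- integral_const.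
    apply integral_ext; intros; now rewrite sum_n_m_zero.
Qed.

Lemma cont2_continuity_2d f x y : cont2 f -> continuity_2d_pt f x y.
Proof. intros F. apply continuity_2d_pt_filterlim, (F (x, y)). Qed.

Lemma integral_derive_param (f df : R -> R -> R) a b x :
  a <= b ->
  locally x (fun x => forall y, is_derive (fun z => f z y) x (df x y)) ->
  (forall x, cont (f x)) -> cont2 df ->
  is_derive (fun x => RInt (f x) a b) x (RInt (df x) a b).
Proof.
  intros ab D F DF.
  replace (RInt (df x) a b) with (RInt (fun t => Derive (fun u => f u t) x) a b).
  - apply is_derive_RInt_param.
    + revert D; apply filter_imp. intros z Hz t _. eexists; apply Hz.
    + intros t _. apply continuity_2d_pt_ext_loc with df.
      * destruct D as [d Hd]. exists d. intros u v Hu _. symmetry. apply is_derive_unique, Hd, Hu.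
      * apply cont2_continuity_2d, DF.
    + apply filter_forall. intros; now apply ex_integral.
  - apply integral_ext; intros t. apply is_derive_unique. apply (locally_singleton _ _ D).
Qed.

(** Seen as functions of the upper limit in [x], both sides vanish at [a] and have the same
    derivative. *)
Lemma fubini (f : R -> R -> R) a b c d : a <= b -> c <= d -> cont2 f ->
  RInt (fun x => RInt (fun y => f x y) c d) a b = RInt (fun y => RInt (fun x => f x y) a b) c d.
Proof.
  intros ab cd F.
  destruct (Rle_lt_or_eq_dec a b ab) as [lt| ->].
  2:{ rewrite integral_point. symmetry. rewrite <- (Rmult_0_r (d - c)), <- integral_const.
      apply integral_ext; intros; apply integral_point. }
  set (P := fun t => RInt (fun x => RInt (fun y => f x y) c d) a t
                     - RInt (fun y => RInt (fun x => f x y) a t) c d).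
  assert (E : P a = P b).
  { apply (eq_is_derive (V := R_NormedModule)); [|exact lt]. intros t Ht.
    apply (deriv_val _ _ (RInt (fun y => f t y) c d - RInt (fun y => f t y) c d)); [|apply Rminus_diag].
    apply deriv_minus.
    - apply (integral_derive (fun x => RInt (fun y => f x y) c d)). now apply cont_RInt.
    - apply (integral_derive_param (fun t y => RInt (fun x => f x y) a t)); [exact cd | | | exact F].
      + apply filter_forall. intros z y. apply (integral_derive (fun x => f x y)). now apply cont2_l.
      (* Continuity is asked for every upper limit [z], also to the left of [a], where the
         orientation is reversed. *)
      + intros z. destruct (Rle_dec a z) as [az|az].
        * apply (cont_RInt (fun y x => f x y)); [exact az|]. now apply cont2_swap.
        * apply cont_ext with (fun y => - RInt (fun x => f x y) z a).
          { intros y. pose proof (integral_chasles (fun x => f x y) z a (cont2_l f y F) z) as E.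
            rewrite integral_point in E. lra. }
          apply cont_opp. apply (cont_RInt (fun y x => f x y)); [lra|]. now apply cont2_swap. }
  unfold P in E. rewrite integral_point in E.
  rewrite (integral_ext (fun y => RInt (fun x => f x y) a a) (fun _ => 0)) in E by (intros; apply integral_point).
  rewrite integral_const in E. lra.
Qed.

(* Equivalent to [X ^ 2 <= P * V] with [P] and [V] nonnegative, but linear in (P, X, V),
   hence stable under sums and integrals. *)
Definition quad_ge0 (P X V : R) : Prop := forall t, 0 <= P * t ^ 2 + 2 * X * t + V.

(** For [P > 0] this is the value at the minimum; [P = 0] forces [X = 0], and [P < 0] contradicts
    nonnegativity far out. *)
Lemma quad_ge0_le P X V : quad_ge0 P X V -> X ^ 2 <= P * V.
Proof.
  intros H. pose proof (H 0) as H0.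
  destruct (Rtotal_order P 0) as [p|[p|p]].
  - exfalso. assert (V0 : 0 <= V) by lra.
    pose proof (H ((2 * Rabs X + V + 1) / - P)) as H1.
    set (s := (2 * Rabs X + V + 1) / - P) in *.
    assert (Es : s * - P = 2 * Rabs X + V + 1) by (unfold s; field; lra).
    assert (X <= Rabs X) by apply Rle_abs. assert (0 <= Rabs X) by apply Rabs_pos.
    assert (0 < s) by (apply Rdiv_lt_0_compat; lra).
    assert (P * s ^ 2 = - (2 * Rabs X + V + 1) * s) by (rewrite <- Es; ring).
    (* At [s] the quadratic may still be nonnegative if [s < 1]; at [s + 1] it is negative in all
       cases. *)
    pose proof (H (s + 1)) as Hs1.
    assert (P * (s + 1) ^ 2 = - (2 * Rabs X + V + 1) * s + 2 * P * s + P) by (rewrite <- Es; ring).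
    nra.
  - subst P. assert (X = 0); [|subst; lra].
    destruct (Req_dec X 0) as [|nz]; [assumption|].
    pose proof (H (- (V + 1) / (2 * X))) as H1.
    replace (2 * X * (- (V + 1) / (2 * X))) with (- (V + 1)) in H1 by (field; assumption).
    lra.
  - pose proof (H (- X / P)) as H1.
    replace (P * (- X / P) ^ 2 + 2 * X * (- X / P) + V) with ((P * V - X ^ 2) / P) in H1 by (field; lra).
    apply Rnot_lt_le; intros C.
    assert ((P * V - X ^ 2) / P < 0); [|lra].
    apply Ropp_lt_cancel. rewrite Ropp_0. unfold Rdiv.
    rewrite <- Ropp_mult_distr_l_reverse. apply Rdiv_lt_0_compat; lra.
Qed.

Lemma le_quad_ge0 P X V : 0 <= P -> 0 <= V -> X ^ 2 <= P * V -> quad_ge0 P X V.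
Proof.
  intros p v H t.
  destruct (Req_dec P 0) as [->|nz].
  - assert (X = 0) by nra. subst; lra.
  - assert (0 < P) by lra.
    apply Rmult_le_reg_l with P; [assumption|]. rewrite Rmult_0_r.
    assert (0 <= (P * t + X) ^ 2) by apply pow2_ge_0. nra.
Qed.

Lemma quad_ge0_mono P X V P' V' : quad_ge0 P X V -> P <= P' -> V <= V' -> quad_ge0 P' X V'.
Proof. intros H p v t. specialize (H t). assert (0 <= t ^ 2) by apply pow2_ge_0. nra. Qed.

Lemma quad_ge0_int (P X V : R -> R) a b : a <= b -> cont P -> cont X -> cont V ->
  (forall x, a <= x <= b -> quad_ge0 (P x) (X x) (V x)) -> quad_ge0 (RInt P a b) (RInt X a b) (RInt V a b).
Proof.
  intros ab p x v H t.
  replace (RInt P a b * t ^ 2 + 2 * RInt X a b * t + RInt V a b)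
    with (RInt (fun s => t ^ 2 * P s + 2 * t * X s + V s) a b).
  - apply integral_ge0; [cts | exact ab |]. intros s Hs. specialize (H s Hs t). lra.
  - rewrite integral_plus, integral_plus, !integral_scal by cts. rring.
Qed.

Lemma quad_ge0_0 : quad_ge0 0 0 0.
Proof. intros t; lra. Qed.

Lemma quad_ge0_plus P X V P' X' V' : quad_ge0 P X V -> quad_ge0 P' X' V' -> quad_ge0 (P + P') (X + X') (V + V').
Proof. intros H H' t. specialize (H t); specialize (H' t). lra. Qed.

Lemma integral_cauchy_schwarz (f g : R -> R) a b : a <= b -> cont f -> cont g ->
  (RInt (fun x => f x * g x) a b) ^ 2 <= RInt (fun x => f x ^ 2) a b * RInt (fun x => g x ^ 2) a b.
Proof.
  intros ab F G. apply quad_ge0_le, quad_ge0_int; [exact ab | cts | cts | cts |].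
  intros x _. apply le_quad_ge0; [apply pow2_ge_0 | apply pow2_ge_0 | apply Req_le; ring].
Qed.

(** * Finite sums *)

Notation sumr N F := (sum_n_m (G := R_AbelianMonoid) F 1 N : R).


Section Sumr.
Implicit Types F G : nat -> R.

Lemma sumr0 F : sumr 0 F = 0.
Proof. now rewrite sum_n_m_zero by lia. Qed.

Lemma sumrS N F : sumr (S N) F = sumr N F + F (S N).
Proof.
  destruct N as [|N].
  - rewrite sumr0, sum_n_n. rring.
  - now rewrite sum_n_Sm by lia.
Qed.

Lemma sumr_ext N F G : (forall i, (1 <= i <= N)%nat -> F i = G i) -> sumr N F = sumr N G.
Proof. intros H. apply sum_n_m_ext_loc, H. Qed.

Lemma sumr_plus N F G : sumr N (fun i => F i + G i) = sumr N F + sumr N G.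
Proof. apply (sum_n_m_plus (G := R_AbelianMonoid)). Qed.

Lemma sumr_scal N c F : sumr N (fun i => c * F i) = c * sumr N F.
Proof. induction N as [|N IH]; [rewrite !sumr0; rring | rewrite !sumrS, IH; rring]. Qed.

Lemma sumr_minus N F G : sumr N (fun i => F i - G i) = sumr N F - sumr N G.
Proof. induction N as [|N IH]; [rewrite !sumr0; rring | rewrite !sumrS, IH; rring]. Qed.

Lemma sumr_le N F G : (forall i, (1 <= i <= N)%nat -> F i <= G i) -> sumr N F <= sumr N G.
Proof.
  intros H. induction N as [|N IH]; [rewrite !sumr0; lra | rewrite !sumrS].
  apply Rplus_le_compat; [apply IH; intros; apply H; lia | apply H; lia].
Qed.

Lemma sumr_ge0 N F : (forall i, (1 <= i <= N)%nat -> 0 <= F i) -> 0 <= sumr N F.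
Proof.
  intros H. induction N as [|N IH]; [rewrite sumr0; lra | rewrite sumrS].
  apply Rplus_le_le_0_compat; [apply IH; intros; apply H; lia | apply H; lia].
Qed.

Lemma sumr_swap N M (F : nat -> nat -> R) :
  sumr N (fun i => sumr M (fun j => F i j)) = sumr M (fun j => sumr N (fun i => F i j)).
Proof.
  induction N as [|N IH].
  - rewrite sumr0. rewrite (sumr_ext M _ (fun j => 0 * 0)) by (intros; rewrite sumr0; rring).
    rewrite sumr_scal; rring.
  - rewrite sumrS, IH, <- sumr_plus. apply sumr_ext; intros; now rewrite sumrS.
Qed.

Lemma sumr_quad_ge0 N P X V : (forall i, (1 <= i <= N)%nat -> quad_ge0 (P i) (X i) (V i)) ->
  quad_ge0 (sumr N P) (sumr N X) (sumr N V).
Proof.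
  induction N as [|N IH]; intros H; [rewrite !sumr0; apply quad_ge0_0 | rewrite !sumrS].
  apply quad_ge0_plus; [apply IH; intros; apply H; lia | apply H; lia].
Qed.

End Sumr.

Lemma integral_cells (f : R -> R) a h N : cont f ->
  sumr N (fun i => RInt f (a + INR (i - 1) * h) (a + INR i * h)) = RInt f a (a + INR N * h).
Proof.
  intros F. induction N as [|N IH].
  - rewrite sumr0. simpl. rewrite Rmult_0_l, Rplus_0_r. symmetry; apply integral_point.
  - rewrite sumrS, IH. replace (S N - 1)%nat with N by lia. now apply integral_chasles.
Qed.

Notation sum0 m F := (sum_n (G := R_AbelianMonoid) F m : R).

Section Sums.
Implicit Types F G : nat -> R.

Lemma sum0_0 F : sum0 0 F = F 0%nat.
Proof. apply (sum_O (G := R_AbelianMonoid)). Qed.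

Lemma sum0_S m F : sum0 (S m) F = sum0 m F + F (S m).
Proof. apply (sum_Sn (G := R_AbelianMonoid)). Qed.

Lemma sum0_ext m F G : (forall i, (i <= m)%nat -> F i = G i) -> sum0 m F = sum0 m G.
Proof. apply (sum_n_ext_loc (G := R_AbelianMonoid)). Qed.

Lemma sum0_plus m F G : sum0 m (fun i => F i + G i) = sum0 m F + sum0 m G.
Proof. apply (sum_n_plus (G := R_AbelianMonoid)). Qed.

Lemma sum0_scal m c F : sum0 m (fun i => c * F i) = c * sum0 m F.
Proof. induction m as [|m IH]; [now rewrite !sum0_0 | rewrite !sum0_S, IH; rring]. Qed.

Lemma sum0_minus m F G : sum0 m (fun i => F i - G i) = sum0 m F - sum0 m G.
Proof. induction m as [|m IH]; [now rewrite !sum0_0 | rewrite !sum0_S, IH; rring]. Qed.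

Lemma sum0_le m F G : (forall i, (i <= m)%nat -> F i <= G i) -> sum0 m F <= sum0 m G.
Proof.
  intros H. induction m as [|m IH]; [rewrite !sum0_0; now apply H|]. rewrite !sum0_S.
  apply Rplus_le_compat; [apply IH; intros; apply H; lia | now apply H].
Qed.

Lemma sum0_ge0 m F : (forall i, (i <= m)%nat -> 0 <= F i) -> 0 <= sum0 m F.
Proof.
  intros H. induction m as [|m IH]; [rewrite !sum0_0; now apply H|]. rewrite !sum0_S.
  apply Rplus_le_le_0_compat; [apply IH; intros; apply H; lia | now apply H].
Qed.

Lemma sum0_term m F i : (i <= m)%nat -> (forall i, (i <= m)%nat -> 0 <= F i) -> F i <= sum0 m F.
Proof.
  intros im H. induction m as [|m IH].
  - replace i with 0%nat by lia. rewrite sum0_0. lra.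
  - rewrite sum0_S. destruct (Nat.eq_dec i (S m)) as [->|d].
    + assert (0 <= sum0 m F) by (apply sum0_ge0; intros; apply H; lia). lra.
    + assert (0 <= F (S m)) by (apply H; lia).
      assert (F i <= sum0 m F) by (apply IH; [lia | intros; apply H; lia]). lra.
Qed.

Lemma sum0_quad_ge0 m P X V : (forall i, (i <= m)%nat -> quad_ge0 (P i) (X i) (V i)) ->
  quad_ge0 (sum0 m P) (sum0 m X) (sum0 m V).
Proof.
  induction m as [|m IH]; intros H; [rewrite !sum0_0; now apply H | rewrite !sum0_S].
  apply quad_ge0_plus; [apply IH; intros; apply H; lia | now apply H].
Qed.

Lemma sum0_delta m F i : (i <= m)%nat -> sum0 m (fun j => if Nat.eqb i j then F j else 0) = F i.
Proof.
  intros im. induction m as [|m IH].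
  - replace i with 0%nat by lia. now rewrite sum0_0.
  - rewrite sum0_S. destruct (Nat.eqb_spec i (S m)) as [->|d].
    + rewrite (sum0_ext m _ (fun j => 0 * 0)).
      * rewrite sum0_scal. ring.
      * intros j jm. destruct (Nat.eqb_spec (S m) j); [lia | ring].
    + rewrite IH by lia. ring.
Qed.

Lemma sum0_0s m : sum0 m (fun _ => 0) = 0.
Proof. rewrite (sum0_ext m _ (fun _ => 0 * 0)) by (intros; ring). rewrite sum0_scal. ring. Qed.

Lemma cont_sum0 {U : UniformSpace} m (f : nat -> U -> R) :
  (forall i, (i <= m)%nat -> cont (f i)) -> cont (fun u => sum0 m (fun i => f i u)).
Proof. intros H. apply cont_sum_n_m. intros; apply H; lia. Qed.

Lemma integral_sum0 (f : nat -> R -> R) m a b : (forall i, (i <= m)%nat -> cont (f i)) ->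
  RInt (fun x => sum0 m (fun i => f i x)) a b = sum0 m (fun i => RInt (f i) a b).
Proof. intros H. apply integral_sum. intros; apply H; lia. Qed.

Lemma deriv_sum0 m (f : nat -> R -> R) (d : nat -> R) x :
  (forall i, (i <= m)%nat -> is_derive (f i) x (d i)) ->
  is_derive (fun x => sum0 m (fun i => f i x)) x (sum0 m d).
Proof.
  intros H. induction m as [|m IH].
  - rewrite sum0_0. apply is_derive_ext with (f 0%nat); [intros; symmetry; apply sum0_0 | now apply H].
  - rewrite sum0_S. apply is_derive_ext with (fun x => sum0 m (fun i => f i x) + f (S m) x).
    + intros; symmetry; apply sum0_S.
    + apply deriv_plus; [apply IH; intros; apply H; lia | now apply H].
Qed.

Lemma sum0_swap m n (F : nat -> nat -> R) :
  sum0 m (fun i => sum0 n (fun j => F i j)) = sum0 n (fun j => sum0 m (fun i => F i j)).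
Proof. apply (sum_n_switch (G := R_AbelianMonoid)). Qed.
End Sums.

(** * Polynomials *)

(** Horner form: inductions on the degree peel off the constant coefficient, and multiplication by
    [x] is the successor step. *)
Fixpoint isP (k : nat) (p : R -> R) : Prop :=
  match k with
  | 0%nat => exists c, forall x, p x = c
  | S k => exists c q, isP k q /\ forall x, p x = c + x * q x
  end.

Lemma isP_ext k p q : (forall x, p x = q x) -> isP k p -> isP k q.
Proof.
  destruct k as [|k]; intros E; simpl.
  - intros [c H]. exists c. intros; now rewrite <- E.
  - intros (c & r & R1 & H). exists c, r. split; [exact R1 |]. intros; now rewrite <- E.
Qed.

Lemma isP_const k c : isP k (fun _ => c).
Proof.
  revert c; induction k as [|k IH]; intros c; simpl.
  - now exists c.
  - exists c, (fun _ => 0). split; [apply IH | intros; ring].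
Qed.

Lemma isP_plus k p q : isP k p -> isP k q -> isP k (fun x => p x + q x).
Proof.
  revert p q; induction k as [|k IH]; simpl; intros p q.
  - intros [c H] [d K]. exists (c + d). intros; now rewrite H, K.
  - intros (c & r & R1 & H) (d & s & S1 & K). exists (c + d), (fun x => r x + s x).
    split; [now apply IH | intros; rewrite H, K; ring].
Qed.

Lemma isP_scal k c p : isP k p -> isP k (fun x => c * p x).
Proof.
  revert p; induction k as [|k IH]; simpl; intros p.
  - intros [d H]. exists (c * d). intros; now rewrite H.
  - intros (d & r & R1 & H). exists (c * d), (fun x => c * r x).
    split; [now apply IH | intros; rewrite H; ring].
Qed.

Lemma isP_minus k p q : isP k p -> isP k q -> isP k (fun x => p x - q x).
Proof.
  intros P Q. apply isP_ext with (fun x => p x + (-1) * q x); [intros; ring|].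
  apply isP_plus; [exact P | now apply isP_scal].
Qed.

Lemma isP_S k p : isP k p -> isP (S k) p.
Proof.
  revert p; induction k as [|k IH]; intros p.
  - intros [c H]. exists c, (fun _ => 0). split; [now exists 0 | intros; rewrite H; ring].
  - intros (c & q & Q & H). exists c, q. split; [now apply IH | exact H].
Qed.

Lemma isP_le k m p : (k <= m)%nat -> isP k p -> isP m p.
Proof. induction 1; [easy | intros; now apply isP_S, IHle]. Qed.

Lemma isP_mulx k p : isP k p -> isP (S k) (fun x => x * p x).
Proof. intros P. exists 0, p. split; [exact P | intros; ring]. Qed.

Lemma isP_affine k p a h : isP k p -> isP k (fun x => p (a + h * x)).
Proof.
  revert p; induction k as [|k IH]; intros p.
  - intros [c H]. exists c. intros; apply H.
  - intros (c & q & Q & H).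
    apply isP_ext with (fun x => c + (a * q (a + h * x) + h * (x * q (a + h * x)))).
    + intros x. rewrite H. ring.
    + specialize (IH _ Q). apply isP_plus; [apply isP_const|]. apply isP_plus.
      * now apply isP_S, isP_scal.
      * now apply isP_scal, isP_mulx.
Qed.

Lemma isP_pow k : isP k (fun x => x ^ k).
Proof. induction k as [|k IH]; [now exists 1 | now apply isP_mulx]. Qed.

Lemma isP_sum0 k m (f : nat -> R -> R) : (forall i, (i <= m)%nat -> isP k (f i)) ->
  isP k (fun x => sum0 m (fun i => f i x)).
Proof.
  induction m as [|m IH]; intros H.
  - apply isP_ext with (f 0%nat); [intros; now rewrite sum0_0 | now apply H].
  - apply isP_ext with (fun x => sum0 m (fun i => f i x) + f (S m) x).
    + intros; now rewrite sum0_S.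
    + apply isP_plus; [apply IH; intros; apply H; lia | now apply H].
Qed.

(** Horner form exposes the constant coefficient; Gram-Schmidt needs the leading one. *)
Lemma isP_lead k p : isP (S k) p -> exists c q, isP k q /\ forall x, p x = c * x ^ S k + q x.
Proof.
  revert p; induction k as [|k IH]; intros p (c & q & Q & H).
  - destruct Q as [d K]. exists d, (fun _ => c). split; [now exists c|].
    intros x. rewrite H, K. simpl; ring.
  - destruct (IH _ Q) as (d & r & R1 & K). exists d, (fun x => c + x * r x). split.
    + now exists c, r.
    + intros x. rewrite H, K. simpl; ring.
Qed.

Lemma isP_coef k p : isP k p -> exists c, forall x, p x = sum0 k (fun a => c a * x ^ a).
Proof.
  revert p; induction k as [|k IH]; intros p.
  - intros [c H]. exists (fun _ => c). intros x. rewrite H, sum0_0. simpl; ring.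
  - intros P. destruct (isP_lead k p P) as (c & q & Q & H). destruct (IH _ Q) as [d K].
    exists (fun a => if Nat.eqb a (S k) then c else d a). intros x.
    rewrite H, K, sum0_S, Nat.eqb_refl.
    rewrite (sum0_ext k (fun a => (if Nat.eqb a (S k) then c else d a) * x ^ a) (fun a => d a * x ^ a)).
    + rring.
    + intros i Hi. destruct (Nat.eqb_spec i (S k)); [lia | reflexivity].
Qed.

Lemma isP_derive k p : isP (S k) p -> exists q, isP k q /\ forall x, is_derive p x (q x).
Proof.
  revert p; induction k as [|k IH]; intros p (c & q & Q & H).
  - destruct Q as [d K]. exists (fun _ => d). split; [now exists d|].
    intros x. apply is_derive_ext with (fun x => c + d * x).
    + intros t. rewrite H, K. apply Rplus_eq_compat_l, Rmult_comm.
    + apply (deriv_val _ _ (0 + d * 1)); [|ring]. apply deriv_plus; [apply deriv_const | apply deriv_scal, deriv_id].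
  - destruct (IH _ Q) as (r & R1 & K). exists (fun x => q x + x * r x). split.
    + apply isP_plus; [exact Q | now apply isP_mulx].
    + intros x. apply is_derive_ext with (fun x => c + x * q x); [intros; now rewrite H|].
      apply (deriv_val _ _ (0 + (1 * q x + x * r x))); [|ring].
      apply deriv_plus; [apply deriv_const | apply deriv_mult; [apply deriv_id | apply K]].
Qed.

Lemma isP_ex_derive k p x : isP k p -> ex_derive p x.
Proof.
  intros P. apply isP_S in P. destruct (isP_derive k p P) as (q & _ & H). eexists; apply H.
Qed.

Lemma isP_Derive k p : isP (S k) p -> isP k (Derive p).
Proof.
  intros P. destruct (isP_derive k p P) as (q & Q & H). apply isP_ext with q; [|exact Q].
  intros x. symmetry. apply is_derive_unique, H.
Qed.

Lemma isP_is_derive k p x : isP k p -> is_derive p x (Derive p x).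
Proof. intros P. apply Derive_correct. now apply isP_ex_derive with k. Qed.

Lemma isP_cont k p : isP k p -> cont p.
Proof. intros P. apply (cont_of_derive p (Derive p)). intros; now apply isP_is_derive with k. Qed.

(** The power [x ^ m] makes the induction work: Horner's rule moves one factor [x] after another
    from [q] into it. *)
Lemma isP_primitive k m q : isP k q ->
  exists Q, isP k Q /\ forall x, is_derive (fun x => x ^ S m * Q x) x (x ^ m * q x).
Proof.
  assert (N : forall m x, is_derive (fun x => x ^ S m) x (INR (S m) * x ^ m)).
  { intros n x. apply (deriv_val _ _ (INR (S n) * 1 * x ^ pred (S n))); [|simpl pred; ring].
    apply (is_derive_pow (fun x => x)), deriv_id. }
  assert (Z : forall m, INR (S m) <> 0) by (intros; now apply not_0_INR).
  revert m q; induction k as [|k IH]; intros m q.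
  - intros [c H]. exists (fun _ => c / INR (S m)). split; [now exists (c / INR (S m))|].
    intros x. rewrite H.
    apply (deriv_val _ _ (INR (S m) * x ^ m * (c / INR (S m)) + x ^ S m * 0)); [|field; apply Z].
    apply (deriv_mult (fun x => x ^ S m) (fun _ => c / INR (S m))); [apply N | apply deriv_const].
  - intros (c & r & R1 & H). destruct (IH (S m) r R1) as (Q1 & P1 & K).
    exists (fun x => c / INR (S m) + x * Q1 x). split; [now exists (c / INR (S m)), Q1|].
    intros x. apply is_derive_ext with (fun x => x ^ S m * (c / INR (S m)) + x ^ S (S m) * Q1 x).
    + intros t. simpl. ring.
    + apply (deriv_val _ _ ((INR (S m) * x ^ m * (c / INR (S m)) + x ^ S m * 0) + x ^ S m * r x)).
      * apply (deriv_plus (fun t => t ^ S m * (c / INR (S m))) (fun t => t ^ S (S m) * Q1 t)); [|apply K].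
        apply (deriv_mult (fun x => x ^ S m) (fun _ => c / INR (S m))); [apply N | apply deriv_const].
      * rewrite H. simpl pow. field. apply Z.
Qed.

Lemma isP_RInt k q : isP k q -> isP (S k) (fun x => RInt q 0 x).
Proof.
  intros P. destruct (isP_primitive k 0 q P) as (Q & PQ & H).
  apply isP_ext with (fun x => x * Q x); [|now apply isP_mulx].
  intros x. rewrite (integral_ftc (fun x => x ^ 1 * Q x)).
  - simpl. rring.
  - intros y. apply (deriv_val _ _ _ _ (H y)). simpl; ring.
  - now apply isP_cont with k.
Qed.

(** Differentiation lowers the degree on both sides until a nonconstant linear function would be
    constant. The identity is confined to the open interval because that is where [integral_eq0]
    delivers it. *)
Lemma pow_not_isP m c q : c <> 0 -> isP m q -> ~ (forall x, 0 < x < 1 -> c * x ^ S m = q x).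
Proof.
  revert c q; induction m as [|m IH]; intros c q nz P H.
  - destruct P as [d K]. pose proof (H (1/2) ltac:(lra)) as H1. pose proof (H (1/3) ltac:(lra)) as H2.
    rewrite K in H1, H2. simpl in *. lra.
  - destruct (isP_derive m q P) as (r & R1 & D).
    assert (NZ : INR (S (S m)) <> 0) by now apply not_0_INR.
    apply (IH (c * INR (S (S m))) r); [now apply Rmult_integral_contrapositive | exact R1 |].
    intros x Hx. rewrite <- (is_derive_unique _ _ _ (D x)). symmetry.
    rewrite (Derive_ext_loc q (fun x => c * x ^ S (S m))).
    + apply is_derive_unique.
      apply (deriv_val _ _ (c * (INR (S (S m)) * 1 * x ^ pred (S (S m))))); [|simpl pred; ring].
      apply deriv_scal. apply (is_derive_pow (fun x => x)), deriv_id.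
    + apply (locally_interval _ x 0 1); simpl; [lra | lra |]. intros y y0 y1. symmetry; apply H. lra.
Qed.

(** The integral over every initial piece vanishes as well, and the integrand is its derivative. *)
Lemma integral_eq0 (f : R -> R) x : cont f -> (forall x, 0 <= f x) -> RInt f 0 1 = 0 -> 0 < x < 1 -> f x = 0.
Proof.
  intros F P Z Hx.
  assert (E : forall t, 0 < t < 1 -> RInt f 0 t = 0).
  { intros t Ht. apply Rle_antisym.
    - pose proof (integral_chasles f 0 t F 1).
      assert (0 <= RInt f t 1) by (apply integral_ge0; [exact F | lra | intros; apply P]). lra.
    - apply integral_ge0; [exact F | lra | intros; apply P]. }
  rewrite <- (is_derive_unique _ _ _ (integral_derive f 0 F x)).
  rewrite (Derive_ext_loc _ (fun _ => 0)); [apply Derive_const|].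
  apply (locally_interval _ x 0 1); simpl; [lra | lra |]. intros y y0 y1; apply E; lra.
Qed.

(** * Orthonormal polynomials on the unit interval *)

Definition dot (f g : R -> R) : R := RInt (fun x => f x * g x) 0 1.

(** The expansion formula is part of the definition; it replaces an argument by dimension. *)
Definition onb (m : nat) (p : nat -> R -> R) : Prop :=
  (forall i, isP m (p i)) /\
  (forall i j, (i <= m)%nat -> (j <= m)%nat -> dot (p i) (p j) = if Nat.eqb i j then 1 else 0) /\
  (forall q, isP m q -> forall x, q x = sum0 m (fun i => dot q (p i) * p i x)).

Lemma dot_plus (f g q : R -> R) : cont f -> cont g -> cont q -> dot (fun x => f x + g x) q = dot f q + dot g q.
Proof.
  intros F G Q. unfold dot. rewrite <- integral_plus by cts. apply integral_ext; intros; ring.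
Qed.

Lemma dot_scal c (f q : R -> R) : cont f -> cont q -> dot (fun x => c * f x) q = c * dot f q.
Proof.
  intros F Q. unfold dot. rewrite <- integral_scal by cts. apply integral_ext; intros; ring.
Qed.

Lemma dot_minus (f g q : R -> R) : cont f -> cont g -> cont q -> dot (fun x => f x - g x) q = dot f q - dot g q.
Proof.
  intros F G Q. unfold dot. rewrite <- integral_minus by cts. apply integral_ext; intros; ring.
Qed.

Lemma dot_sym f g : dot f g = dot g f.
Proof. apply integral_ext; intros; ring. Qed.

Lemma dot_sum0 m (f : nat -> R -> R) q : (forall i, (i <= m)%nat -> cont (f i)) -> cont q ->
  dot (fun x => sum0 m (fun i => f i x)) q = sum0 m (fun i => dot (f i) q).
Proof.
  intros F Q. unfold dot. rewrite <- (integral_sum0 (fun i x => f i x * q x)).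
  - apply integral_ext; intros x. rewrite Rmult_comm, <- sum0_scal. apply sum0_ext; intros; ring.
  - intros i im. specialize (F i im). cts.
Qed.

Lemma dot_ext f g q : (forall x, f x = g x) -> dot f q = dot g q.
Proof. intros H. apply integral_ext; intros; now rewrite H. Qed.

(** One Gram-Schmidt step per degree: the part of the next power orthogonal to the lower degrees is
    normalized. It does not vanish by [pow_not_isP]. *)
Lemma onb_exists m : exists p, onb m p.
Proof.
  induction m as [|m [p (P & O & Sp)]].
  - exists (fun _ _ => 1). split; [|split].
    + intros; now exists 1.
    + intros [|i] [|j] Hi Hj; try lia. unfold dot. rewrite integral_const. simpl. ring.
    + intros q [c Q] x. rewrite sum0_0. unfold dot.
      rewrite (integral_ext _ (fun _ => c)) by (intros; rewrite Q; ring). rewrite integral_const, Q. rring.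
  - assert (CP : forall i, cont (p i)) by (intros i; apply (isP_cont m), P).
    pose (M := fun x : R => x ^ S m). assert (CM : cont M) by (unfold M; cts).
    pose (q := fun x => sum0 m (fun i => dot M (p i) * p i x)).
    assert (PQ : isP m q) by (apply isP_sum0; intros i im; now apply isP_scal, P).
    assert (CQ : cont q) by (apply (isP_cont m), PQ).
    pose (r := fun x => M x - q x).
    assert (PR : isP (S m) r) by (apply isP_minus; [apply isP_pow | now apply isP_S]).
    assert (CR : cont r) by (apply (isP_cont (S m)), PR).
    assert (Qp : forall i, (i <= m)%nat -> dot q (p i) = dot M (p i)).
    { intros i im. unfold q. rewrite (dot_sum0 m (fun i x => dot M (p i) * p i x)).
      - rewrite (sum0_ext m _ (fun j => if Nat.eqb i j then dot M (p j) else 0)).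
        + now apply sum0_delta.
        + intros j jm. rewrite dot_scal by auto. rewrite O by assumption.
          rewrite Nat.eqb_sym. destruct (Nat.eqb i j); ring.
      - intros j jm. specialize (CP j). cts.
      - auto. }
    assert (Rp : forall i, (i <= m)%nat -> dot r (p i) = 0).
    { intros i im. unfold r. rewrite dot_minus, Qp by auto. ring. }
    assert (RR : 0 < dot r r).
    { assert (0 <= dot r r).
      { apply integral_ge0; [cts | lra | intros; apply Rle_0_sqr]. }
      destruct (Req_dec (dot r r) 0) as [Z|]; [exfalso | lra].
      apply (pow_not_isP m 1 q); [lra | exact PQ |]. intros x Hx.
      assert (r x * r x = 0).
      { apply (integral_eq0 (fun x => r x * r x) x); [cts | intros; apply Rle_0_sqr | exact Z | exact Hx]. }
      assert (r x = 0) by nra. unfold r, M in *. lra. }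
    set (n := / sqrt (dot r r)).
    assert (N2 : n * n * dot r r = 1).
    { unfold n. rewrite <- (sqrt_sqrt (dot r r)) at 3 by lra. field.
      apply Rgt_not_eq, sqrt_lt_R0, RR. }
    pose (rn := fun x => n * r x). assert (Crn : cont rn) by (unfold rn; cts).
    assert (Rnp : forall i, (i <= m)%nat -> dot rn (p i) = 0).
    { intros i im. unfold rn. rewrite dot_scal, Rp by auto. ring. }
    assert (Rnn : dot rn rn = 1).
    { unfold rn at 1. rewrite dot_scal, dot_sym by auto. unfold rn. rewrite dot_scal by auto.
      rewrite <- Rmult_assoc. exact N2. }
    exists (fun i => if Nat.eqb i (S m) then rn else p i). split; [|split].
    + intros i. destruct (Nat.eqb_spec i (S m)); [now apply isP_scal | apply isP_S, P].
    + intros i j im jm.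
      destruct (Nat.eqb_spec i (S m)) as [ei|ei]; destruct (Nat.eqb_spec j (S m)) as [ej|ej].
      * rewrite Rnn. destruct (Nat.eqb_spec i j); [reflexivity | lia].
      * rewrite Rnp by lia. destruct (Nat.eqb_spec i j); [lia | reflexivity].
      * rewrite dot_sym, Rnp by lia. destruct (Nat.eqb_spec i j); [lia | reflexivity].
      * apply O; lia.
    + intros f Pf x. destruct (isP_lead m f Pf) as (c & g & G & E).
      (* Trading the power in [f] for [r] leaves the remainder [g'] of degree [m], to which the
         expansion from the induction hypothesis applies. *)
      pose (g' := fun x => c * q x + g x).
      assert (G' : isP m g') by (apply isP_plus; [now apply isP_scal | exact G]).
      assert (Cg : cont g') by (apply (isP_cont m), G').
      assert (E' : forall x, f x = c * r x + g' x) by (intros y; rewrite E; unfold g', r, M; ring).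
      assert (Dr : dot f rn = c * / n).
      { rewrite (dot_ext _ _ _ E'), dot_plus, dot_scal by cts.
        replace (dot g' rn) with 0.
        - unfold rn. rewrite dot_sym, dot_scal by auto.
          replace (n * dot r r) with (/ n); [ring|].
          apply Rmult_eq_reg_l with n.
          + rewrite Rinv_r; [lra|]. intros Z. rewrite Z in N2. lra.
          + intros Z. rewrite Z in N2. lra.
        - symmetry. rewrite (dot_ext _ _ _ (Sp g' G')).
          rewrite (dot_sum0 m (fun i x => dot g' (p i) * p i x)).
          + rewrite <- (sum0_0s m). apply sum0_ext. intros i im.
            rewrite dot_scal, (dot_sym (p i) rn), Rnp by auto. ring.
          + intros i im. specialize (CP i). cts.
          + exact Crn. }
      assert (Dp : forall i, (i <= m)%nat -> dot f (p i) = dot g' (p i)).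
      { intros i im. specialize (CP i).
        rewrite (dot_ext _ _ _ E'), dot_plus, dot_scal, Rp by (cts; auto). ring. }
      rewrite sum0_S, Nat.eqb_refl, Dr, E', (Sp g' G').
      rewrite (sum0_ext m (fun i => dot f (if Nat.eqb i (S m) then rn else p i)
                 * (if Nat.eqb i (S m) then rn else p i) x) (fun i => dot g' (p i) * p i x)).
      * unfold rn. rewrite Rplus_comm. f_equal. field. intros Z. rewrite Z in N2. lra.
      * intros i im. destruct (Nat.eqb_spec i (S m)); [lia | now rewrite Dp].
Qed.

Lemma onb_cont m p i : onb m p -> cont (p i).
Proof. intros (P & _ & _). apply (isP_cont m), P. Qed.

Lemma onb_parseval m p q : onb m p -> isP m q -> dot q q = sum0 m (fun i => dot q (p i) ^ 2).
Proof.
  intros B Q. pose proof (isP_cont m q Q) as C. destruct B as (P & O & Sp).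
  rewrite (dot_ext _ _ _ (Sp q Q)), (dot_sum0 m (fun i x => dot q (p i) * p i x)).
  - apply sum0_ext. intros i im. rewrite dot_scal, (dot_sym (p i)) by (try assumption; apply (isP_cont m), P). ring.
  - intros i im. apply cont_mult; [apply cont_const | apply (isP_cont m), P].
  - exact C.
Qed.

(** Cauchy-Schwarz on the coefficients and Parseval; the sum is the reproducing kernel on the
    diagonal. This is the inverse inequality on the reference interval, with an explicit
    constant. *)
Lemma inverse_ineq m p q x : onb m p -> isP m q ->
  q x ^ 2 <= sum0 m (fun i => p i x ^ 2) * dot q q.
Proof.
  intros B Q. rewrite (onb_parseval m p q B Q). destruct B as (P & O & Sp).
  rewrite (Sp q Q x). apply quad_ge0_le, sum0_quad_ge0. intros i im.
  apply le_quad_ge0; [apply pow2_ge_0 | apply pow2_ge_0 | right; ring].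
Qed.

(** * Tensor-product polynomials *)

Lemma is_Qk_ext k (p q : R -> R -> R) : (forall x y, p x y = q x y) -> is_Qk k p -> is_Qk k q.
Proof. intros E [c H]. exists c. intros; now rewrite <- E. Qed.

Lemma is_Qk_plus k p q : is_Qk k p -> is_Qk k q -> is_Qk k (fun x y => p x y + q x y).
Proof.
  intros [c H] [d K]. exists (fun a b => c a b + d a b). intros x y. rewrite H, K.
  rewrite <- sum0_plus. apply sum0_ext; intros a _. rewrite <- sum0_plus.
  apply sum0_ext; intros; rring.
Qed.

Lemma is_Qk_scal k s p : is_Qk k p -> is_Qk k (fun x y => s * p x y).
Proof.
  intros [c H]. exists (fun a b => s * c a b). intros x y. rewrite H.
  rewrite <- sum0_scal. apply sum0_ext; intros a _. rewrite <- sum0_scal.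
  apply sum0_ext; intros; rring.
Qed.

Lemma is_Qk_prod k p q : isP k p -> isP k q -> is_Qk k (fun x y => p x * q y).
Proof.
  intros P Q. destruct (isP_coef k p P) as [c H]. destruct (isP_coef k q Q) as [d K].
  exists (fun a b => c a * d b). intros x y. rewrite H, K, Rmult_comm.
  rewrite <- sum0_scal. apply sum0_ext; intros a _. rewrite Rmult_comm.
  rewrite <- sum0_scal. apply sum0_ext; intros; rring.
Qed.

Lemma is_Qk_sum0 k m (f : nat -> R -> R -> R) : (forall i, (i <= m)%nat -> is_Qk k (f i)) ->
  is_Qk k (fun x y => sum0 m (fun i => f i x y)).
Proof.
  induction m as [|m IH]; intros H.
  - apply is_Qk_ext with (f 0%nat); [intros; now rewrite sum0_0 | now apply H].
  - apply is_Qk_ext with (fun x y => sum0 m (fun i => f i x y) + f (S m) x y).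
    + intros; now rewrite sum0_S.
    + apply is_Qk_plus; [apply IH; intros; apply H; lia | now apply H].
Qed.

Lemma is_Qk_swap k p : is_Qk k p -> is_Qk k (fun x y => p y x).
Proof.
  intros [c H]. exists (fun a b => c b a). intros x y. rewrite H, sum0_swap.
  apply sum0_ext; intros a _. apply sum0_ext; intros; rring.
Qed.

Lemma is_Qk_slice k p y : is_Qk k p -> isP k (fun x => p x y).
Proof.
  intros [c H]. apply isP_ext with (fun x => sum0 k (fun a => sum0 k (fun b => c a b * y ^ b) * x ^ a)).
  - intros x. rewrite H. apply sum0_ext; intros a _. rewrite Rmult_comm, <- sum0_scal.
    apply sum0_ext; intros; rring.
  - apply isP_sum0. intros a ak. apply isP_scal, (isP_le a); [exact ak | apply isP_pow].
Qed.

Lemma is_Qk_cont2 k p : is_Qk k p -> cont2 p.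
Proof.
  intros [c H]. apply cont_ext with (fun z : R * R => sum0 k (fun a => sum0 k (fun b =>
      c a b * fst z ^ a * snd z ^ b))); [intros; now rewrite H|].
  apply cont_sum0; intros a _. apply cont_sum0; intros b _. cts.
Qed.

Lemma is_Qk_Derive_cont2 k p : is_Qk k p -> cont2 (fun x y => Derive (fun s => p s y) x).
Proof.
  intros [c H]. apply cont_ext with (fun z : R * R => sum0 k (fun a => sum0 k (fun b =>
      (c a b * snd z ^ b) * (INR a * 1 * fst z ^ pred a)))).
  - intros [x y]; simpl. symmetry. apply is_derive_unique.
    apply is_derive_ext with (fun s => sum0 k (fun a => sum0 k (fun b => (c a b * y ^ b) * s ^ a))).
    + intros s. rewrite H. apply sum0_ext; intros a _. apply sum0_ext; intros; rring.
    + apply deriv_sum0; intros a _. apply deriv_sum0; intros b _. apply deriv_scal.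
      apply (is_derive_pow (fun x => x)), deriv_id.
  - apply cont_sum0; intros a _. apply cont_sum0; intros b _. cts.
Qed.

(** * The one-dimensional projection *)

(* [F n] is the n-th derivative of [F 0]. *)
Definition smooth1 (F : nat -> R -> R) : Prop := forall n x, is_derive (F n) x (F (S n) x).

Lemma smooth1_cont F n : smooth1 F -> cont (F n).
Proof. intros S1. apply (cont_of_derive _ (F (S n))). intros; apply S1. Qed.

Lemma smooth1_tail F : smooth1 F -> smooth1 (fun n => F (S n)).
Proof. intros S1 n x; apply S1. Qed.

Lemma cont_bounded (f : R -> R) a b : cont f -> exists C, 0 < C /\ forall x, a <= x <= b -> Rabs (f x) <= C.
Proof.
  intros F. destruct (Rle_dec a b) as [ab|ab].
  - assert (K : forall c, a <= c <= b -> continuity_pt (fun x => Rabs (f x)) c).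
    { intros c _. apply continuity_pt_filterlim. apply (continuous_comp f Rabs); [apply F|].
      apply continuity_pt_filterlim, Rcontinuity_abs. }
    destruct (continuity_ab_maj (fun x => Rabs (f x)) a b ab K) as (M & H & _).
    exists (Rabs (f M) + 1). split; [pose proof (Rabs_pos (f M)); lra|].
    intros x Hx. specialize (H x Hx). lra.
  - exists 1. split; [lra|]. intros; lra.
Qed.

(** The polynomial for [F] is a primitive of the one for its derivative, and every integration gains
    a factor [h]. The right side is an integral over the cell rather than a supremum, so that
    squares add up over the cells to a Sobolev norm. *)
Lemma taylor_L2 n F a h : smooth1 F -> 0 < h ->
  exists T, isP n T /\ forall s, 0 <= s <= 1 ->
    (F 0%nat (a + h * s) - T s) ^ 2 <= h ^ (2 * n + 1) * RInt (fun x => F (S n) x ^ 2) a (a + h).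
Proof.
  revert F; induction n as [|n IH]; intros F SF h0.
  - exists (fun _ => F 0%nat a). split; [now exists (F 0%nat a)|]. intros s Hs.
    pose proof (smooth1_cont F 1 SF) as C1.
    assert (hs : 0 <= h * s <= h) by nra.
    rewrite <- (integral_ftc (F 0%nat) (F 1%nat)); [|intros; apply SF | exact C1].
    rewrite (integral_ext (F 1%nat) (fun x => 1 * F 1%nat x)) by (intros; ring).
    apply Rle_trans with (1 := integral_cauchy_schwarz (fun _ => 1) (F 1%nat) a (a + h * s)
      ltac:(lra) (cont_const 1) C1).
    rewrite integral_const.
    assert (CC : cont (fun x : R => F 1%nat x ^ 2)) by cts.
    pose proof (integral_chasles _ a (a + h * s) CC (a + h)) as E.
    assert (0 <= RInt (fun x => F 1%nat x ^ 2) (a + h * s) (a + h))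
      by (apply integral_ge0; [cts | lra | intros; apply pow2_ge_0]).
    assert (0 <= RInt (fun x => F 1%nat x ^ 2) a (a + h * s))
      by (apply integral_ge0; [cts | lra | intros; apply pow2_ge_0]).
    simpl (2 * 0 + 1)%nat. rewrite pow_1.
    replace ((a + h * s - a) * 1 ^ 2) with (h * s) by ring.
    apply Rmult_le_compat; lra.
  - destruct (IH _ (smooth1_tail F SF) h0) as (T & PT & H).
    pose proof (isP_cont _ _ PT) as CT. pose proof (smooth1_cont F 1 SF) as C1.
    exists (fun s => F 0%nat a + h * RInt T 0 s). split.
    + apply isP_plus; [apply isP_const | now apply isP_scal, isP_RInt].
    + intros s Hs.
      replace (F 0%nat (a + h * s) - (F 0%nat a + h * RInt T 0 s))
        with (h * RInt (fun r => F 1%nat (a + h * r) - T r) 0 s).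
      2:{ rewrite integral_minus by cts.
          pose proof (integral_affine (F 1%nat) h a 0 s C1) as E.
          rewrite (integral_ftc (F 0%nat) (F 1%nat)), Rmult_0_r, Rplus_0_r in E by (assumption || (intros; apply SF)). lra. }
      set (B := h ^ (2 * n + 1) * RInt (fun x => F (S (S n)) x ^ 2) a (a + h)) in *.
      assert (B0 : 0 <= B) by (eapply Rle_trans; [apply pow2_ge_0 | apply (H 0); lra]).
      replace (h ^ (2 * S n + 1) * RInt (fun x => F (S (S n)) x ^ 2) a (a + h)) with (h ^ 2 * B).
      2:{ unfold B. replace (2 * S n + 1)%nat with (2 + (2 * n + 1))%nat by lia.
          rewrite (pow_add h 2). rring. }
      rewrite Rpow_mult_distr. apply Rmult_le_compat_l; [apply pow2_ge_0|].
      rewrite (integral_ext _ (fun r => 1 * (F 1%nat (a + h * r) - T r))) by (intros; ring).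
      apply Rle_trans with (1 := integral_cauchy_schwarz (fun _ => 1) (fun r => F 1%nat (a + h * r) - T r)
         0 s ltac:(lra) (cont_const 1) ltac:(cts)).
      rewrite integral_const.
      assert (RInt (fun r => (F 1%nat (a + h * r) - T r) ^ 2) 0 s <= (s - 0) * B).
      { rewrite <- integral_const. apply integral_le; [cts | cts | lra |]. intros r Hr. apply H. lra. }
      assert (0 <= RInt (fun r => (F 1%nat (a + h * r) - T r) ^ 2) 0 s)
        by (apply integral_ge0; [cts | lra | intros; apply pow2_ge_0]).
      simpl (1 ^ 2). nra.
Qed.

Section Projection.
Variables (m : nat) (p : nat -> R -> R).
Hypothesis Bp : onb m p.

Let Cp i : cont (p i) := onb_cont m p i Bp.

Definition ker1 s := sum0 m (fun i => p i 1 * p i s).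
Definition ker0 s := sum0 m (fun i => p i 0 * p i s).
(** The squared norm of the functional [q 1 + q 0] on polynomials of degree [m], whose representer
    is the sum of [ker1] and [ker0]. *)
Definition kappa := sum0 m (fun i => (p i 1 + p i 0) ^ 2).

Definition proj (f : R -> R) (s : R) : R := sum0 m (fun i => dot f (p i) * p i s).

Lemma isP_ker1 : isP m ker1.
Proof. apply isP_sum0. intros i im. now apply isP_scal, (proj1 Bp). Qed.

Lemma isP_ker0 : isP m ker0.
Proof. apply isP_sum0. intros i im. now apply isP_scal, (proj1 Bp). Qed.

Lemma isP_proj f : isP m (proj f).
Proof. apply isP_sum0. intros i im. now apply isP_scal, (proj1 Bp). Qed.

Lemma cont_ker1 : cont ker1. Proof. exact (isP_cont _ _ isP_ker1). Qed.
Lemma cont_ker0 : cont ker0. Proof. exact (isP_cont _ _ isP_ker0). Qed.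
Lemma cont_proj f : cont (proj f). Proof. exact (isP_cont _ _ (isP_proj f)). Qed.

Lemma dot_combination (c : nat -> R) q : isP m q ->
  dot (fun s => sum0 m (fun i => c i * p i s)) q = sum0 m (fun i => c i * dot q (p i)).
Proof.
  intros Q. pose proof (isP_cont _ _ Q) as CQ.
  rewrite (dot_sum0 m (fun i s => c i * p i s)); [|intros i im; specialize (Cp i); cts | exact CQ].
  apply sum0_ext. intros i im. rewrite dot_scal, dot_sym; auto.
Qed.

Lemma dot_ker1 q : isP m q -> dot ker1 q = q 1.
Proof.
  intros Q. unfold ker1. rewrite dot_combination by exact Q.
  rewrite (proj2 (proj2 Bp) q Q 1). apply sum0_ext; intros; ring.
Qed.

Lemma dot_ker0 q : isP m q -> dot ker0 q = q 0.
Proof.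
  intros Q. unfold ker0. rewrite dot_combination by exact Q.
  rewrite (proj2 (proj2 Bp) q Q 0). apply sum0_ext; intros; ring.
Qed.

Lemma dot_proj (f q : R -> R) : cont f -> isP m q -> dot (proj f) q = dot f q.
Proof.
  intros F Q. unfold proj. rewrite dot_combination by exact Q.
  rewrite (dot_sym f q), (dot_ext _ _ _ (proj2 (proj2 Bp) q Q)).
  rewrite (dot_sum0 m (fun i s => dot q (p i) * p i s)); [|intros i im; specialize (Cp i); cts | exact F].
  apply sum0_ext. intros i im. rewrite dot_scal, (dot_sym (p i) f); auto. ring.
Qed.

Lemma dot_1_r (f : R -> R) : cont f -> dot f (fun _ => 1) = RInt f 0 1.
Proof. intros F. apply integral_ext; intros; ring. Qed.

Lemma ker0_1 : ker0 1 = ker1 0.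
Proof. apply sum0_ext; intros; ring. Qed.

Lemma kappa_eq : kappa = ker1 1 + ker0 0 + 2 * ker1 0.
Proof.
  unfold kappa, ker1, ker0. rewrite <- sum0_plus, <- sum0_scal, <- sum0_plus.
  apply sum0_ext; intros; rring.
Qed.

(** The functional takes the value 2 at the constant 1, so its norm cannot vanish. The number of
    cells does not enter, which is what makes the local correction available on every grid. *)
Lemma kappa_pos : 0 < kappa.
Proof.
  assert (P1 : isP m (fun _ => 1)) by apply isP_const.
  assert (E : sum0 m (fun i => dot (fun _ => 1) (p i) * (p i 1 + p i 0)) = 2).
  { pose proof (proj2 (proj2 Bp) _ P1 1) as E1. pose proof (proj2 (proj2 Bp) _ P1 0) as E0.
    cbv beta in E1, E0. rewrite (sum0_ext m _ (fun i => dot (fun _ => 1) (p i) * p i 1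
      + dot (fun _ => 1) (p i) * p i 0)) by (intros; ring).
    rewrite sum0_plus. lra. }
  assert (0 <= kappa) by (apply sum0_ge0; intros; apply pow2_ge_0).
  destruct (Req_dec kappa 0) as [Z|]; [exfalso | lra].
  assert (Q : (sum0 m (fun i => dot (fun _ => 1) (p i) * (p i 1 + p i 0))) ^ 2
          <= sum0 m (fun i => dot (fun _ => 1) (p i) ^ 2) * kappa).
  { apply quad_ge0_le, sum0_quad_ge0. intros. apply le_quad_ge0; [apply pow2_ge_0 | apply pow2_ge_0 | right; ring]. }
  rewrite E, Z in Q. lra.
Qed.

(** The projection reproduces [T], so only [r = f - T] matters, and the projection is bounded in the
    maximum norm through its coefficients. *)
Lemma proj_error_bound : exists C, 0 < C /\ forall (f T : R -> R) B s, cont f -> isP m T ->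
  (forall s, 0 <= s <= 1 -> (f s - T s) ^ 2 <= B) -> 0 <= s <= 1 ->
  (f s - proj f s) ^ 2 <= C * B.
Proof.
  destruct (cont_bounded (fun s => sum0 m (fun i => p i s ^ 2)) 0 1) as (S & S0 & HS).
  { apply cont_sum0. intros i im. specialize (Cp i). cts. }
  exists (2 + 2 * (INR (m + 1) * S)). split.
  { assert (0 <= INR (m + 1)) by apply pos_INR. nra. }
  intros f T B s F PT H Hs.
  pose proof (isP_cont _ _ PT) as CT.
  pose (r := fun s : R => f s - T s). assert (CR : cont r) by (unfold r; cts).
  assert (E : proj f s = T s + proj r s).
  { rewrite (proj2 (proj2 Bp) T PT s). unfold proj. rewrite <- sum0_plus. apply sum0_ext.
    intros i im. unfold r. rewrite dot_minus by auto. ring. }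
  rewrite E. replace (f s - (T s + proj r s)) with (r s - proj r s) by (unfold r; ring).
  assert (B0 : 0 <= B) by (eapply Rle_trans; [apply pow2_ge_0 | apply (H s Hs)]).
  assert (Hr : r s ^ 2 <= B) by (apply H, Hs).
  assert (Hd : forall i, (i <= m)%nat -> dot r (p i) ^ 2 <= B).
  { intros i im. specialize (Cp i). unfold dot.
    apply Rle_trans with (1 := integral_cauchy_schwarz r (p i) 0 1 ltac:(lra) CR Cp).
    replace (RInt (fun x => p i x ^ 2) 0 1) with 1.
    - rewrite Rmult_1_r. replace B with ((1 - 0) * B) by ring. rewrite <- integral_const.
      apply integral_le; [cts | cts | lra |]. intros; now apply H.
    - pose proof (proj1 (proj2 Bp) i i im im) as O. rewrite Nat.eqb_refl in O.
      symmetry. transitivity (dot (p i) (p i)); [apply integral_ext; intros; ring | exact O]. }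
  assert (Hp : proj r s ^ 2 <= INR (m + 1) * S * B).
  { apply Rle_trans with (sum0 m (fun i => dot r (p i) ^ 2) * sum0 m (fun i => p i s ^ 2)).
    - apply quad_ge0_le, sum0_quad_ge0. intros. apply le_quad_ge0; [apply pow2_ge_0 | apply pow2_ge_0 | right; ring].
    - assert (A1 : sum0 m (fun i => dot r (p i) ^ 2) <= INR (m + 1) * B).
      { apply Rle_trans with (sum0 m (fun _ => B)); [now apply sum0_le|].
        right. rewrite (sum_n_const (m)). f_equal. f_equal. lia. }
      assert (A2 : sum0 m (fun i => p i s ^ 2) <= S)
        by (eapply Rle_trans; [apply Rle_abs | apply HS, Hs]).
      assert (0 <= sum0 m (fun i => p i s ^ 2)) by (apply sum0_ge0; intros; apply pow2_ge_0).
      assert (0 <= sum0 m (fun i => dot r (p i) ^ 2)) by (apply sum0_ge0; intros; apply pow2_ge_0).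
      replace (INR (m + 1) * S * B) with (INR (m + 1) * B * S) by ring.
      apply Rmult_le_compat; assumption. }
  pose proof (pow2_ge_0 (r s + proj r s)). lra.
Qed.

Definition slope (F : nat -> R -> R) (a h : R) : R -> R := proj (fun s => F 1%nat (a + h * s)).

Definition defect (F : nat -> R -> R) (h a : R) : R :=
  F 1%nat a - (slope F (a - h) h 1 + slope F a h 0) / 2.

(* [ker1] and [ker0] represent the evaluations at [1] and [0] on polynomials of degree [m].
   The factor [2 / kappa] makes the averaged derivative error at a node a multiple of the
   second difference of the defects, see [defect_identity]. *)
Definition dproj_ref (F : nat -> R -> R) (a h s : R) : R :=
  slope F a h s + 2 / kappa * (defect F h (a + h) * ker1 s + defect F h a * ker0 s).

(** Its derivative in [s] is [h] times [dproj_ref]. Since [ker1] and [ker0] have mean 1, the [- 1]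
    makes the value at either end depend on the defect at that end only. From the two sides of a
    node the value is shifted by opposite amounts, so that averages at the nodes stay exact. *)
Definition proj_ref (F : nat -> R -> R) (a h s : R) : R :=
  F 0%nat a + h * RInt (slope F a h) 0 s
  + 2 / kappa * h * (defect F h (a + h) * RInt ker1 0 s + defect F h a * (RInt ker0 0 s - 1)).

Definition Pi (F : nat -> R -> R) (a h x : R) : R := proj_ref F a h ((x - a) / h).
Definition Pi' (F : nat -> R -> R) (a h x : R) : R := dproj_ref F a h ((x - a) / h).

Lemma cont_slope F a h : cont (slope F a h).
Proof. apply cont_proj. Qed.

Lemma isP_Pv F a h : isP (S m) (proj_ref F a h).
Proof.
  unfold proj_ref. apply isP_plus; [apply isP_plus|].
  - apply isP_const.
  - apply isP_scal, isP_RInt, isP_proj.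
  - apply isP_scal, isP_plus; apply isP_scal.
    + apply isP_RInt, isP_ker1.
    + apply isP_minus; [apply isP_RInt, isP_ker0 | apply isP_const].
Qed.

Lemma isP_Pi F a h : isP (S m) (Pi F a h).
Proof.
  apply isP_ext with (fun x => proj_ref F a h (- a / h + / h * x)).
  - intros x. unfold Pi. f_equal. unfold Rdiv. ring.
  - apply isP_affine, isP_Pv.
Qed.

Lemma deriv_Pi F a h x : h <> 0 -> is_derive (Pi F a h) x (Pi' F a h x).
Proof.
  intros h0. apply is_derive_ext with (fun x => proj_ref F a h (- a / h + / h * x)).
  { intros t. unfold Pi. f_equal. unfold Rdiv. ring. }
  replace (Pi' F a h x) with (/ h * (0 + h * slope F a h (- a / h + / h * x)
    + 2 / kappa * h * (defect F h (a + h) * ker1 (- a / h + / h * x)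
       + defect F h a * (ker0 (- a / h + / h * x) - 0)))).
  2:{ unfold Pi', dproj_ref. replace ((x - a) / h) with (- a / h + / h * x) by (unfold Rdiv; ring).
      field. split; [apply Rgt_not_eq, kappa_pos | exact h0]. }
  apply (deriv_affine (proj_ref F a h)). unfold proj_ref.
  apply deriv_plus; [apply deriv_plus|].
  - apply deriv_const.
  - apply deriv_scal, integral_derive, cont_slope.
  - apply deriv_scal, deriv_plus; apply deriv_scal.
    + apply integral_derive, cont_ker1.
    + apply deriv_minus; [apply integral_derive, cont_ker0 | apply deriv_const].
Qed.

Lemma Pi_node F a h s : h <> 0 -> Pi F a h (a + h * s) = proj_ref F a h s.
Proof. intros h0. unfold Pi. f_equal. field. exact h0. Qed.

Lemma Pi'_node F a h s : h <> 0 -> Pi' F a h (a + h * s) = dproj_ref F a h s.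
Proof. intros h0. unfold Pi'. f_equal. field. exact h0. Qed.

(** Constants are polynomials of degree [m], so the projection keeps the mean of the derivative. *)
Lemma RInt_slope F a h : smooth1 F -> h * RInt (slope F a h) 0 1 = F 0%nat (a + h) - F 0%nat a.
Proof.
  intros SF. pose proof (smooth1_cont F 1 SF) as C1.
  assert (CF : cont (fun s : R => F 1%nat (a + h * s))) by cts.
  rewrite <- dot_1_r by apply cont_slope. unfold slope.
  rewrite dot_proj, dot_1_r by (exact CF || apply isP_const).
  rewrite integral_affine, (integral_ftc (F 0%nat) (F 1%nat)) by (assumption || (intros; apply SF)).
  f_equal; f_equal; ring.
Qed.

Lemma proj_ref_1 F a h : smooth1 F -> proj_ref F a h 1 = F 0%nat (a + h) + 2 / kappa * h * defect F h (a + h).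
Proof.
  intros SF. unfold proj_ref.
  rewrite RInt_slope, <- (dot_1_r ker1), <- (dot_1_r ker0), dot_ker1, dot_ker0
    by (exact SF || apply isP_const || apply cont_ker1 || apply cont_ker0).
  ring.
Qed.

Lemma proj_ref_0 F a h : proj_ref F a h 0 = F 0%nat a - 2 / kappa * h * defect F h a.
Proof. unfold proj_ref. rewrite !integral_point. ring. Qed.

(** Equal defects at three successive nodes would be cancelled exactly; by [kappa_eq] this fixes the
    factor [2 / kappa]. The coupling [ker1 0] between the two ends of a cell multiplies the
    deviation from equality. *)
Lemma defect_identity F h a :
  F 1%nat a - (dproj_ref F (a - h) h 1 + dproj_ref F a h 0) / 2
  = - (ker1 0 / kappa) * (defect F h (a + h) - 2 * defect F h a + defect F h (a - h)).
Proof.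
  unfold dproj_ref. rewrite ker0_1. replace (a - h + h) with a by ring.
  replace (F 1%nat a - _) with (defect F h a - (2 / kappa * (defect F h a * ker1 1 + defect F h (a - h) * ker1 0)
    + 2 / kappa * (defect F h (a + h) * ker1 0 + defect F h a * ker0 0)) / 2) by (unfold defect; field; apply Rgt_not_eq, kappa_pos).
  pose proof kappa_pos as k0.
  apply Rmult_eq_reg_r with kappa; [|lra].
  replace (ker0 0) with (kappa - ker1 1 - 2 * ker1 0) by (rewrite kappa_eq; ring).
  field. lra.
Qed.

(* The [L2] projection part drops out, and [ker1], [ker0] represent the evaluations at [1], [0]. *)
Lemma dproj_ref_orth F a h q : smooth1 F -> isP m q ->
  dot (fun s => F 1%nat (a + h * s) - dproj_ref F a h s) q
  = - (2 / kappa) * (defect F h (a + h) * q 1 + defect F h a * q 0).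
Proof.
  intros SF Q. pose proof (smooth1_cont F 1 SF) as C1. pose proof (isP_cont _ _ Q) as CQ.
  pose proof cont_ker1. pose proof cont_ker0. pose proof (cont_slope F a h).
  assert (CF : cont (fun s : R => F 1%nat (a + h * s))) by cts.
  unfold dproj_ref. rewrite dot_minus, dot_plus, dot_scal, dot_plus, !dot_scal, dot_ker1, dot_ker0 by (assumption || cts).
  unfold slope at 1. rewrite dot_proj by assumption. ring.
Qed.

(** * Second differences of the defects *)

Definition second_diff (h : R) (F : nat -> R -> R) : nat -> R -> R :=
  fun n x => F n (x + h) - 2 * F n x + F n (x - h).

Lemma smooth1_shift F c : smooth1 F -> smooth1 (fun n x => F n (c + x)).
Proof.
  intros SF n x. apply is_derive_ext with (fun x => F n (c + 1 * x)); [intros; f_equal; ring|].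
  apply (deriv_val _ _ (1 * F (S n) (c + x))); [|ring].
  apply deriv_affine. rewrite Rmult_1_l. apply SF.
Qed.

Lemma smooth1_second_diff h F : smooth1 F -> smooth1 (second_diff h F).
Proof.
  intros SF n x. unfold second_diff. apply deriv_plus; [apply deriv_minus; [|apply deriv_scal, SF]|].
  - apply is_derive_ext with (fun x => F n (h + x)); [intros; f_equal; ring|].
    rewrite (Rplus_comm x h). apply (smooth1_shift F h SF n x).
  - apply is_derive_ext with (fun x => F n (- h + x)); [intros; f_equal; ring|].
    replace (x - h) with (- h + x) by ring. apply (smooth1_shift F (- h) SF n x).
Qed.

Lemma slope_second_diff F a h s : smooth1 F ->
  slope (second_diff h F) a h s = slope F (a + h) h s - 2 * slope F a h s + slope F (a - h) h s.
Proof.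
  intros SF. pose proof (smooth1_cont F 1 SF) as C1. unfold slope, proj.
  rewrite <- sum0_scal, <- sum0_minus, <- sum0_plus. apply sum0_ext. intros i im.
  specialize (Cp i). unfold second_diff.
  rewrite dot_plus, dot_minus, dot_scal by cts.
  rewrite (dot_ext (fun s => F 1%nat (a + h * s + h)) (fun s => F 1%nat (a + h + h * s))) by (intros; f_equal; ring).
  rewrite (dot_ext (fun s => F 1%nat (a + h * s - h)) (fun s => F 1%nat (a - h + h * s))) by (intros; f_equal; ring).
  rring.
Qed.

(** The construction is linear and commutes with translations. Hence second differences of defects
    can be estimated as defects of a smooth function that is itself small. *)
Lemma defect_second_diff F h a : smooth1 F ->
  defect (second_diff h F) h a = defect F h (a + h) - 2 * defect F h a + defect F h (a - h).
Proof.
  intros SF. unfold defect. rewrite !slope_second_diff by exact SF. unfold second_diff.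
  replace (a + h - h) with a by ring. replace (a - h + h) with a by ring. field.
Qed.

Definition periodic1 (L : R) (F : nat -> R -> R) : Prop := forall n x, F n (x + L) = F n x.

Lemma slope_periodic L F a h s : periodic1 L F -> slope F (a + L) h s = slope F a h s.
Proof.
  intros P. unfold slope, proj. apply sum0_ext. intros i im. f_equal. apply dot_ext.
  intros x. rewrite <- (P 1%nat (a + h * x)). f_equal; ring.
Qed.

Lemma defect_periodic L F a h : periodic1 L F -> defect F h (a + L) = defect F h a.
Proof.
  intros P. unfold defect. rewrite P, (slope_periodic L F a) by exact P.
  replace (a + L - h) with (a - h + L) by ring. now rewrite (slope_periodic L F (a - h)).
Qed.

Lemma dproj_ref_periodic L F a h s : periodic1 L F -> dproj_ref F (a + L) h s = dproj_ref F a h s.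
Proof.
  intros P. unfold dproj_ref. rewrite (slope_periodic L F a), (defect_periodic L F a) by exact P.
  replace (a + L + h) with (a + h + L) by ring. now rewrite (defect_periodic L F (a + h)).
Qed.

(** The parameter [n] trades order for smoothness: [n = m] gives the full order, while [n = 0] asks
    for second derivatives only. Both ends of the range are used, and for the mixed tensor-product
    term also [m - 2]. *)
Lemma slope_error : exists C, 0 < C /\ forall n F a h s, (n <= m)%nat -> smooth1 F -> 0 < h -> 0 <= s <= 1 ->
  (F 1%nat (a + h * s) - slope F a h s) ^ 2
  <= C * (h ^ (2 * n + 1) * RInt (fun x => F (n + 2)%nat x ^ 2) a (a + h)).
Proof.
  destruct proj_error_bound as (C & C0 & H). exists C. split; [exact C0|].
  intros n F a h s nm SF h0 Hs. pose proof (smooth1_cont F 1 SF) as C1.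
  destruct (taylor_L2 n (fun n => F (S n)) a h (smooth1_tail F SF) h0) as (T & PT & HT).
  replace (n + 2)%nat with (S (S n)) by lia.
  apply (H (fun s => F 1%nat (a + h * s)) T); [cts | now apply isP_le with n | exact HT | exact Hs].
Qed.

Lemma defect_error : exists C, 0 < C /\ forall n F a h, (n <= m)%nat -> smooth1 F -> 0 < h ->
  defect F h a ^ 2 <= C * (h ^ (2 * n + 1) * RInt (fun x => F (n + 2)%nat x ^ 2) (a - h) (a + h)).
Proof.
  destruct slope_error as (C & C0 & H). exists C. split; [exact C0|].
  intros n F a h nm SF h0. pose proof (smooth1_cont F (n + 2) SF) as C2.
  assert (CC : cont (fun x : R => F (n + 2)%nat x ^ 2)) by cts.
  rewrite <- (integral_chasles _ (a - h) a CC (a + h)).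
  pose proof (H n F (a - h) h 1 nm SF h0 ltac:(lra)) as H1.
  pose proof (H n F a h 0 nm SF h0 ltac:(lra)) as H2.
  replace (a - h + h * 1) with a in H1 by ring. replace (a - h + h) with a in H1 by ring.
  replace (a + h * 0) with a in H2 by ring.
  assert (0 <= C * (h ^ (2 * n + 1) * RInt (fun x => F (n + 2)%nat x ^ 2) (a - h) a))
    by (eapply Rle_trans; [apply pow2_ge_0 | exact H1]).
  assert (0 <= C * (h ^ (2 * n + 1) * RInt (fun x => F (n + 2)%nat x ^ 2) a (a + h)))
    by (eapply Rle_trans; [apply pow2_ge_0 | exact H2]).
  replace (defect F h a) with ((F 1%nat a - slope F (a - h) h 1 + (F 1%nat a - slope F a h 0)) / 2)
    by (unfold defect; field).
  rewrite !Rmult_plus_distr_l.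
  set (X := F 1%nat a - slope F (a - h) h 1) in *. set (Y := F 1%nat a - slope F a h 0) in *.
  nra.
Qed.

(** Integrating the slope error gains one more power of [h]. The defects at the two ends of the cell
    look one cell further, hence three cells on the right. *)
Lemma Pi_error : exists C, 0 < C /\ forall n F a h s, (n <= m)%nat -> smooth1 F -> 0 < h -> 0 <= s <= 1 ->
  (F 0%nat (a + h * s) - proj_ref F a h s) ^ 2
  <= C * (h ^ (2 * n + 3) * RInt (fun x => F (n + 2)%nat x ^ 2) (a - h) (a + 2 * h)).
Proof.
  destruct slope_error as (Cs & Cs0 & Hs). destruct defect_error as (Cd & Cd0 & Hd).
  destruct (cont_bounded (fun s => RInt ker1 0 s) 0 1) as (R1 & R10 & HR1).
  { apply (cont_of_derive _ ker1). intros; apply integral_derive, cont_ker1. }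
  destruct (cont_bounded (fun s => RInt ker0 0 s - 1) 0 1) as (R2 & R20 & HR2).
  { apply (cont_of_derive _ (fun s => ker0 s - 0)). intros; apply deriv_minus; [apply integral_derive, cont_ker0 | apply deriv_const]. }
  set (c := 2 / kappa). assert (c0 : 0 < c) by (apply Rdiv_lt_0_compat; [lra | apply kappa_pos]).
  exists (3 * (Cs + c ^ 2 * R1 ^ 2 * Cd + c ^ 2 * R2 ^ 2 * Cd)). split.
  { assert (0 <= c ^ 2 * R1 ^ 2 * Cd) by (apply Rmult_le_pos; [apply Rmult_le_pos; apply pow2_ge_0 | lra]).
    assert (0 <= c ^ 2 * R2 ^ 2 * Cd) by (apply Rmult_le_pos; [apply Rmult_le_pos; apply pow2_ge_0 | lra]).
    lra. }
  intros n F a h s nm SF h0 s01.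
  pose proof (smooth1_cont F (n + 2) SF) as C2. pose proof (smooth1_cont F 1 SF) as C1.
  pose proof (cont_slope F a h) as Csl.
  assert (CC : cont (fun x : R => F (n + 2)%nat x ^ 2)) by cts.
  set (I := fun u v => RInt (fun x => F (n + 2)%nat x ^ 2) u v).
  assert (I0 : forall u v, u <= v -> 0 <= I u v)
    by (intros; apply integral_ge0; [cts | assumption | intros; apply pow2_ge_0]).
  assert (IC : forall u v w, I u v + I v w = I u w) by (intros; now apply integral_chasles).
  change (RInt (fun x => F (n + 2)%nat x ^ 2) (a - h) (a + 2 * h)) with (I (a - h) (a + 2 * h)).
  pose proof (I0 (a - h) a ltac:(lra)). pose proof (I0 a (a + h) ltac:(lra)).
  pose proof (I0 (a + h) (a + 2 * h) ltac:(lra)).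
  pose proof (IC (a - h) a (a + h)). pose proof (IC (a - h) (a + h) (a + 2 * h)).
  pose proof (IC a (a + h) (a + 2 * h)).
  pose proof (pow_lt h (2 * n + 1) h0) as hp.
  replace (h ^ (2 * n + 3)) with (h ^ 2 * h ^ (2 * n + 1)) by (rewrite <- pow_add; f_equal; lia).
  set (W := h ^ (2 * n + 1) * I (a - h) (a + 2 * h)).
  assert (W0 : 0 <= W) by (apply Rmult_le_pos; lra).
  replace (F 0%nat (a + h * s) - proj_ref F a h s) with
    (h * (RInt (fun r => F 1%nat (a + h * r) - slope F a h r) 0 s
     + - (c * RInt ker1 0 s * defect F h (a + h)) + - (c * (RInt ker0 0 s - 1) * defect F h a))).
  2:{ rewrite integral_minus by cts. unfold proj_ref. fold c.
      pose proof (integral_affine (F 1%nat) h a 0 s C1) as E.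
      rewrite (integral_ftc (F 0%nat) (F 1%nat)), Rmult_0_r, Rplus_0_r in E by (assumption || (intros; apply SF)).
      rewrite !Rmult_plus_distr_l, Rmult_minus_distr_l, E. rring. }
  rewrite Rpow_mult_distr.
  replace (3 * (Cs + c ^ 2 * R1 ^ 2 * Cd + c ^ 2 * R2 ^ 2 * Cd) * (h ^ 2 * h ^ (2 * n + 1) * I (a - h) (a + 2 * h)))
    with (h ^ 2 * (3 * (Cs * W + R1 ^ 2 * (c ^ 2 * (Cd * W)) + R2 ^ 2 * (c ^ 2 * (Cd * W))))) by (unfold W; ring).
  apply Rmult_le_compat_l; [apply pow2_ge_0|].
  assert (T3 : forall x y z, (x + y + z) ^ 2 <= 3 * (x ^ 2 + y ^ 2 + z ^ 2)).
  { intros x y z. pose proof (pow2_ge_0 (x - y)). pose proof (pow2_ge_0 (x - z)). pose proof (pow2_ge_0 (y - z)). nra. }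
  apply Rle_trans with (1 := T3 _ _ _). apply Rmult_le_compat_l; [lra|].
  assert (SQ : forall x R, Rabs x <= R -> x ^ 2 <= R ^ 2).
  { intros x R Hx. rewrite <- (pow2_abs x). apply pow_incr. split; [apply Rabs_pos | exact Hx]. }
  apply Rplus_le_compat; [apply Rplus_le_compat|].
  - rewrite (integral_ext _ (fun r => 1 * (F 1%nat (a + h * r) - slope F a h r))) by (intros; ring).
    apply Rle_trans with (1 := integral_cauchy_schwarz (fun _ => 1) (fun r => F 1%nat (a + h * r) - slope F a h r)
         0 s ltac:(lra) (cont_const 1) ltac:(cts)).
    rewrite integral_const.
    assert (RInt (fun r => (F 1%nat (a + h * r) - slope F a h r) ^ 2) 0 s <= (s - 0) * (Cs * W)).
    { rewrite <- integral_const. apply integral_le; [cts | cts | lra |]. intros r Hr.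
      eapply Rle_trans; [apply (Hs n F a h r nm SF h0); lra|].
      apply Rmult_le_compat_l; [lra|]. apply Rmult_le_compat_l; [lra|].
      change (I a (a + h) <= I (a - h) (a + 2 * h)). lra. }
    assert (0 <= RInt (fun r => (F 1%nat (a + h * r) - slope F a h r) ^ 2) 0 s)
        by (apply integral_ge0; [cts | lra | intros; apply pow2_ge_0]).
    assert (0 <= Cs * W) by (apply Rmult_le_pos; lra).
    simpl (1 ^ 2). nra.
  - replace ((- (c * RInt ker1 0 s * defect F h (a + h))) ^ 2)
      with ((RInt ker1 0 s) ^ 2 * (c ^ 2 * defect F h (a + h) ^ 2)) by ring.
    apply Rmult_le_compat; [apply pow2_ge_0 | apply Rmult_le_pos; apply pow2_ge_0 | apply SQ, HR1, s01 |].
    apply Rmult_le_compat_l; [apply pow2_ge_0|].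
    eapply Rle_trans; [apply (Hd n F (a + h) h nm SF h0)|].
    apply Rmult_le_compat_l; [lra|]. apply Rmult_le_compat_l; [lra|].
    replace (a + h - h) with a by ring. replace (a + h + h) with (a + 2 * h) by ring.
    change (I a (a + 2 * h) <= I (a - h) (a + 2 * h)). lra.
  - replace ((- (c * (RInt ker0 0 s - 1) * defect F h a)) ^ 2)
      with ((RInt ker0 0 s - 1) ^ 2 * (c ^ 2 * defect F h a ^ 2)) by ring.
    apply Rmult_le_compat; [apply pow2_ge_0 | apply Rmult_le_pos; apply pow2_ge_0 | apply SQ, HR2, s01 |].
    apply Rmult_le_compat_l; [apply pow2_ge_0|].
    eapply Rle_trans; [apply (Hd n F a h nm SF h0)|].
    apply Rmult_le_compat_l; [lra|]. apply Rmult_le_compat_l; [lra|].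
    change (I (a - h) (a + h) <= I (a - h) (a + 2 * h)). lra.
Qed.

End Projection.

(** * The one-dimensional form on a periodic grid *)

Lemma integral_period (g : R -> R) L a c : cont g -> (forall x, g (x + L) = g x) ->
  RInt g (a + c) (a + c + L) = RInt g a (a + L).
Proof.
  intros C P.
  pose proof (integral_chasles g a (a + c) C (a + c + L)) as E1.
  pose proof (integral_chasles g a (a + L) C (a + c + L)) as E2.
  pose proof (integral_shift g a (a + c) L C) as E3.
  rewrite (integral_ext (fun s => g (L + s)) g) in E3 by (intros x; rewrite Rplus_comm; apply P).
  replace (L + a) with (a + L) in E3 by ring. replace (L + (a + c)) with (a + c + L) in E3 by ring.
  lra.
Qed.

Lemma cont_shift (g : R -> R) c : cont g -> cont (fun x : R => g (x + c)).
Proof. intros C. apply (cont_comp1 g (fun x : R => x + c)); [exact C | cts]. Qed.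

Lemma integral_period_shift (g : R -> R) L a c : cont g -> (forall x, g (x + L) = g x) ->
  RInt (fun x => g (x + c)) a (a + L) = RInt g a (a + L).
Proof.
  intros C P. rewrite <- (integral_period g L a c C P).
  rewrite (integral_ext _ (fun x => g (c + x))) by (intros; f_equal; ring).
  rewrite integral_shift by exact C. f_equal; ring.
Qed.

(** Relabelling of the nodes around the period; summation by parts on the periodic grid rests on
    it. *)
Lemma sumr_cycle N (B : nat -> R) :
  sumr N (fun i => if Nat.eqb i N then B 1%nat else B (S i)) = sumr N B.
Proof.
  destruct N as [|N]; [now rewrite !sumr0|].
  rewrite sumrS, Nat.eqb_refl.
  rewrite (sumr_ext N _ (fun i => B (S i))).
  - enough (E : forall n, sumr n (fun i => B (S i)) + B 1%nat = sumr (S n) B) by apply E.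
    induction n as [|n IH]; [rewrite sumrS, !sumr0; rring|].
    rewrite (sumrS n), (sumrS (S n)), <- IH. rring.
  - intros i Hi. destruct (Nat.eqb_spec i (S N)); [lia | reflexivity].
Qed.

(** A weighted Cauchy-Schwarz inequality. The weight [a], a multiple of [h] in use, balances the
    nodal sum of defects against that of jumps. *)
Lemma sum_sq_quad_ge0 N (e j : nat -> R) (a P V : R) : 0 < a ->
  / a * sumr N (fun i => e i ^ 2) <= P -> a * sumr N (fun i => j i ^ 2) <= V ->
  quad_ge0 P (sumr N (fun i => e i * j i)) V.
Proof.
  intros a0 HP HV.
  apply quad_ge0_mono with (/ a * sumr N (fun i => e i ^ 2)) (a * sumr N (fun i => j i ^ 2));
    [| exact HP | exact HV].
  rewrite <- !sumr_scal. apply sumr_quad_ge0. intros i _.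
  apply le_quad_ge0.
  - apply Rmult_le_pos; [left; now apply Rinv_0_lt_compat | apply pow2_ge_0].
  - apply Rmult_le_pos; [lra | apply pow2_ge_0].
  - right. field. lra.
Qed.

Section Grid.
Variables (x0 h : R) (N : nat).
Hypothesis h0 : 0 < h.

Definition node (i : nat) : R := x0 + INR i * h.

Definition trace_minus (w : nat -> R -> R) (i : nat) : R := w i (node i).
Definition trace_plus (w : nat -> R -> R) (i : nat) : R :=
  if Nat.eqb i N then w 1%nat (node 0) else w (S i) (node i).

(** The derivatives are arguments of their own, so that splitting and rewriting need not pass
    through [Derive]. *)
Definition form1 (w dw v dv : nat -> R -> R) : R :=
  sumr N (fun i => RInt (fun x => dw i x * dv i x) (node (i - 1)) (node i))
  + sumr N (fun i => (trace_plus dw i + trace_minus dw i) / 2 * (trace_plus v i - trace_minus v i)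
                   + (trace_plus dv i + trace_minus dv i) / 2 * (trace_plus w i - trace_minus w i)).

Definition sqnorm1 (v : nat -> R -> R) : R :=
  sumr N (fun i => RInt (fun x => v i x ^ 2) (node (i - 1)) (node i)).

Lemma node_S i : node (S i) = node i + h.
Proof. unfold node. rewrite S_INR. ring. Qed.

Lemma node_pred i : (1 <= i)%nat -> node i = node (i - 1) + h.
Proof. intros Hi. rewrite <- node_S. f_equal. lia. Qed.

Lemma node_0 : node 0 = x0.
Proof. unfold node. simpl. ring. Qed.

Lemma node_N : node N = x0 + INR N * h.
Proof. reflexivity. Qed.

Lemma trace_plus_sum (B : nat -> R -> R) : sumr N (trace_plus B) = sumr N (fun i => B i (node (i - 1))).
Proof.
  rewrite <- (sumr_cycle N (fun i => B i (node (i - 1)))).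
  apply sumr_ext. intros i Hi. unfold trace_plus. destruct (Nat.eqb i N); [reflexivity|].
  now replace (S i - 1)%nat with i by lia.
Qed.

Lemma trace_plus_smooth f i : f (x0 + INR N * h) = f x0 -> trace_plus (fun _ => f) i = f (node i).
Proof.
  intros P. unfold trace_plus. destruct (Nat.eqb_spec i N) as [->|]; [|reflexivity].
  now rewrite node_N, P, node_0.
Qed.

Lemma form1_minus w dw w' dw' v dv :
  (forall i, (1 <= i <= N)%nat -> cont (dw i)) -> (forall i, (1 <= i <= N)%nat -> cont (dw' i)) ->
  (forall i, (1 <= i <= N)%nat -> cont (dv i)) ->
  form1 (fun i x => w i x - w' i x) (fun i x => dw i x - dw' i x) v dv = form1 w dw v dv - form1 w' dw' v dv.
Proof.
  intros C C' CV. unfold form1.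
  rewrite (sumr_ext N _ (fun i => RInt (fun x => dw i x * dv i x) (node (i - 1)) (node i)
    - RInt (fun x => dw' i x * dv i x) (node (i - 1)) (node i))).
  - rewrite sumr_minus.
    rewrite (sumr_ext N (fun i => (trace_plus (fun i x => dw i x - dw' i x) i + _) / 2 * _ + _) (fun i =>
     ((trace_plus dw i + trace_minus dw i) / 2 * (trace_plus v i - trace_minus v i)
                   + (trace_plus dv i + trace_minus dv i) / 2 * (trace_plus w i - trace_minus w i))
     - ((trace_plus dw' i + trace_minus dw' i) / 2 * (trace_plus v i - trace_minus v i)
                   + (trace_plus dv i + trace_minus dv i) / 2 * (trace_plus w' i - trace_minus w' i)))).
    + rewrite sumr_minus. rring.
    + intros i _. unfold trace_plus, trace_minus. destruct (Nat.eqb i N); field.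
  - intros i Hi. specialize (C i Hi). specialize (C' i Hi). specialize (CV i Hi).
    rewrite <- integral_minus by cts. apply integral_ext; intros; ring.
Qed.

(** Integration by parts on each cell. [F] has no jumps, and the boundary terms, regrouped by nodes,
    cancel the products of [F 1] with the jumps of [v]. *)
Lemma form1_smooth F v dv : smooth1 F -> periodic1 (INR N * h) F ->
  (forall i x, (1 <= i <= N)%nat -> is_derive (v i) x (dv i x)) ->
  (forall i, (1 <= i <= N)%nat -> cont (dv i)) ->
  form1 (fun _ => F 0%nat) (fun _ => F 1%nat) v dv
  = - sumr N (fun i => RInt (fun x => F 2%nat x * v i x) (node (i - 1)) (node i)).
Proof.
  intros SF PF DV CV. unfold form1.
  pose proof (smooth1_cont F 1 SF) as C1. pose proof (smooth1_cont F 2 SF) as C2.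
  rewrite (sumr_ext N (fun i => RInt _ _ _) (fun i =>
     ((F 1%nat (node i) * v i (node i)) - F 1%nat (node (i - 1)) * v i (node (i - 1)))
       - RInt (fun x => F 2%nat x * v i x) (node (i - 1)) (node i))).
  2:{ intros i Hi. specialize (CV i Hi).
      assert (Cv : cont (v i)) by (apply (cont_of_derive _ (dv i)); intros; now apply DV).
      rewrite <- (integral_ftc (fun x => F 1%nat x * v i x) (fun x => F 2%nat x * v i x + F 1%nat x * dv i x)).
      - rewrite integral_plus by cts. lra.
      - intros x. apply deriv_mult; [apply SF | now apply DV].
      - cts. }
  rewrite (sumr_ext N (fun i => _ / 2 * _ + _) (fun i =>
     trace_plus (fun i x => F 1%nat x * v i x) i - F 1%nat (node i) * v i (node i))).
  2:{ intros i Hi. rewrite !(trace_plus_smooth _ i) by (apply (PF _ x0)). unfold trace_minus.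
      replace (trace_plus (fun i x => F 1%nat x * v i x) i) with (F 1%nat (node i) * trace_plus v i).
      - field.
      - unfold trace_plus. destruct (Nat.eqb_spec i N) as [->|]; [|reflexivity].
        now rewrite node_N, (PF _ x0), node_0. }
  rewrite !sumr_minus, trace_plus_sum. rring.
Qed.


End Grid.

(** * Inverse estimates and jumps *)

Lemma node_bound k : exists C, 0 < C /\ forall v a h, isP k v -> 0 < h ->
  h * v a ^ 2 <= C * RInt (fun x => v x ^ 2) a (a + h) /\
  h * v (a + h) ^ 2 <= C * RInt (fun x => v x ^ 2) a (a + h).
Proof.
  destruct (onb_exists k) as [q B].
  set (S0 := sum0 k (fun i => q i 0 ^ 2)). set (S1 := sum0 k (fun i => q i 1 ^ 2)).
  assert (0 <= S0) by (apply sum0_ge0; intros; apply pow2_ge_0).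
  assert (0 <= S1) by (apply sum0_ge0; intros; apply pow2_ge_0).
  exists (S0 + S1 + 1). split; [lra|]. intros v a h P h0.
  pose proof (isP_cont _ _ P) as C.
  assert (P' : isP k (fun s => v (a + h * s))) by now apply isP_affine.
  assert (E : h * dot (fun s => v (a + h * s)) (fun s => v (a + h * s)) = RInt (fun x => v x ^ 2) a (a + h)).
  { pose proof (integral_affine (fun x => v x ^ 2) h a 0 1 ltac:(cts)) as E.
    rewrite Rmult_0_r, Rmult_1_r, Rplus_0_r in E. rewrite <- E. f_equal. apply integral_ext; intros; ring. }
  assert (D0 : 0 <= RInt (fun x => v x ^ 2) a (a + h))
    by (apply integral_ge0; [cts | lra | intros; apply pow2_ge_0]).
  pose proof (inverse_ineq k q _ 0 B P') as H0'. pose proof (inverse_ineq k q _ 1 B P') as H1'.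
  cbv beta in H0', H1'. fold S0 in H0'. fold S1 in H1'.
  replace (a + h * 0) with a in H0' by ring. replace (a + h * 1) with (a + h) in H1' by ring.
  rewrite <- E in D0 |- *. set (d := dot _ _) in *.
  split; nra.
Qed.

(** The two traces at a node belong to neighbouring cells, and each cell serves two nodes. The
    factor [h] on the left is the price of measuring jumps by the L2 norm alone. *)
Lemma jump_bound k : exists C, 0 < C /\ forall x0 h N v, 0 < h ->
  (forall i, (1 <= i <= N)%nat -> isP k (v i)) ->
  h * sumr N (fun i => (trace_plus x0 h N v i - trace_minus x0 h v i) ^ 2) <= C * sqnorm1 x0 h N v.
Proof.
  destruct (node_bound k) as (C & C0 & H). exists (4 * C). split; [lra|].
  intros x0 h N v h0 P.
  pose (cell := fun i => RInt (fun x => v i x ^ 2) (node x0 h (i - 1)) (node x0 h i)).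
  assert (Hc : forall i, (1 <= i <= N)%nat ->
    h * v i (node x0 h (i - 1)) ^ 2 <= C * cell i /\ h * v i (node x0 h i) ^ 2 <= C * cell i).
  { intros i Hi. unfold cell. rewrite (node_pred x0 h i) by lia. apply H; auto. }
  apply Rle_trans with (2 * (sumr N (trace_plus x0 h N (fun i x => h * v i x ^ 2))
      + sumr N (fun i => h * v i (node x0 h i) ^ 2))).
  - rewrite <- sumr_plus, <- !sumr_scal. apply sumr_le. intros i Hi.
    replace (trace_plus x0 h N (fun i x => h * v i x ^ 2) i) with (h * trace_plus x0 h N v i ^ 2)
      by (unfold trace_plus; destruct (Nat.eqb i N); reflexivity).
    unfold trace_minus. pose proof (pow2_ge_0 (trace_plus x0 h N v i + v i (node x0 h i))). nra.
  - rewrite trace_plus_sum.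
    assert (sumr N (fun i => h * v i (node x0 h (i - 1)) ^ 2) <= C * sqnorm1 x0 h N v)
      by (unfold sqnorm1; rewrite <- sumr_scal; apply sumr_le; intros; now apply Hc).
    assert (sumr N (fun i => h * v i (node x0 h i) ^ 2) <= C * sqnorm1 x0 h N v)
      by (unfold sqnorm1; rewrite <- sumr_scal; apply sumr_le; intros; now apply Hc).
    lra.
Qed.

Lemma sqnorm1_cells (g : R -> R) x0 h N : cont g ->
  sumr N (fun i => RInt g (node x0 h (i - 1)) (node x0 h i)) = RInt g x0 (x0 + INR N * h).
Proof. intros C. apply integral_cells, C. Qed.

(** A translated partition still covers one period. Integrals over the neighbours of all cells are
    summed in this way, with no special case at the ends. *)
Lemma integral_cells_shift (g : R -> R) x0 h N c : cont g -> (forall x, g (x + INR N * h) = g x) ->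
  sumr N (fun i => RInt g (node x0 h (i - 1) + c) (node x0 h i + c)) = RInt g x0 (x0 + INR N * h).
Proof.
  intros C P. rewrite <- (integral_period_shift g _ x0 c C P), <- sqnorm1_cells by (now apply cont_shift).
  apply sumr_ext. intros i _.
  rewrite (integral_ext (fun x => g (x + c)) (fun x => g (c + x))) by (intros; f_equal; ring).
  rewrite integral_shift by exact C. f_equal; ring.
Qed.

Lemma second_diff_periodic h L F : periodic1 L F -> periodic1 L (second_diff h F).
Proof.
  intros P n x. unfold second_diff. rewrite P.
  replace (x + L + h) with (x + h + L) by ring. replace (x + L - h) with (x - h + L) by ring.
  now rewrite !P.
Qed.

(** * Second differences in L2 *)

Section SecondDifference.
Variables (F : nat -> R -> R) (x0 h L : R).
Hypotheses (SF : smooth1 F) (PF : periodic1 L F) (h0 : 0 < h) (L0 : 0 < L).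

Let cF n : cont (F n) := smooth1_cont F n SF.

Lemma second_diff_norm_0 n :
  RInt (fun x => second_diff h F n x ^ 2) x0 (x0 + L) <= 18 * RInt (fun x => F n x ^ 2) x0 (x0 + L).
Proof.
  pose proof (cF n) as C.
  assert (C1 : cont (fun x : R => F n (x + h))) by now apply cont_shift.
  assert (C2 : cont (fun x : R => F n (x - h))) by (apply (cont_shift (F n) (- h)), C).
  assert (CC : cont (fun x : R => F n x ^ 2)) by cts.
  assert (P : forall x, (fun x => F n x ^ 2) (x + L) = (fun x => F n x ^ 2) x) by (intros; simpl; now rewrite PF).
  pose proof (integral_period_shift _ L x0 h CC P) as E1.
  pose proof (integral_period_shift _ L x0 (- h) CC P) as E2. cbv beta in E1, E2.
  (* Cauchy-Schwarz with the squared weights 1, 4, 1 gives 6; the three translates have equal norms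
     over a period, hence 18. *)
  apply Rle_trans with (RInt (fun x => 6 * (F n (x + h) ^ 2 + F n x ^ 2 + F n (x - h) ^ 2)) x0 (x0 + L)).
  - apply integral_le; [unfold second_diff; cts | cts | lra |]. intros x _. unfold second_diff.
    set (u := F n (x + h)). set (v := F n x). set (w := F n (x - h)).
    pose proof (pow2_ge_0 (2 * u + v)). pose proof (pow2_ge_0 (u - w)). pose proof (pow2_ge_0 (2 * w + v)). nra.
  - rewrite integral_scal, integral_plus, integral_plus by cts. unfold Rminus at 1. rewrite E1, E2. lra.
Qed.

(** The second difference is the integral of [F (S n) (x + t) - F (S n) (x - t)] over [0 <= t <= h],
    and this integrand is an integral of the next derivative over a window of length [2 * t].
    Cauchy-Schwarz, used twice, gives [2 * h ^ 3] times a local integral; integrating in [x] and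
    exchanging the order contributes the length [2 * h] of the largest window. *)
Lemma second_diff_norm_2 n :
  RInt (fun x => second_diff h F n x ^ 2) x0 (x0 + L)
  <= 4 * h ^ 4 * RInt (fun x => F (S (S n)) x ^ 2) x0 (x0 + L).
Proof.
  pose proof (cF n) as C. pose proof (cF (S n)) as C1. pose proof (cF (S (S n))) as C2.
  assert (CC : cont (fun x : R => F (S (S n)) x ^ 2)) by cts.
  assert (Csh : forall c, cont (fun t : R => F (S n) (c + t))).
  { intros c. apply (cont_comp1 (F (S n)) (fun t : R => c + t)); [exact C1 | cts]. }
  assert (Csm : forall c, cont (fun t : R => F (S n) (c - t))).
  { intros c. apply (cont_comp1 (F (S n)) (fun t : R => c - t)); [exact C1 | cts]. }
  assert (Cs2 : cont2 (fun x t => F (S (S n)) (x + t) ^ 2)).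
  { apply (cont_pow (fun p : R * R => F (S (S n)) (fst p + snd p))).
    apply (cont_comp1 (F (S (S n))) (fun p : R * R => fst p + snd p)); [exact C2 | cts]. }
  assert (B : forall x, second_diff h F n x ^ 2
      <= 2 * h ^ 3 * RInt (fun t => F (S (S n)) (x + t) ^ 2) (- h) h).
  { intros x.
    assert (E : second_diff h F n x = RInt (fun t => 1 * (F (S n) (x + t) - F (S n) (x - t))) 0 h).
    { unfold second_diff.
      rewrite (integral_ftc (fun t => F n (x + t) + F n (x - t))).
      - rewrite Rplus_0_r, Rminus_0_r. ring.
      - intros t. apply (deriv_val _ _ (F (S n) (x + t) + -1 * F (S n) (x + -1 * t))).
        + apply deriv_plus; [apply (smooth1_shift F x SF n t)|].
          apply is_derive_ext with (fun t => F n (x + -1 * t)); [intros; f_equal; ring|].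
          apply deriv_affine, SF.
        + replace (x + -1 * t) with (x - t) by ring. ring.
      - apply cont_mult; [cts | apply cont_minus; auto]. }
    set (Q := RInt (fun t => F (S (S n)) (x + t) ^ 2) (- h) h).
    assert (CQ : cont (fun t : R => F (S (S n)) (x + t) ^ 2)).
    { apply (cont_pow (fun t : R => F (S (S n)) (x + t))).
      apply (cont_comp1 (F (S (S n))) (fun t : R => x + t)); [exact C2 | cts]. }
    assert (Q0 : 0 <= Q) by (apply integral_ge0; [exact CQ | lra | intros; apply pow2_ge_0]).
    assert (H : forall t, 0 <= t <= h -> (F (S n) (x + t) - F (S n) (x - t)) ^ 2 <= 2 * h * Q).
    { intros t Ht.
      assert (E1 : F (S n) (x + t) - F (S n) (x - t) = RInt (fun r => 1 * F (S (S n)) (x + r)) (- t) t).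
      { rewrite (integral_ext _ (fun r => F (S (S n)) (x + r))) by (intros; ring).
        rewrite (integral_ftc (fun r => F (S n) (x + r))).
        - f_equal.
        - intros r; apply (smooth1_shift F x SF).
        - apply (cont_comp1 (F (S (S n))) (fun t : R => x + t)); [exact C2 | cts]. }
      rewrite E1.
      eapply Rle_trans; [apply integral_cauchy_schwarz; [lra | cts |]|].
      { apply (cont_comp1 (F (S (S n))) (fun t : R => x + t)); [exact C2 | cts]. }
      cbv beta. rewrite integral_const.
      assert (RInt (fun r => F (S (S n)) (x + r) ^ 2) (- t) t <= Q).
      { unfold Q. rewrite <- (integral_chasles _ (- h) (- t) CQ h), <- (integral_chasles _ (- t) t CQ h).
        assert (0 <= RInt (fun r => F (S (S n)) (x + r) ^ 2) (- h) (- t))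
          by (apply integral_ge0; [exact CQ | lra | intros; apply pow2_ge_0]).
        assert (0 <= RInt (fun r => F (S (S n)) (x + r) ^ 2) t h)
          by (apply integral_ge0; [exact CQ | lra | intros; apply pow2_ge_0]).
        lra. }
      assert (0 <= RInt (fun r => F (S (S n)) (x + r) ^ 2) (- t) t)
          by (apply integral_ge0; [exact CQ | lra | intros; apply pow2_ge_0]).
      replace ((t - - t) * 1 ^ 2) with (2 * t) by ring.
      apply Rmult_le_compat; lra. }
    rewrite E.
    eapply Rle_trans; [apply integral_cauchy_schwarz; [lra | cts | apply cont_minus; auto]|].
    cbv beta. rewrite integral_const.
    assert (A : RInt (fun t => (F (S n) (x + t) - F (S n) (x - t)) ^ 2) 0 h <= (h - 0) * (2 * h * Q)).
    { rewrite <- integral_const. apply integral_le; [apply cont_pow, cont_minus; auto | cts | lra | exact H]. }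
    replace ((h - 0) * 1 ^ 2) with h by ring.
    replace (2 * h ^ 3 * Q) with (h * ((h - 0) * (2 * h * Q))) by ring.
    apply Rmult_le_compat_l; [lra | exact A]. }
  assert (CI : cont (fun x : R => RInt (fun t => F (S (S n)) (x + t) ^ 2) (- h) h))
    by (apply (cont_RInt (fun x t : R => F (S (S n)) (x + t) ^ 2)); [lra | exact Cs2]).
  apply Rle_trans with (RInt (fun x => 2 * h ^ 3 * RInt (fun t => F (S (S n)) (x + t) ^ 2) (- h) h) x0 (x0 + L)).
  - apply integral_le; [| cts | lra | intros; apply B].
    apply (cont_pow (fun x : R => second_diff h F n x)), smooth1_cont, smooth1_second_diff, SF.
  - rewrite integral_scal by exact CI.
    rewrite (fubini (fun x t => F (S (S n)) (x + t) ^ 2)) by (lra || exact Cs2).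
    rewrite (integral_ext _ (fun _ => RInt (fun x => F (S (S n)) x ^ 2) x0 (x0 + L))).
    + rewrite integral_const. right. ring.
    + intros t. apply (integral_period_shift (fun x => F (S (S n)) x ^ 2)); [exact CC|].
      intros x; simpl; now rewrite PF.
Qed.
End SecondDifference.

(** * Error estimates in one variable *)

Section Error.
Variables (m : nat) (p : nat -> R -> R).
Hypothesis Bp : onb m p.

Section Identity.
Variables (x0 h : R) (N : nat) (F : nat -> R -> R) (v dv : nat -> R -> R).
Hypotheses (h0 : 0 < h) (SF : smooth1 F) (PF : periodic1 (INR N * h) F)
  (Pdv : forall i, (1 <= i <= N)%nat -> isP m (dv i)).

Notation X := (node x0 h).
Let P i x := Pi m p F (X (i - 1)) h x.
Let P' i x := Pi' m p F (X (i - 1)) h x.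

(* Only the averages of the derivative error at the nodes survive, and these are
   second differences. *)
Lemma form1_error :
  form1 x0 h N (fun i x => F 0%nat x - P i x) (fun i x => F 1%nat x - P' i x) v dv
  = sumr N (fun i => - (ker1 m p 0 / kappa m p) * defect m p (second_diff h F) h (X i)
                     * (trace_plus x0 h N v i - trace_minus x0 h v i)).
Proof.
  set (c := 2 / kappa m p). set (g := fun i => defect m p F h (X i)).
  assert (hn : h <> 0) by lra.
  (* Nodes 0 and [N] are one point of the circle; equal defects there let the regrouped sums close
     up. *)
  assert (gN : g N = g 0%nat).
  { unfold g. rewrite (node_N x0 h N), defect_periodic, node_0 by exact PF. reflexivity. }
  assert (Per : forall i, F 0%nat (X i + INR N * h) = F 0%nat (X i)) by (intros; apply PF).
  assert (plF : forall n i, trace_plus x0 h N (fun _ => F n) i = F n (X i))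
    by (intros; apply trace_plus_smooth, PF).
  assert (plP' : forall i, (1 <= i)%nat -> trace_plus x0 h N P' i = dproj_ref m p F (X i) h 0).
  { intros i Hi. unfold trace_plus, P'. destruct (Nat.eqb_spec i N) as [->|].
    - simpl (1 - 1)%nat. replace (X 0) with (X 0 + h * 0) at 2 by ring. rewrite Pi'_node by exact hn.
      rewrite (node_N x0 h N), node_0. symmetry. now apply dproj_ref_periodic.
    - replace (S i - 1)%nat with i by lia.
      replace (X i) with (X i + h * 0) at 2 by ring. now rewrite Pi'_node. }
  assert (miP' : forall i, (1 <= i)%nat -> trace_minus x0 h P' i = dproj_ref m p F (X i - h) h 1).
  { intros i Hi. unfold trace_minus, P'. rewrite (node_pred x0 h i) by exact Hi.
    replace (X (i - 1) + h) with (X (i - 1) + h * 1) at 1 by ring. rewrite Pi'_node by exact hn.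
    f_equal. ring. }
  assert (plP : forall i, (1 <= i)%nat -> trace_plus x0 h N P i = F 0%nat (X i) - c * h * g i).
  { intros i Hi. unfold trace_plus, P. destruct (Nat.eqb_spec i N) as [->|].
    - simpl (1 - 1)%nat. replace (X 0) with (X 0 + h * 0) at 2 by ring. rewrite Pi_node by exact hn.
      rewrite proj_ref_0, gN. unfold c, g. rewrite (node_N x0 h N), node_0, PF. reflexivity.
    - replace (S i - 1)%nat with i by lia.
      replace (X i) with (X i + h * 0) at 2 by ring. rewrite Pi_node, proj_ref_0 by exact hn. reflexivity. }
  assert (miP : forall i, (1 <= i)%nat -> trace_minus x0 h P i = F 0%nat (X i) + c * h * g i).
  { intros i Hi. unfold trace_minus, P, g. rewrite (node_pred x0 h i) by exact Hi.
    replace (X (i - 1) + h) with (X (i - 1) + h * 1) at 1 by ring. rewrite Pi_node by exact hn.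
    now rewrite (proj_ref_1 m p Bp) by exact SF. }
  assert (V : forall i, (1 <= i <= N)%nat ->
     RInt (fun x => (F 1%nat x - P' i x) * dv i x) (X (i - 1)) (X i)
     = - c * h * (g i * dv i (X i) + g (i - 1)%nat * dv i (X (i - 1)))).
  { intros i Hi. specialize (Pdv i Hi). pose proof (isP_cont _ _ Pdv) as Cd.
    pose proof (smooth1_cont F 1 SF) as C1.
    assert (CP : cont (P' i)).
    { unfold P', Pi', dproj_ref. pose proof (cont_ker1 m p Bp). pose proof (cont_ker0 m p Bp).
      pose proof (cont_slope m p Bp F (X (i - 1)) h). unfold Rdiv.
      assert (Ca : cont (fun x : R => (x - X (i - 1)) * / h)) by cts.
      apply cont_plus; [exact (cont_comp1 _ _ H1 Ca)|]. apply cont_mult; [cts|].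
      apply cont_plus; (apply cont_mult; [cts|]).
      - exact (cont_comp1 _ _ H Ca).
      - exact (cont_comp1 _ _ H0 Ca). }
    rewrite (node_pred x0 h i) by lia.
    replace (X (i - 1)) with (X (i - 1) + h * 0) at 1 by ring.
    replace (X (i - 1) + h) with (X (i - 1) + h * 1) at 1 by ring.
    rewrite <- (integral_affine (fun x => (F 1%nat x - P' i x) * dv i x)) by cts.
    rewrite (integral_ext _ (fun s => (F 1%nat (X (i - 1) + h * s) - dproj_ref m p F (X (i - 1)) h s)
        * dv i (X (i - 1) + h * s))).
    - pose proof (dproj_ref_orth m p Bp F (X (i - 1)) h (fun s => dv i (X (i - 1) + h * s)) SF
        (isP_affine _ _ _ _ Pdv)) as O.
      unfold dot in O. rewrite O. unfold g, c. rewrite (node_pred x0 h i) by lia.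
      rewrite Rmult_1_r, Rmult_0_r, Rplus_0_r. rring.
    - intros s. unfold P'. now rewrite Pi'_node. }
  unfold form1. rewrite (sumr_ext N _ _ V).
  (* The error jumps by [2 * c * h * g i] at node [i]. Against the average of [dv] this produces,
     after regrouping by cells, the volume terms of [V] with the opposite sign; the other product is
     left to [defect_identity]. *)
  rewrite (sumr_ext N (fun i => _ / 2 * _ + _) (fun i =>
     - (ker1 m p 0 / kappa m p) * defect m p (second_diff h F) h (X i) * (trace_plus x0 h N v i - trace_minus x0 h v i)
     + c * h * (trace_plus x0 h N (fun i x => g (i - 1)%nat * dv i x) i + g i * dv i (X i)))).
  2:{ intros i Hi.
      assert (Epl : forall (f f' : nat -> R -> R), trace_plus x0 h N (fun i x => f i x - f' i x) i
         = trace_plus x0 h N f i - trace_plus x0 h N f' i) by (intros; unfold trace_plus; now destruct (Nat.eqb i N)).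
      assert (Emi : forall (f f' : nat -> R -> R), trace_minus x0 h (fun i x => f i x - f' i x) i
         = trace_minus x0 h f i - trace_minus x0 h f' i) by reflexivity.
      rewrite (Epl (fun _ => F 0%nat)), (Epl (fun _ => F 1%nat)), (Emi (fun _ => F 0%nat)), (Emi (fun _ => F 1%nat)).
      rewrite !plF, plP, plP', miP, miP' by lia.
      replace (trace_plus x0 h N (fun i x => g (i - 1)%nat * dv i x) i) with (g i * trace_plus x0 h N dv i).
      2:{ unfold trace_plus. destruct (Nat.eqb_spec i N) as [->|]; [simpl; now rewrite gN|].
          now replace (S i - 1)%nat with i by lia. }
      pose proof (defect_identity m p Bp F h (X i)) as DI.
      rewrite <- (defect_second_diff m p Bp) in DI by exact SF. rewrite <- DI.
      unfold trace_minus. field. }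
  rewrite sumr_plus, !sumr_scal, !sumr_plus, trace_plus_sum. rring.
Qed.
End Identity.

(** Two estimates of one quantity. With [n = m], defects and jumps together leave [h ^ (2 * m)], to
    which [second_diff_norm_2] adds [h ^ 4]. With [n = 0] and [second_diff_norm_0] no order is
    gained, but second derivatives of [F] suffice. *)
Lemma form1_error_bounds : exists C, 0 < C /\ forall x0 h N F v dv, 0 < h -> (1 <= N)%nat ->
  smooth1 F -> periodic1 (INR N * h) F ->
  (forall i, (1 <= i <= N)%nat -> isP (S m) (v i)) ->
  (forall i, (1 <= i <= N)%nat -> isP m (dv i)) ->
  let A := form1 x0 h N (fun i x => F 0%nat x - Pi m p F (node x0 h (i - 1)) h x)
                     (fun i x => F 1%nat x - Pi' m p F (node x0 h (i - 1)) h x) v dv in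
  let nrm n := RInt (fun x => F n x ^ 2) x0 (x0 + INR N * h) in
  quad_ge0 (C * h ^ (2 * m + 4) * nrm (m + 4)%nat) A (sqnorm1 x0 h N v) /\
  quad_ge0 (C * nrm 2%nat) A (sqnorm1 x0 h N v).
Proof.
  destruct (jump_bound (S m)) as (CJ & CJ0 & HJ).
  destruct (defect_error m p Bp) as (CD & CD0 & HD).
  set (b := (ker1 m p 0 / kappa m p) ^ 2). assert (b0 : 0 <= b) by apply pow2_ge_0.
  (* Two cells meet at a node, which gives 2, times the 18 of [second_diff_norm_0]; the other
     estimate takes only [2 * 4]. The added 1 makes the constant positive without an inspection of
     [b]. *)
  exists (36 * (CJ * (b * CD)) + 1). 
  assert (0 <= CJ * (b * CD)) by (apply Rmult_le_pos; [lra | apply Rmult_le_pos; lra]).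
  split; [lra|].
  intros x0 h N F v dv h0 N1 SF PF proj_ref Pdv A nrm.
  assert (NL : 0 < INR N * h) by (apply Rmult_lt_0_compat; [apply lt_0_INR; lia | exact h0]).
  pose proof (smooth1_second_diff h F SF) as SS.
  pose proof (second_diff_periodic h _ F PF) as PS.
  assert (E : forall n, (n <= m)%nat ->
     sumr N (fun i => (- (ker1 m p 0 / kappa m p) * defect m p (second_diff h F) h (node x0 h i)) ^ 2)
     <= 2 * (b * CD) * h ^ (2 * n + 1) * RInt (fun x => second_diff h F (n + 2)%nat x ^ 2) x0 (x0 + INR N * h)).
  { intros n nm. set (D := fun x => second_diff h F (n + 2)%nat x ^ 2).
    assert (CDx : cont D) by (apply (cont_pow (second_diff h F (n + 2)%nat)), smooth1_cont, SS).
    assert (PD : forall x, D (x + INR N * h) = D x) by (intros; unfold D; now rewrite PS).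
    replace (2 * (b * CD) * h ^ (2 * n + 1) * RInt D x0 (x0 + INR N * h))
      with (b * CD * h ^ (2 * n + 1) * (RInt D x0 (x0 + INR N * h) + RInt D x0 (x0 + INR N * h))) by ring.
    rewrite <- (integral_cells_shift D x0 h N 0 CDx PD) at 1.
    rewrite <- (integral_cells_shift D x0 h N h CDx PD) at 1.
    rewrite <- sumr_plus, <- sumr_scal. apply sumr_le. intros i Hi.
    rewrite !Rplus_0_r. replace (node x0 h (i - 1) + h) with (node x0 h i) by (apply node_pred; lia).
    rewrite (integral_chasles D _ _ CDx).
    replace (node x0 h (i - 1)) with (node x0 h i - h) by (rewrite (node_pred x0 h i) by lia; ring).
    rewrite Rpow_mult_distr. replace ((- (ker1 m p 0 / kappa m p)) ^ 2) with b by (unfold b; ring).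
    rewrite !Rmult_assoc. apply Rmult_le_compat_l; [exact b0|].
    apply (HD n (second_diff h F)); assumption. }
  specialize (HJ x0 h N v h0 proj_ref).
  assert (G : forall n Q, (n <= m)%nat ->
     RInt (fun x => second_diff h F (n + 2)%nat x ^ 2) x0 (x0 + INR N * h) <= Q ->
     quad_ge0 (CJ * (2 * (b * CD) * h ^ (2 * n) * Q)) A (sqnorm1 x0 h N v)).
  { intros n Q nm HQ. unfold A. rewrite form1_error by assumption.
    apply sum_sq_quad_ge0 with (h / CJ).
    - now apply Rdiv_lt_0_compat.
    - replace (/ (h / CJ)) with (CJ * / h) by (field; lra).
      rewrite Rmult_assoc. apply Rmult_le_compat_l; [lra|].
      apply Rmult_le_reg_l with h; [exact h0|]. rewrite <- Rmult_assoc, Rinv_r, Rmult_1_l by lra.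
      eapply Rle_trans; [apply (E n nm)|].
      replace (h * (2 * (b * CD) * h ^ (2 * n) * Q)) with (2 * (b * CD) * h ^ (2 * n + 1) * Q)
        by (rewrite pow_add; ring).
      apply Rmult_le_compat_l; [|exact HQ].
      apply Rmult_le_pos; [| left; now apply pow_lt]. apply Rmult_le_pos; [lra|].
      apply Rmult_le_pos; lra.
    - replace (h / CJ * sumr N (fun i => (trace_plus x0 h N v i - trace_minus x0 h v i) ^ 2))
        with (/ CJ * (h * sumr N (fun i => (trace_plus x0 h N v i - trace_minus x0 h v i) ^ 2))) by (field; lra).
      apply Rmult_le_reg_l with CJ; [exact CJ0|]. rewrite <- Rmult_assoc, Rinv_r by lra. lra. }
  assert (N0 : forall n, 0 <= nrm n).
  { intros n. pose proof (smooth1_cont F n SF). apply integral_ge0; [cts | lra | intros; apply pow2_ge_0]. }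
  split.
  - eapply quad_ge0_mono; [eapply (G m _ (le_n m)), (second_diff_norm_2 F x0 h _ SF PF h0 NL) | | apply Rle_refl].
    replace (S (S (m + 2))) with (m + 4)%nat by lia. fold (nrm (m + 4)%nat).
    replace (h ^ (2 * m + 4)) with (h ^ (2 * m) * h ^ 4) by (now rewrite pow_add).
    assert (0 <= h ^ (2 * m) * h ^ 4 * nrm (m + 4)%nat)
      by (apply Rmult_le_pos; [apply Rmult_le_pos; left; now apply pow_lt | apply N0]).
    nra.
  - eapply quad_ge0_mono; [eapply (G 0%nat _ (Nat.le_0_l m)), (second_diff_norm_0 F x0 h _ SF PF NL) | | apply Rle_refl].
    simpl (0 + 2)%nat. fold (nrm 2%nat). pose proof (N0 2%nat). simpl (h ^ (2 * 0)). nra.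
Qed.

(** By subtraction: the form of [F] itself is, up to sign, the integral of [F 2] against [v], and
    the form of its error is bounded through [F 2] alone. It will be applied to an [F] that is
    already an error in the other variable, whose [F 2] is small. *)
Lemma form1_Pi_bound : exists C, 0 < C /\ forall x0 h N F v dv, 0 < h -> (1 <= N)%nat ->
  smooth1 F -> periodic1 (INR N * h) F ->
  (forall i, (1 <= i <= N)%nat -> isP (S m) (v i)) ->
  (forall i, (1 <= i <= N)%nat -> isP m (dv i)) ->
  (forall i x, (1 <= i <= N)%nat -> is_derive (v i) x (dv i x)) ->
  quad_ge0 (C * RInt (fun x => F 2%nat x ^ 2) x0 (x0 + INR N * h))
    (form1 x0 h N (fun i x => Pi m p F (node x0 h (i - 1)) h x)
               (fun i x => Pi' m p F (node x0 h (i - 1)) h x) v dv) (sqnorm1 x0 h N v).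
Proof.
  destruct form1_error_bounds as (C & C0 & H).
  exists (2 * C + 2). split; [lra|].
  intros x0 h N F v dv h0 N1 SF PF proj_ref Pdv DV.
  assert (NL : 0 < INR N * h) by (apply Rmult_lt_0_compat; [apply lt_0_INR; lia | exact h0]).
  destruct (H x0 h N F v dv h0 N1 SF PF proj_ref Pdv) as [_ H2]. cbv zeta in H2.
  pose proof (smooth1_cont F 2 SF) as C2. pose proof (smooth1_cont F 1 SF) as C1.
  assert (CdV : forall i, (1 <= i <= N)%nat -> cont (dv i)) by (intros i Hi; apply (isP_cont m), Pdv, Hi).
  assert (CP : forall i, (1 <= i <= N)%nat -> cont (fun x : R => Pi' m p F (node x0 h (i - 1)) h x)).
  { intros i Hi. pose proof (cont_ker1 m p Bp) as c1. pose proof (cont_ker0 m p Bp) as c0.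
    pose proof (cont_slope m p Bp F (node x0 h (i - 1)) h) as cs.
    unfold Pi', dproj_ref, Rdiv. assert (Ca : cont (fun x : R => (x - node x0 h (i - 1)) * / h)) by cts.
    apply cont_plus; [exact (cont_comp1 _ _ cs Ca)|]. apply cont_mult; [cts|].
    apply cont_plus; (apply cont_mult; [cts|]); [exact (cont_comp1 _ _ c1 Ca) | exact (cont_comp1 _ _ c0 Ca)]. }
  rewrite (form1_minus x0 h N (fun _ => F 0%nat) (fun _ => F 1%nat)) in H2 by auto.
  rewrite (form1_smooth x0 h N F v dv SF PF DV CdV) in H2.
  set (A := form1 _ _ _ _ _ _ _) in *.
  set (B := sumr N (fun i => RInt (fun x => F 2%nat x * v i x) (node x0 h (i - 1)) (node x0 h i))) in *.
  assert (HB : quad_ge0 (RInt (fun x => F 2%nat x ^ 2) x0 (x0 + INR N * h)) B (sqnorm1 x0 h N v)).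
  { rewrite <- sqnorm1_cells by cts. apply sumr_quad_ge0. intros i Hi.
    assert (cont (v i)) by (apply (isP_cont (S m)), proj_ref, Hi).
    apply quad_ge0_int; [rewrite (node_pred x0 h i) by lia; lra | cts | cts | cts |].
    intros x _. apply le_quad_ge0; [apply pow2_ge_0 | apply pow2_ge_0 | right; ring]. }
  (* Half the sum of the two quadratics at [-2 * t]: [B] cancels, and the leading coefficient
     becomes [2 * C + 2]. *)
  intros t. specialize (H2 (-2 * t)). specialize (HB (-2 * t)).
  lra.
Qed.

(** Each local bound involves a cell and its two neighbours, so every cell is counted three
    times. *)
Lemma Pi_L2_error : exists C, 0 < C /\ forall n x0 h N F, (n <= m)%nat -> 0 < h -> (1 <= N)%nat ->
  smooth1 F -> periodic1 (INR N * h) F ->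
  sqnorm1 x0 h N (fun i x => F 0%nat x - Pi m p F (node x0 h (i - 1)) h x)
  <= C * h ^ (2 * n + 4) * RInt (fun x => F (n + 2)%nat x ^ 2) x0 (x0 + INR N * h).
Proof.
  destruct (Pi_error m p Bp) as (C & C0 & H). exists (3 * C). split; [lra|].
  intros n x0 h N F nm h0 N1 SF PF.
  pose proof (smooth1_cont F (n + 2) SF) as C2. pose proof (smooth1_cont F 0 SF) as Cf0.
  set (D := fun x => F (n + 2)%nat x ^ 2).
  assert (CD : cont D) by (unfold D; cts).
  assert (PD : forall x, D (x + INR N * h) = D x) by (intros; unfold D; now rewrite PF).
  replace (3 * C * h ^ (2 * n + 4) * RInt D x0 (x0 + INR N * h)) with
    (C * h ^ (2 * n + 4) * (RInt D x0 (x0 + INR N * h) + RInt D x0 (x0 + INR N * h) + RInt D x0 (x0 + INR N * h))) by ring.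
  rewrite <- (integral_cells_shift D x0 h N (- h) CD PD) at 1.
  rewrite <- (integral_cells_shift D x0 h N 0 CD PD) at 1.
  rewrite <- (integral_cells_shift D x0 h N h CD PD) at 1.
  rewrite <- !sumr_plus, <- sumr_scal. apply sumr_le. intros i Hi.
  set (a := node x0 h (i - 1)). replace (node x0 h i) with (a + h) by (symmetry; apply node_pred; lia).
  replace (a + h + - h) with a by ring. rewrite !Rplus_0_r.
  rewrite (integral_chasles D _ _ CD), (integral_chasles D _ _ CD).
  replace (a + - h) with (a - h) by ring. replace (a + h + h) with (a + 2 * h) by ring.
  replace (C * h ^ (2 * n + 4) * RInt D (a - h) (a + 2 * h))
    with ((a + h - a) * (C * (h ^ (2 * n + 3) * RInt D (a - h) (a + 2 * h)))).
  2:{ replace (2 * n + 4)%nat with (1 + (2 * n + 3))%nat by lia. rewrite (pow_add h 1). ring. }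
  rewrite <- integral_const.
  assert (CP : cont (Pi m p F a h)) by (apply (isP_cont (S m)), (isP_Pi m p Bp)).
  apply integral_le; [cts | cts | lra |]. intros x Hx.
  replace x with (a + h * ((x - a) / h)) by (field; lra).
  rewrite Pi_node by lra. apply H; [exact nm | exact SF | exact h0 |].
  split; [apply Rdiv_le_0_compat; lra|].
  apply Rmult_le_reg_r with h; [exact h0|]. unfold Rdiv. rewrite Rmult_assoc, Rinv_l; lra.
Qed.

End Error.

(** * The tensor-product projection *)

(* [W a b] is the derivative of [W 0 0] of order [a] in x and [b] in y. *)
Definition smooth2 (W : nat -> nat -> R -> R -> R) : Prop :=
  (forall a b, cont2 (W a b)) /\
  (forall a b x y, is_derive (fun s => W a b s y) x (W (S a) b x y)) /\
  (forall a b x y, is_derive (fun s => W a b x s) y (W a (S b) x y)).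

Definition transpose (W : nat -> nat -> R -> R -> R) : nat -> nat -> R -> R -> R :=
  fun a b x y => W b a y x.

Lemma smooth2_transpose W : smooth2 W -> smooth2 (transpose W).
Proof.
  intros (C & DX & DY). split; [|split]; intros; unfold transpose.
  - apply (cont2_swap (W b a)), C.
  - apply DY.
  - apply DX.
Qed.

Lemma smooth2_x W b y : smooth2 W -> smooth1 (fun a x => W a b x y).
Proof. intros (C & DX & DY) n x. apply DX. Qed.

Lemma smooth2_y W a x : smooth2 W -> smooth1 (fun b y => W a b x y).
Proof. intros (C & DX & DY) n y. apply DY. Qed.

Lemma quad_ge0_add P1 P2 X1 X2 V : quad_ge0 P1 X1 V -> quad_ge0 P2 X2 V -> quad_ge0 (2 * (P1 + P2)) (X1 + X2) V.
Proof. intros H1 H2 t. specialize (H1 (2 * t)). specialize (H2 (2 * t)). lra. Qed.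

Section Tensor.
Variables (m : nat) (p : nat -> R -> R).
Hypothesis Bp : onb m p.

Let Cp i : cont (p i) := onb_cont m p i Bp.

(* Syntax for the linear functionals of which [Pi] is made, so that the projections in
   x and y can be shown to commute by induction. *)
Inductive functional :=
  | LEv (n : nat) (a : R)
  | LMo (a h : R) (i : nat)
  | LAdd (l l' : functional)
  | LScal (c : R) (l : functional)
  | LSum (l : nat -> functional).

Fixpoint eval (l : functional) (F : nat -> R -> R) : R :=
  match l with
  | LEv n a => F n a
  | LMo a h i => dot (fun s => F 1%nat (a + h * s)) (p i)
  | LAdd l l' => eval l F + eval l' F
  | LScal c l => c * eval l F
  | LSum l => sum0 m (fun i => eval (l i) F)
  end.

Lemma eval_ext l F G : (forall n x, F n x = G n x) -> eval l F = eval l G.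
Proof.
  intros E. induction l as [n a|a h i|l1 IH1 l2 IH2|c l IH|l IH]; simpl.
  - apply E.
  - apply dot_ext. intros; apply E.
  - now rewrite IH1, IH2.
  - now rewrite IH.
  - apply sum0_ext. intros; apply IH.
Qed.

Lemma eval_plus l F G : smooth1 F -> smooth1 G ->
  eval l (fun n x => F n x + G n x) = eval l F + eval l G.
Proof.
  intros SF SG. pose proof (smooth1_cont F 1 SF). pose proof (smooth1_cont G 1 SG).
  induction l as [n a|a h i|l1 IH1 l2 IH2|c l IH|l IH]; simpl.
  - reflexivity.
  - apply (dot_plus (fun s => F 1%nat (a + h * s)) (fun s => G 1%nat (a + h * s))); [cts | cts | apply Cp].
  - rewrite IH1, IH2. ring.
  - rewrite IH. ring.
  - rewrite <- sum0_plus. apply sum0_ext. intros; apply IH.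
Qed.

Lemma eval_scal l c F : smooth1 F -> eval l (fun n x => c * F n x) = c * eval l F.
Proof.
  intros SF. pose proof (smooth1_cont F 1 SF).
  induction l as [n a|a h i|l1 IH1 l2 IH2|d l IH|l IH]; simpl.
  - reflexivity.
  - apply (dot_scal c (fun s => F 1%nat (a + h * s))); [cts | apply Cp].
  - rewrite IH1, IH2. ring.
  - rewrite IH. ring.
  - rewrite <- sum0_scal. apply sum0_ext. intros; apply IH.
Qed.

Lemma smooth1_scal c F : smooth1 F -> smooth1 (fun n x => c * F n x).
Proof. intros SF n x. apply deriv_scal, SF. Qed.

Lemma smooth1_minus F G : smooth1 F -> smooth1 G -> smooth1 (fun n x => F n x - G n x).
Proof. intros SF SG n x. apply deriv_minus; [apply SF | apply SG]. Qed.

Lemma smooth1_sum0 n (F : nat -> nat -> R -> R) : (forall i, smooth1 (F i)) ->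
  smooth1 (fun a x => sum0 n (fun i => F i a x)).
Proof. intros SF a x. apply (deriv_sum0 n (fun i => F i a)). intros; apply SF. Qed.

Lemma eval_sum0 l n (F : nat -> nat -> R -> R) : (forall i, smooth1 (F i)) ->
  eval l (fun a x => sum0 n (fun i => F i a x)) = sum0 n (fun i => eval l (F i)).
Proof.
  intros SF. induction n as [|n IH].
  - rewrite sum0_0. apply eval_ext. intros; now rewrite sum0_0.
  - rewrite sum0_S, <- IH, <- eval_plus.
    + apply eval_ext. intros; now rewrite sum0_S.
    + now apply smooth1_sum0.
    + apply SF.
Qed.

Lemma eval_minus l F G : smooth1 F -> smooth1 G ->
  eval l (fun n x => F n x - G n x) = eval l F - eval l G.
Proof.
  intros SF SG.
  rewrite (eval_ext l _ (fun n x => F n x + -1 * G n x)) by (intros; ring).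
  rewrite eval_plus, eval_scal by (assumption || now apply smooth1_scal). ring.
Qed.

(** Functionals in [y] commute with derivatives in [x]; for moments this is differentiation under
    the integral. *)
Lemma eval_smooth l W : smooth2 W -> smooth1 (fun a x => eval l (fun b y => W a b x y)).
Proof.
  intros SW. pose proof SW as (C & DX & DY).
  induction l as [n a|a h i|l1 IH1 l2 IH2|c l IH|l IH]; intros k x; simpl.
  - apply DX.
  - pose proof (Cp i) as Ci. unfold dot.
    apply (integral_derive_param (fun x s => W k 1%nat x (a + h * s) * p i s)
       (fun x s => W (S k) 1%nat x (a + h * s) * p i s)); [lra | | |].
    + apply filter_forall. intros z s.
      apply (deriv_val _ _ (W (S k) 1%nat z (a + h * s) * p i s + W k 1%nat z (a + h * s) * 0)); [|ring].
      apply (deriv_mult (fun z => W k 1%nat z (a + h * s)) (fun _ => p i s)); [apply DX | apply deriv_const].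
    + intros z. pose proof (cont2_r _ z (C k 1%nat)). cts.
    + pose proof (C (S k) 1%nat). cts.
  - apply deriv_plus; [apply IH1 | apply IH2].
  - apply deriv_scal, IH.
  - apply (deriv_sum0 m (fun i x => eval (l i) (fun b y => W k b x y))). intros i _; apply IH.
Qed.

Lemma eval_smooth' l W : smooth2 W -> smooth1 (fun b y => eval l (fun a x => W a b x y)).
Proof. intros SW. exact (eval_smooth l (transpose W) (smooth2_transpose W SW)). Qed.

Lemma eval_cont l W a : smooth2 W -> cont (fun x : R => eval l (fun b y => W a b x y)).
Proof. intros SW. apply (smooth1_cont (fun a x => eval l (fun b y => W a b x y))), eval_smooth, SW. Qed.

(** Point values commute with every functional by computation, and two moments by Fubini; all other
    cases are linearity. *)
Lemma eval_commute l l' W : smooth2 W ->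
  eval l (fun a x => eval l' (fun b y => W a b x y)) = eval l' (fun b y => eval l (fun a x => W a b x y)).
Proof.
  intros SW. pose proof SW as (C & _ & _).
  induction l as [n a|a h i|l1 IH1 l2 IH2|c l IH|l IH]; simpl.
  - reflexivity.
  - pose proof (Cp i) as Ci.
    assert (A : forall l, cont (fun s : R => eval l (fun b y => W 1%nat b (a + h * s) y))).
    { intros l. pose proof (eval_cont l W 1%nat SW) as Cl.
      apply (cont_comp1 (fun x => eval l (fun b y => W 1%nat b x y)) (fun s : R => a + h * s)); [exact Cl | cts]. }
    induction l' as [n0 a0|a0 h0 i0|l1 IH1 l2 IH2|c0 l IH|l IH]; simpl.
    + reflexivity.
    + pose proof (Cp i0) as Ci0. unfold dot. pose proof (C 1%nat 1%nat) as C11.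
      assert (CW : cont2 (fun s r => W 1%nat 1%nat (a + h * s) (a0 + h0 * r) * p i0 r * p i s)) by cts.
      transitivity (RInt (fun s => RInt (fun r => W 1%nat 1%nat (a + h * s) (a0 + h0 * r) * p i0 r * p i s) 0 1) 0 1).
      * apply integral_ext. intros s. rewrite Rmult_comm.
        pose proof (cont2_r _ (a + h * s) C11) as Cs.
        rewrite <- (integral_scal (fun r => W 1%nat 1%nat (a + h * s) (a0 + h0 * r) * p i0 r)) by cts.
        apply integral_ext; intros; ring.
      * rewrite (fubini (fun s r => W 1%nat 1%nat (a + h * s) (a0 + h0 * r) * p i0 r * p i s)) by (lra || exact CW).
        apply integral_ext. intros r. pose proof (cont2_l _ (a0 + h0 * r) C11) as Cs.
        transitivity (p i0 r * RInt (fun s => W 1%nat 1%nat (a + h * s) (a0 + h0 * r) * p i s) 0 1).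
        -- rewrite <- integral_scal by cts. apply integral_ext; intros; ring.
        -- apply Rmult_comm.
    + rewrite <- IH1, <- IH2. apply dot_plus; auto.
    + rewrite <- IH. apply dot_scal; auto.
    + rewrite (dot_sum0 m (fun i0 s => eval (l i0) (fun b y => W 1%nat b (a + h * s) y))); auto.
      apply sum0_ext. intros; apply IH.
  - rewrite IH1, IH2, eval_plus; auto using eval_smooth'.
  - rewrite IH, eval_scal; auto using eval_smooth'.
  - rewrite (eval_sum0 l' m (fun i b y => eval (l i) (fun a x => W a b x y))) by auto using eval_smooth'.
    apply sum0_ext. intros; apply IH.
Qed.

Definition LDef (h a : R) : functional :=
  LAdd (LEv 1 a) (LScal (-1/2)
    (LSum (fun i => LAdd (LScal (p i 1) (LMo (a - h) h i)) (LScal (p i 0) (LMo a h i))))).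

Lemma eval_LDef h a F : eval (LDef h a) F = defect m p F h a.
Proof.
  simpl. unfold defect, slope, proj. rewrite <- sum0_plus.
  rewrite (sum0_ext m _ (fun i => dot (fun s => F 1%nat (a - h + h * s)) (p i) * p i 1
     + dot (fun s => F 1%nat (a + h * s)) (p i) * p i 0)) by (intros; ring).
  lra.
Qed.

Definition PiL (a h x : R) : functional :=
  LAdd (LAdd (LEv 0 a) (LSum (fun i => LScal (h * RInt (p i) 0 ((x - a) / h)) (LMo a h i))))
   (LAdd (LScal (2 / kappa m p * h * RInt (ker1 m p) 0 ((x - a) / h)) (LDef h (a + h)))
         (LScal (2 / kappa m p * h * (RInt (ker0 m p) 0 ((x - a) / h) - 1)) (LDef h a))).

Lemma eval_PiL a h x F : eval (PiL a h x) F = Pi m p F a h x.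
Proof.
  unfold Pi, proj_ref, PiL. cbn [eval]. fold (eval (LDef h (a + h)) F). fold (eval (LDef h a) F).
  rewrite !eval_LDef. unfold slope, proj.
  rewrite (integral_sum0 (fun i s => dot (fun s => F 1%nat (a + h * s)) (p i) * p i s)).
  2:{ intros i _. pose proof (Cp i). cts. }
  rewrite <- sum0_scal.
  rewrite (sum0_ext m (fun i => h * RInt (fun s => dot (fun s => F 1%nat (a + h * s)) (p i) * p i s) 0 ((x - a) / h))
    (fun i => h * RInt (p i) 0 ((x - a) / h) * dot (fun s => F 1%nat (a + h * s)) (p i))).
  - rring.
  - intros i _. rewrite integral_scal by apply Cp. rring.
Qed.

Lemma Pi_minus F G a h x : smooth1 F -> smooth1 G ->
  Pi m p (fun n x => F n x - G n x) a h x = Pi m p F a h x - Pi m p G a h x.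
Proof. intros SF SG. rewrite <- !eval_PiL. now apply eval_minus. Qed.

Lemma Pi'_minus F G a h x : h <> 0 -> smooth1 F -> smooth1 G ->
  Pi' m p (fun n x => F n x - G n x) a h x = Pi' m p F a h x - Pi' m p G a h x.
Proof.
  intros h0 SF SG. rewrite <- (is_derive_unique _ _ _ (deriv_Pi m p Bp (fun n x => F n x - G n x) a h x h0)).
  apply is_derive_unique. apply is_derive_ext with (fun x => Pi m p F a h x - Pi m p G a h x).
  - intros t. symmetry. now apply Pi_minus.
  - apply deriv_minus; now apply deriv_Pi.
Qed.

(** Kept as a family indexed by the order [n] in [x], because the projection in [x] takes such a
    family as its argument. *)
Definition Piy (W : nat -> nat -> R -> R -> R) (a h y : R) : nat -> R -> R :=
  fun n x => Pi m p (fun b y => W n b x y) a h y.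

Definition Pi2 (W : nat -> nat -> R -> R -> R) (ax hx ay hy x y : R) : R :=
  Pi m p (Piy W ay hy y) ax hx x.

Lemma Piy_smooth W a h y : smooth2 W -> smooth1 (Piy W a h y).
Proof.
  intros SW n x. unfold Piy. apply is_derive_ext with (fun x => eval (PiL a h y) (fun b y => W n b x y)).
  - intros; apply eval_PiL.
  - rewrite <- eval_PiL. apply (eval_smooth (PiL a h y) W SW).
Qed.

(** Because the projections in the two variables commute, an estimate for the [x] part of the form,
    applied to the transposed function, is one for the [y] part with the same projection. *)
Lemma Pi2_transpose W ax hx ay hy x y : smooth2 W ->
  Pi2 (transpose W) ay hy ax hx y x = Pi2 W ax hx ay hy x y.
Proof.
  intros SW. unfold Pi2. rewrite <- !eval_PiL.
  rewrite (eval_ext _ (Piy (transpose W) ax hx x) (fun b y => eval (PiL ax hx x) (fun a x => W a b x y)))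
    by (intros; unfold Piy; now rewrite eval_PiL).
  rewrite (eval_ext _ (Piy W ay hy y) (fun a x => eval (PiL ay hy y) (fun b y => W a b x y)))
    by (intros; unfold Piy; now rewrite eval_PiL).
  symmetry. now apply eval_commute.
Qed.

Lemma isP_ref k q a h : isP k q -> isP k (fun x => q ((x - a) / h)).
Proof.
  intros Q. apply isP_ext with (fun x => q (- a / h + / h * x)).
  - intros x. f_equal. unfold Rdiv. ring.
  - now apply isP_affine.
Qed.

Lemma isP_PiL_coef :
  (forall a h i, isP (S m) (fun x => h * RInt (p i) 0 ((x - a) / h))) /\
  (forall a h c, isP (S m) (fun x => c * RInt (ker1 m p) 0 ((x - a) / h))) /\
  (forall a h c, isP (S m) (fun x => c * (RInt (ker0 m p) 0 ((x - a) / h) - 1))).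
Proof.
  split; [|split]; intros; apply isP_scal.
  - apply (isP_ref _ (fun x => RInt (p i) 0 x)), isP_RInt, (proj1 Bp).
  - apply (isP_ref _ (fun x => RInt (ker1 m p) 0 x)), isP_RInt, isP_ker1, Bp.
  - apply isP_minus; [|apply isP_const].
    apply (isP_ref _ (fun x => RInt (ker0 m p) 0 x)), isP_RInt, isP_ker0, Bp.
Qed.

(** In [x] the projection is a combination of fixed polynomials, with functionals of the [y]
    projection as coefficients. After commuting, each coefficient is itself a projection in [y],
    hence a polynomial. *)
Lemma Pi2_Qk W ax hx ay hy : smooth2 W -> is_Qk (S m) (Pi2 W ax hx ay hy).
Proof.
  intros SW.
  assert (T : forall l, isP (S m) (fun y => eval l (Piy W ay hy y))).
  { intros l. apply isP_ext with (Pi m p (fun b y => eval l (fun a x => W a b x y)) ay hy).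
    - intros y. rewrite <- eval_PiL, <- eval_commute by exact SW.
      apply eval_ext. intros; apply eval_PiL.
    - apply isP_Pi, Bp. }
  destruct isP_PiL_coef as (H1 & H2 & H3).
  apply is_Qk_ext with (fun x y => eval (PiL ax hx x) (Piy W ay hy y)).
  { intros; apply eval_PiL. }
  unfold PiL. cbn [eval]. apply is_Qk_plus; apply is_Qk_plus.
  - apply is_Qk_ext with (fun x y => 1 * eval (LEv 0 ax) (Piy W ay hy y)); [intros; simpl; ring|].
    apply (is_Qk_prod (S m) (fun _ => 1)); [apply isP_const | apply (T (LEv 0 ax))].
  - apply is_Qk_sum0. intros i _.
    apply (is_Qk_prod (S m) (fun x => hx * RInt (p i) 0 ((x - ax) / hx)) (fun y => eval (LMo ax hx i) (Piy W ay hy y)));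
      [apply H1 | apply T].
  - apply (is_Qk_prod (S m) (fun x => _) (fun y => eval (LDef hx (ax + hx)) (Piy W ay hy y)));
      [apply H2 | apply T].
  - apply (is_Qk_prod (S m) (fun x => _) (fun y => eval (LDef hx ax) (Piy W ay hy y))); [apply H3 | apply T].
Qed.

Lemma Piy_cont2 W a h n : smooth2 W -> cont2 (fun x y => Piy W a h y n x).
Proof.
  intros SW. destruct isP_PiL_coef as (H1 & H2 & H3).
  assert (T : forall l, cont (fun q : R * R => eval l (fun b y => W n b (fst q) y))).
  { intros l. apply (cont_comp1 (fun x => eval l (fun b y => W n b x y)) (fun q : R * R => fst q)).
    - now apply eval_cont.
    - cts. }
  assert (Q : forall q : R -> R, isP (S m) q -> cont (fun z : R * R => q (snd z))).
  { intros q P. apply (cont_comp1 q (fun q : R * R => snd q)); [now apply (isP_cont (S m)) | cts]. }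
  apply cont_ext with (fun z : R * R => eval (PiL a h (snd z)) (fun b y => W n b (fst z) y)).
  { intros; apply eval_PiL. }
  unfold PiL. cbn [eval]. apply cont_plus; apply cont_plus.
  - apply (T (LEv 0 a)).
  - apply (cont_sum0 m (fun i z => _ * _)). intros i _. apply cont_mult.
    + exact (Q _ (H1 a h i)).
    + apply (T (LMo a h i)).
  - apply cont_mult; [exact (Q _ (H2 a h (2 / kappa m p * h))) | apply (T (LDef h (a + h)))].
  - apply cont_mult; [exact (Q _ (H3 a h (2 / kappa m p * h))) | apply (T (LDef h a))].
Qed.

End Tensor.

(** * The two-dimensional form, one direction at a time *)

Definition row (v : broken) (j : nat) (y : R) : nat -> R -> R := fun i x => v i j x y.

(** The terms with derivatives in [x] and jumps across vertical edges. The remaining terms are the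
    same expression for flipped arguments, so only one direction has to be analysed. *)
Definition form_x (x0 hx : R) (N : nat) (y0 hy : R) (M : nat) (w dw v dv : broken) : R :=
  sumr M (fun j => RInt (fun y => form1 x0 hx N (row w j y) (row dw j y) (row v j y) (row dv j y))
                        (node y0 hy (j - 1)) (node y0 hy j)).

Definition sqnorm2 (x0 hx : R) (N : nat) (y0 hy : R) (M : nat) (v : broken) : R :=
  sumr M (fun j => RInt (fun y => sqnorm1 x0 hx N (row v j y)) (node y0 hy (j - 1)) (node y0 hy j)).

Definition flip_broken (v : broken) : broken := fun j i y x => v i j x y.

Definition broken_cont (N M : nat) (v : broken) : Prop :=
  forall i j, (1 <= i <= N)%nat -> (1 <= j <= M)%nat -> cont2 (v i j).

Lemma broken_cont_tr N M v : broken_cont N M v -> broken_cont M N (flip_broken v).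
Proof. intros C i j Hi Hj. apply (cont2_swap (v j i)). now apply C. Qed.

Section Continuity.
Variables (x0 hx : R) (N M : nat).
Hypotheses (N1 : (1 <= N)%nat) (hx0 : 0 < hx).

Lemma node_le i : (1 <= i)%nat -> node x0 hx (i - 1) <= node x0 hx i.
Proof. intros Hi. rewrite (node_pred x0 hx i Hi). lra. Qed.

Lemma cont_nrm1 v j : broken_cont N M v -> (1 <= j <= M)%nat -> cont (fun y : R => sqnorm1 x0 hx N (row v j y)).
Proof.
  intros C Hj. unfold sqnorm1, row. apply cont_sum_n_m. intros i Hi.
  apply (cont_RInt (fun y x => v i j x y ^ 2)); [apply node_le; lia|].
  apply (cont_pow (fun q : R * R => v i j (snd q) (fst q))). apply (cont2_swap (v i j)). now apply C.
Qed.

Lemma cont_mi v j i : broken_cont N M v -> (1 <= j <= M)%nat -> (1 <= i <= N)%nat ->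
  cont (fun y : R => trace_minus x0 hx (row v j y) i).
Proof. intros C Hj Hi. apply (cont2_r (v i j)). now apply C. Qed.

Lemma cont_pl v j i : broken_cont N M v -> (1 <= j <= M)%nat -> (1 <= i <= N)%nat ->
  cont (fun y : R => trace_plus x0 hx N (row v j y) i).
Proof.
  intros C Hj Hi. unfold trace_plus, row. destruct (Nat.eqb_spec i N).
  - apply (cont2_r (v 1%nat j)). apply C; lia.
  - apply (cont2_r (v (S i) j)). apply C; lia.
Qed.

Lemma cont_a1 w dw v dv j : broken_cont N M w -> broken_cont N M dw -> broken_cont N M v -> broken_cont N M dv ->
  (1 <= j <= M)%nat ->
  cont (fun y : R => form1 x0 hx N (row w j y) (row dw j y) (row v j y) (row dv j y)).
Proof.
  intros Cw Cdw Cv Cdv Hj. unfold form1. apply cont_plus.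
  - apply cont_sum_n_m. intros i Hi. unfold row.
    apply (cont_RInt (fun y x => dw i j x y * dv i j x y)); [apply node_le; lia|].
    apply (cont_mult (fun q : R * R => dw i j (snd q) (fst q)) (fun q => dv i j (snd q) (fst q))).
    + apply (cont2_swap (dw i j)). now apply Cdw.
    + apply (cont2_swap (dv i j)). now apply Cdv.
  - apply (cont_sum_n_m (fun i y => _ * _ + _ * _)). intros i Hi.
    pose proof (cont_mi w j i Cw Hj Hi). pose proof (cont_mi dw j i Cdw Hj Hi).
    pose proof (cont_mi v j i Cv Hj Hi). pose proof (cont_mi dv j i Cdv Hj Hi).
    pose proof (cont_pl w j i Cw Hj Hi). pose proof (cont_pl dw j i Cdw Hj Hi).
    pose proof (cont_pl v j i Cv Hj Hi). pose proof (cont_pl dv j i Cdv Hj Hi).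
    cts.
Qed.
End Continuity.

Lemma sqnorm2_cells x0 hx N y0 hy M v : 0 < hx -> 0 < hy -> broken_cont N M v ->
  sqnorm2 x0 hx N y0 hy M v = sumr N (fun i => sumr M (fun j =>
    RInt (fun x => RInt (fun y => v i j x y ^ 2) (node y0 hy (j - 1)) (node y0 hy j)) (node x0 hx (i - 1)) (node x0 hx i))).
Proof.
  intros hx0 hy0 C. rewrite sumr_swap. apply sumr_ext. intros j Hj. unfold sqnorm1.
  rewrite (integral_sum (fun i y => RInt (fun x => row v j y i x ^ 2) (node x0 hx (i - 1)) (node x0 hx i))).
  - apply sumr_ext. intros i Hi. symmetry.
    apply (fubini (fun x y => v i j x y ^ 2)); [apply node_le; (lra || lia) | apply node_le; (lra || lia) |].
    apply (cont_pow (fun q : R * R => v i j (fst q) (snd q))). now apply C.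
  - intros i Hi. apply (cont_RInt (fun y x => v i j x y ^ 2)); [apply node_le; (lra || lia)|].
    apply (cont_pow (fun q : R * R => v i j (snd q) (fst q))). apply (cont2_swap (v i j)). now apply C.
Qed.

Lemma sqnorm2_tr x0 hx N y0 hy M v : 0 < hx -> 0 < hy -> broken_cont N M v ->
  sqnorm2 y0 hy M x0 hx N (flip_broken v) = sqnorm2 x0 hx N y0 hy M v.
Proof.
  intros hx0 hy0 C. rewrite (sqnorm2_cells x0 hx N y0 hy M v hx0 hy0 C).
  unfold sqnorm2. apply sumr_ext. intros i Hi. unfold sqnorm1.
  rewrite <- (integral_sum (fun j x => RInt (fun y => v i j x y ^ 2) (node y0 hy (j - 1)) (node y0 hy j))).
  - reflexivity.
  - intros j Hj. apply (cont_RInt (fun x y => v i j x y ^ 2)); [apply node_le; (lra || lia)|].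
    apply (cont_pow (fun q : R * R => v i j (fst q) (snd q))). now apply C.
Qed.

Lemma sqnorm2_ext x0 hx N y0 hy M v w :
  (forall i j x y, (1 <= i <= N)%nat -> (1 <= j <= M)%nat -> v i j x y = w i j x y) ->
  sqnorm2 x0 hx N y0 hy M v = sqnorm2 x0 hx N y0 hy M w.
Proof.
  intros E. apply sumr_ext. intros j Hj. apply integral_ext. intros y. apply sumr_ext. intros i Hi.
  apply integral_ext. intros x. unfold row. now rewrite E.
Qed.

Definition sobolev_sq (x0 Lx y0 Ly : R) (W : nat -> nat -> R -> R -> R) (a b : nat) : R :=
  RInt (fun x => RInt (fun y => W a b x y ^ 2) y0 (y0 + Ly)) x0 (x0 + Lx).

Definition periodic2 (Lx Ly : R) (W : nat -> nat -> R -> R -> R) : Prop :=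
  forall a b x y, W a b (x + Lx) y = W a b x y /\ W a b x (y + Ly) = W a b x y.

Lemma periodic2_tr Lx Ly W : periodic2 Lx Ly W -> periodic2 Ly Lx (transpose W).
Proof. intros P a b x y. unfold transpose. destruct (P b a y x). now split. Qed.

Lemma sobolev_sq_ge0 x0 Lx y0 Ly W a b : 0 <= Lx -> 0 <= Ly -> smooth2 W -> 0 <= sobolev_sq x0 Lx y0 Ly W a b.
Proof.
  intros HL HM (C & _). pose proof (C a b) as Cab.
  assert (CC : cont2 (fun x y => W a b x y ^ 2)) by cts.
  apply integral_ge0; [|lra|].
  - apply (cont_RInt (fun x y => W a b x y ^ 2)); [lra | exact CC].
  - intros x _. apply integral_ge0; [apply (cont2_r (fun x y => W a b x y ^ 2)), CC | lra | intros; apply pow2_ge_0].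
Qed.

Lemma sobolev_sq_tr x0 Lx y0 Ly W a b : 0 <= Lx -> 0 <= Ly -> smooth2 W ->
  sobolev_sq y0 Ly x0 Lx (transpose W) b a = sobolev_sq x0 Lx y0 Ly W a b.
Proof.
  intros HL HM (C & _). pose proof (C a b) as Cab. unfold sobolev_sq, transpose. symmetry.
  apply (fubini (fun x y => W a b x y ^ 2)); [lra | lra | cts].
Qed.

(** * Error estimates in two variables *)

Section Estimates.
Variables (m : nat) (p : nat -> R -> R).
Hypothesis Bp : onb m p.

Section Mesh.
Variables (x0 hx : R) (N : nat) (y0 hy : R) (M : nat) (W : nat -> nat -> R -> R -> R).
Hypotheses (hx0 : 0 < hx) (hy0 : 0 < hy) (N1 : (1 <= N)%nat) (M1 : (1 <= M)%nat)
  (SW : smooth2 W) (PW : periodic2 (INR N * hx) (INR M * hy) W).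

Let Lx0 : 0 < INR N * hx.
Proof. apply Rmult_lt_0_compat; [apply lt_0_INR; lia | exact hx0]. Qed.
Let Ly0 : 0 < INR M * hy.
Proof. apply Rmult_lt_0_compat; [apply lt_0_INR; lia | exact hy0]. Qed.

Notation X := (node x0 hx).
Notation Y := (node y0 hy).
Notation Sn := (sobolev_sq x0 (INR N * hx) y0 (INR M * hy) W).

Definition proj_cell2 : broken := fun i j => Pi2 m p W (X (i - 1)) hx (Y (j - 1)) hy.

Definition dx_proj_cell2 : broken := fun i j x y =>
  Pi' m p (Piy m p W (Y (j - 1)) hy y) (X (i - 1)) hx x.

Lemma deriv_proj_cell2 i j x y : is_derive (fun s => proj_cell2 i j s y) x (dx_proj_cell2 i j x y).
Proof. apply deriv_Pi; [exact Bp | lra]. Qed.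

Lemma proj_cell2_Qk i j : is_Qk (S m) (proj_cell2 i j).
Proof. apply Pi2_Qk; [exact Bp | exact SW]. Qed.

Lemma dx_proj_cell2_cont2 i j : cont2 (dx_proj_cell2 i j).
Proof.
  apply cont_ext with (fun q : R * R => Derive (fun s => proj_cell2 i j s (snd q)) (fst q)).
  - intros q. apply is_derive_unique, deriv_proj_cell2.
  - apply (is_Qk_Derive_cont2 (S m)), proj_cell2_Qk.
Qed.

Definition err_y (j n : nat) (x y : R) : R := W n 0%nat x y - Piy m p W (Y (j - 1)) hy y n x.

Lemma err_y_cont2 j n : cont2 (err_y j n).
Proof.
  unfold err_y. apply (cont_minus (fun q : R * R => W n 0%nat (fst q) (snd q))).
  - apply SW.
  - apply (Piy_cont2 m p Bp W (Y (j - 1)) hy n SW).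
Qed.

Lemma Piy_periodic j y : periodic1 (INR N * hx) (Piy m p W (Y (j - 1)) hy y).
Proof.
  intros n x. unfold Piy. rewrite <- !(eval_PiL m p Bp). apply eval_ext. intros b y'. apply PW.
Qed.

Lemma sum_slabs (f : R -> R -> R) : cont2 f ->
  sumr M (fun j => RInt (fun y => RInt (fun x => f x y) x0 (x0 + INR N * hx)) (Y (j - 1)) (Y j))
  = RInt (fun x => RInt (fun y => f x y) y0 (y0 + INR M * hy)) x0 (x0 + INR N * hx).
Proof.
  intros C. rewrite (fubini f) by (lra || exact C).
  apply (sqnorm1_cells (fun y => RInt (fun x => f x y) x0 (x0 + INR N * hx))).
  apply (cont_RInt (fun y x => f x y)); [lra | now apply (cont2_swap f)].
Qed.

(** The one-dimensional estimate enters as a hypothesis, so that its constant is fixed before the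
    mesh. It is integrated over [x], and Fubini rearranges the slabs. *)
Lemma err_y_norm C : (forall n x0 h N F, (n <= m)%nat -> 0 < h -> (1 <= N)%nat ->
    smooth1 F -> periodic1 (INR N * h) F ->
    sqnorm1 x0 h N (fun i x => F 0%nat x - Pi m p F (node x0 h (i - 1)) h x)
    <= C * h ^ (2 * n + 4) * RInt (fun x => F (n + 2)%nat x ^ 2) x0 (x0 + INR N * h)) ->
  forall a n, (n <= m)%nat ->
  sumr M (fun j => RInt (fun y => RInt (fun x => err_y j a x y ^ 2) x0 (x0 + INR N * hx)) (Y (j - 1)) (Y j))
  <= C * hy ^ (2 * n + 4) * Sn a (n + 2)%nat.
Proof.
  intros H a n nm.
  assert (CE : forall j, cont2 (fun x y => err_y j a x y ^ 2)).
  { intros j. apply (cont_pow (fun q : R * R => err_y j a (fst q) (snd q))), err_y_cont2. }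
  pose proof (proj1 SW a (n + 2)%nat) as CW.
  assert (CW2 : cont2 (fun x y => W a (n + 2)%nat x y ^ 2)) by cts.
  rewrite (sumr_ext M _ (fun j => RInt (fun x => RInt (fun y => err_y j a x y ^ 2) (Y (j - 1)) (Y j)) x0 (x0 + INR N * hx))).
  - rewrite <- (integral_sum (fun j x => RInt (fun y => err_y j a x y ^ 2) (Y (j - 1)) (Y j))).
    + unfold sobolev_sq. rewrite <- integral_scal by (apply (cont_RInt (fun x y => W a (n + 2)%nat x y ^ 2)); [lra | exact CW2]).
      apply integral_le; [| | lra |].
      * apply cont_sum_n_m. intros j Hj. apply (cont_RInt (fun x y => err_y j a x y ^ 2)); [apply node_le; (lra || lia) | apply CE].
      * apply cont_mult; [cts|]. apply (cont_RInt (fun x y => W a (n + 2)%nat x y ^ 2)); [lra | exact CW2].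
      * intros x _. apply (H n y0 hy M (fun b y => W a b x y) nm hy0 M1).
        -- apply (smooth2_y W a x SW).
        -- intros b y. apply PW.
    + intros j Hj. apply (cont_RInt (fun x y => err_y j a x y ^ 2)); [apply node_le; (lra || lia) | apply CE].
  - intros j Hj. symmetry. apply (fubini (fun x y => err_y j a x y ^ 2)); [lra | apply node_le; (lra || lia) | apply CE].
Qed.
End Mesh.

(** The first part of the error has full order in [hx] by the nodal identity. For the second,
    [form1_Pi_bound] involves only the second x derivative of the error in [y], which has full order
    in [hy]; this is the origin of the mixed norm. *)
Lemma form_x_consistency : exists C, 0 < C /\ forall x0 hx N y0 hy M W v dv,
  0 < hx -> 0 < hy -> (1 <= N)%nat -> (1 <= M)%nat ->
  smooth2 W -> periodic2 (INR N * hx) (INR M * hy) W ->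
  (forall i j, (1 <= i <= N)%nat -> (1 <= j <= M)%nat -> is_Qk (S m) (v i j)) ->
  (forall i j x y, (1 <= i <= N)%nat -> (1 <= j <= M)%nat ->
     is_derive (fun s => v i j s y) x (dv i j x y)) ->
  quad_ge0 (C * (hx ^ (2 * m + 4) * sobolev_sq x0 (INR N * hx) y0 (INR M * hy) W (m + 4) 0
            + hy ^ (2 * m + 4) * sobolev_sq x0 (INR N * hx) y0 (INR M * hy) W 2 (m + 2)))
    (form_x x0 hx N y0 hy M (fun i j x y => W 0%nat 0%nat x y - proj_cell2 x0 hx y0 hy W i j x y)
                        (fun i j x y => W 1%nat 0%nat x y - dx_proj_cell2 x0 hx y0 hy W i j x y) v dv)
    (sqnorm2 x0 hx N y0 hy M v).
Proof.
  destruct (form1_error_bounds m p Bp) as (Ca & Ca0 & Ha).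
  destruct (form1_Pi_bound m p Bp) as (Cb & Cb0 & Hb).
  destruct (Pi_L2_error m p Bp) as (Cc & Cc0 & Hc).
  exists (2 * (Ca + Cb * Cc)). split; [assert (0 < Cb * Cc) by (now apply Rmult_lt_0_compat); lra|].
  intros x0 hx N y0 hy M W v dv hx0 hy0 N1 M1 SW PW Qv Dv.
  assert (Lx0 : 0 < INR N * hx) by (apply Rmult_lt_0_compat; [apply lt_0_INR; lia | exact hx0]).
  assert (Ly0 : 0 < INR M * hy) by (apply Rmult_lt_0_compat; [apply lt_0_INR; lia | exact hy0]).
  pose proof (proj1 SW) as CW.
  set (e := fun i j x y => W 0%nat 0%nat x y - proj_cell2 x0 hx y0 hy W i j x y).
  set (de := fun i j x y => W 1%nat 0%nat x y - dx_proj_cell2 x0 hx y0 hy W i j x y).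
  assert (Ce : broken_cont N M e).
  { intros i j _ _. apply (cont_minus (fun q : R * R => W 0%nat 0%nat (fst q) (snd q))); [apply CW|].
    apply (is_Qk_cont2 (S m)), proj_cell2_Qk, SW. }
  assert (Cde : broken_cont N M de).
  { intros i j _ _. apply (cont_minus (fun q : R * R => W 1%nat 0%nat (fst q) (snd q))); [apply CW|].
    now apply dx_proj_cell2_cont2. }
  assert (Cv : broken_cont N M v) by (intros i j Hi Hj; apply (is_Qk_cont2 (S m)); auto).
  assert (Cdv : broken_cont N M dv).
  { intros i j Hi Hj. apply cont_ext with (fun q : R * R => Derive (fun s => v i j s (snd q)) (fst q)).
    - intros q. now apply is_derive_unique, Dv.
    - apply (is_Qk_Derive_cont2 (S m)); auto. }
  set (PA := fun y => RInt (fun x => W (m + 4)%nat 0%nat x y ^ 2) x0 (x0 + INR N * hx)).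
  set (PB := fun j y => RInt (fun x => err_y y0 hy W j 2 x y ^ 2) x0 (x0 + INR N * hx)).
  set (cA := Ca * hx ^ (2 * m + 4)).
  assert (CPA : cont PA).
  { apply (cont_RInt (fun y x => W (m + 4)%nat 0%nat x y ^ 2)); [lra|].
    apply (cont_pow (fun q : R * R => W (m + 4)%nat 0%nat (snd q) (fst q))), (cont2_swap (W (m + 4)%nat 0%nat)), CW. }
  assert (CPB : forall j, cont (PB j)).
  { intros j. apply (cont_RInt (fun y x => err_y y0 hy W j 2 x y ^ 2)); [lra|].
    apply (cont_pow (fun q : R * R => err_y y0 hy W j 2 (snd q) (fst q))), (cont2_swap (err_y y0 hy W j 2)).
    now apply err_y_cont2. }
  apply quad_ge0_mono with (sumr M (fun j => RInt (fun y => 2 * (cA * PA y + Cb * PB j y))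
     (node y0 hy (j - 1)) (node y0 hy j))) (sqnorm2 x0 hx N y0 hy M v).
  - unfold form_x, sqnorm2. apply sumr_quad_ge0. intros j Hj.
    apply quad_ge0_int; [apply node_le; (lra || lia) | | | |].
    + pose proof (CPB j). cts.
    + apply (cont_a1 x0 hx N M); assumption.
    + apply (cont_nrm1 x0 hx N M); assumption.
    + intros y _.
      set (F := fun a x => W a 0%nat x y).
      set (G := Piy m p W (node y0 hy (j - 1)) hy y).
      assert (SF : smooth1 F) by apply (smooth2_x W 0 y SW).
      assert (SG : smooth1 G) by (apply Piy_smooth; assumption).
      assert (PF : periodic1 (INR N * hx) F) by (intros n x; apply PW).
      assert (PG : periodic1 (INR N * hx) G) by exact (Piy_periodic hx N y0 hy M W PW j y).
      assert (SE : smooth1 (fun n x => F n x - G n x)) by now apply smooth1_minus.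
      assert (PE : periodic1 (INR N * hx) (fun n x => F n x - G n x)) by (intros n x; now rewrite PF, PG).
      assert (proj_ref : forall i, (1 <= i <= N)%nat -> isP (S m) (row v j y i))
        by (intros i Hi; apply (is_Qk_slice (S m) (v i j)); auto).
      assert (DV : forall i x, (1 <= i <= N)%nat -> is_derive (row v j y i) x (row dv j y i x))
        by (intros i x Hi; now apply Dv).
      assert (Pdv : forall i, (1 <= i <= N)%nat -> isP m (row dv j y i)).
      { intros i Hi. apply isP_ext with (Derive (row v j y i)).
        - intros x. now apply is_derive_unique, DV.
        - now apply isP_Derive, proj_ref. }
      assert (Cd : forall H, smooth1 H -> forall i, cont (fun x : R => H 1%nat x - Pi' m p H (node x0 hx (i - 1)) hx x)).
      { intros H SH i. apply cont_minus; [now apply smooth1_cont|].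
        apply cont_ext with (Derive (Pi m p H (node x0 hx (i - 1)) hx)).
        - intros x. apply is_derive_unique, deriv_Pi; [exact Bp | lra].
        - apply (isP_cont m), isP_Derive, isP_Pi, Bp. }
      destruct (Ha x0 hx N F (row v j y) (row dv j y) hx0 N1 SF PF proj_ref Pdv) as [H1 _].
      pose proof (Hb x0 hx N _ (row v j y) (row dv j y) hx0 N1 SE PE proj_ref Pdv DV) as H2.
      cbv zeta in H1. cbv beta in H2.
      pose proof (quad_ge0_add _ _ _ _ _ H1 H2) as H3.
      replace (form1 x0 hx N (row e j y) (row de j y) (row v j y) (row dv j y)) with
        (form1 x0 hx N (fun i x => F 0%nat x - Pi m p F (node x0 hx (i - 1)) hx x)
          (fun i x => F 1%nat x - Pi' m p F (node x0 hx (i - 1)) hx x) (row v j y) (row dv j y)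
         + form1 x0 hx N (fun i x => Pi m p (fun n x => F n x - G n x) (node x0 hx (i - 1)) hx x)
          (fun i x => Pi' m p (fun n x => F n x - G n x) (node x0 hx (i - 1)) hx x) (row v j y) (row dv j y)).
      * exact H3.
      * assert (E : form1 x0 hx N (fun i x => row e j y i x - (F 0%nat x - Pi m p F (node x0 hx (i - 1)) hx x))
          (fun i x => row de j y i x - (F 1%nat x - Pi' m p F (node x0 hx (i - 1)) hx x)) (row v j y) (row dv j y)
          = form1 x0 hx N (row e j y) (row de j y) (row v j y) (row dv j y) -
          form1 x0 hx N (fun i x => F 0%nat x - Pi m p F (node x0 hx (i - 1)) hx x)
          (fun i x => F 1%nat x - Pi' m p F (node x0 hx (i - 1)) hx x) (row v j y) (row dv j y)).
        { apply form1_minus.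
          - intros i Hi. apply (cont2_l (de i j)). now apply Cde.
          - intros i Hi. now apply Cd.
          - intros i Hi. apply (cont2_l (dv i j)). now apply Cdv. }
        apply Rplus_eq_reg_r with (- form1 x0 hx N (fun i x => F 0%nat x - Pi m p F (node x0 hx (i - 1)) hx x)
          (fun i x => F 1%nat x - Pi' m p F (node x0 hx (i - 1)) hx x) (row v j y) (row dv j y)).
        etransitivity; [|exact E].
        rewrite (Rplus_comm (form1 _ _ _ _ _ _ _)), Rplus_assoc, Rplus_opp_r, Rplus_0_r.
        assert (X1 : forall (f g f' g' : nat -> R -> R), (forall i x, f i x = f' i x) -> (forall i x, g i x = g' i x) ->
           form1 x0 hx N f g (row v j y) (row dv j y) = form1 x0 hx N f' g' (row v j y) (row dv j y)).
        { intros f g f' g' E1 E2. unfold form1, trace_plus, trace_minus. f_equal.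
          - apply sumr_ext. intros i _. apply integral_ext. intros x. now rewrite E2.
          - apply sumr_ext. intros i _. now rewrite !E1, !E2. }
        apply X1.
        -- intros i x. rewrite (Pi_minus m p Bp) by assumption. unfold row, e, proj_cell2, Pi2. fold G. unfold F. ring.
        -- intros i x. rewrite (Pi'_minus m p Bp) by (assumption || lra). unfold row, de, dx_proj_cell2. fold G. unfold F. ring.
  - rewrite (sumr_ext M _ (fun j => 2 * cA * RInt PA (node y0 hy (j - 1)) (node y0 hy j)
       + 2 * Cb * RInt (PB j) (node y0 hy (j - 1)) (node y0 hy j))).
    2:{ intros j Hj. pose proof (CPB j). rewrite integral_scal, integral_plus, !integral_scal by cts. rring. }
    rewrite sumr_plus, !sumr_scal.
    pose proof (err_y_norm x0 hx N y0 hy M W hx0 hy0 N1 M1 SW PW Cc Hc 2 m (le_n m)) as H1.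
    change (sumr M (fun j => RInt (PB j) (node y0 hy (j - 1)) (node y0 hy j))
      <= Cc * hy ^ (2 * m + 4) * sobolev_sq x0 (INR N * hx) y0 (INR M * hy) W 2 (m + 2)) in H1.
    assert (H2 : sumr M (fun j => RInt PA (node y0 hy (j - 1)) (node y0 hy j))
       = sobolev_sq x0 (INR N * hx) y0 (INR M * hy) W (m + 4) 0).
    { apply (sum_slabs x0 hx N y0 hy M hx0 hy0 N1 M1 (fun x y => W (m + 4)%nat 0%nat x y ^ 2)).
      apply (cont_pow (fun q : R * R => W (m + 4)%nat 0%nat (fst q) (snd q))), CW. }
    rewrite H2. unfold cA.
    set (s := sumr M _) in *. set (A := sobolev_sq _ _ _ _ W (m + 4) 0) in *.
    set (B := sobolev_sq _ _ _ _ W 2 (m + 2)) in *.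
    assert (0 <= A) by (apply sobolev_sq_ge0; lra || assumption).
    assert (0 <= B) by (apply sobolev_sq_ge0; lra || assumption).
    assert (0 <= hx ^ (2 * m + 4) * A) by (apply Rmult_le_pos; [left; now apply pow_lt | assumption]).
    assert (0 <= hy ^ (2 * m + 4) * B) by (apply Rmult_le_pos; [left; now apply pow_lt | assumption]).
    assert (Cb * s <= Cb * (Cc * (hy ^ (2 * m + 4) * B))) by (apply Rmult_le_compat_l; lra).
    assert (0 <= Cb * Cc * (hx ^ (2 * m + 4) * A)) by (apply Rmult_le_pos; [left; now apply Rmult_lt_0_compat | assumption]).
    assert (0 <= Ca * (hy ^ (2 * m + 4) * B)) by (apply Rmult_le_pos; [lra | assumption]).
    lra.
  - apply Rle_refl.
Qed.

(** With [E] the error in [y], the whole error is that of [F] in [x], plus [E], minus the error of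
    [E] in [x]. The last takes order 2 in [x] and order [m] in [y], so that [m + 2] derivatives
    suffice. For [m < 2] the truncated [m - 2] yields order 2 in [y] as well: more than required, at
    the price of four derivatives. *)
Lemma proj_cell2_L2_error : exists C, 0 < C /\ forall x0 hx N y0 hy M W,
  0 < hx -> 0 < hy -> (1 <= N)%nat -> (1 <= M)%nat ->
  smooth2 W -> periodic2 (INR N * hx) (INR M * hy) W ->
  let Sn := sobolev_sq x0 (INR N * hx) y0 (INR M * hy) W in
  sqnorm2 x0 hx N y0 hy M (fun i j x y => W 0%nat 0%nat x y - proj_cell2 x0 hx y0 hy W i j x y)
  <= C * (hx ^ (2 * m + 4) * Sn (m + 2)%nat 0%nat + hy ^ (2 * m + 4) * Sn 0%nat (m + 2)%nat
          + hx ^ 4 * (hy ^ (2 * (m - 2) + 4) * Sn 2%nat (m - 2 + 2)%nat)).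
Proof.
  destruct (Pi_L2_error m p Bp) as (C & C0 & H).
  exists (3 * (C + C * C)). split; [assert (0 < C * C) by (now apply Rmult_lt_0_compat); lra|].
  intros x0 hx N y0 hy M W hx0 hy0 N1 M1 SW PW Sn.
  assert (Lx0 : 0 < INR N * hx) by (apply Rmult_lt_0_compat; [apply lt_0_INR; lia | exact hx0]).
  assert (Ly0 : 0 < INR M * hy) by (apply Rmult_lt_0_compat; [apply lt_0_INR; lia | exact hy0]).
  pose proof (proj1 SW) as CW.
  set (e := fun i j x y => W 0%nat 0%nat x y - proj_cell2 x0 hx y0 hy W i j x y).
  assert (Ce : broken_cont N M e).
  { intros i j _ _. apply (cont_minus (fun q : R * R => W 0%nat 0%nat (fst q) (snd q))); [apply CW|].
    apply (is_Qk_cont2 (S m)), proj_cell2_Qk, SW. }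
  set (PA := fun y => RInt (fun x => W (m + 2)%nat 0%nat x y ^ 2) x0 (x0 + INR N * hx)).
  set (PB := fun a j y => RInt (fun x => err_y y0 hy W j a x y ^ 2) x0 (x0 + INR N * hx)).
  assert (CPA : cont PA).
  { apply (cont_RInt (fun y x => W (m + 2)%nat 0%nat x y ^ 2)); [lra|].
    apply (cont_pow (fun q : R * R => W (m + 2)%nat 0%nat (snd q) (fst q))), (cont2_swap (W (m + 2)%nat 0%nat)), CW. }
  assert (CPB : forall a j, cont (PB a j)).
  { intros a j. apply (cont_RInt (fun y x => err_y y0 hy W j a x y ^ 2)); [lra|].
    apply (cont_pow (fun q : R * R => err_y y0 hy W j a (snd q) (fst q))), (cont2_swap (err_y y0 hy W j a)).
    now apply err_y_cont2. }
  apply Rle_trans with (sumr M (fun j => RInt (fun y => 3 * (C * hx ^ (2 * m + 4) * PA y + PB 0%nat j y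
      + C * hx ^ 4 * PB 2%nat j y)) (node y0 hy (j - 1)) (node y0 hy j))).
  - unfold sqnorm2. apply sumr_le. intros j Hj. pose proof (CPB 0%nat j) as CB0. pose proof (CPB 2%nat j) as CB2.
    apply integral_le; [now apply (cont_nrm1 x0 hx N M) | cts | apply node_le; (lra || lia) |].
    intros y _.
    set (F := fun a x => W a 0%nat x y).
    set (G := Piy m p W (node y0 hy (j - 1)) hy y).
    assert (SF : smooth1 F) by apply (smooth2_x W 0 y SW).
    assert (SG : smooth1 G) by (apply Piy_smooth; assumption).
    assert (PF : periodic1 (INR N * hx) F) by (intros n x; apply PW).
    assert (PG : periodic1 (INR N * hx) G) by exact (Piy_periodic hx N y0 hy M W PW j y).
    set (E := fun n x => F n x - G n x).
    assert (SE : smooth1 E) by now apply smooth1_minus.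
    assert (PE : periodic1 (INR N * hx) E) by (intros n x; unfold E; now rewrite PF, PG).
    pose proof (H m x0 hx N F (le_n m) hx0 N1 SF PF) as G1.
    pose proof (H 0%nat x0 hx N E (Nat.le_0_l m) hx0 N1 SE PE) as G2. simpl (2 * 0 + 4)%nat in G2.
    pose proof (smooth1_cont F 0 SF) as CF. pose proof (smooth1_cont E 0 SE) as CE.
    assert (CPi : forall H a, cont (Pi m p H a hx)) by (intros; apply (isP_cont (S m)), isP_Pi, Bp).
    assert (G3 : sqnorm1 x0 hx N (fun _ => E 0%nat) = PB 0%nat j y) by (exact (sqnorm1_cells (fun x => E 0%nat x ^ 2) x0 hx N (cont_pow (E 0%nat) 2 CE))).
    change (RInt (fun x => E (0 + 2)%nat x ^ 2) x0 (x0 + INR N * hx)) with (PB 2%nat j y) in G2.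
    change (RInt (fun x => F (m + 2)%nat x ^ 2) x0 (x0 + INR N * hx)) with (PA y) in G1.
    eapply Rle_trans with (3 * (sqnorm1 x0 hx N (fun i x => F 0%nat x - Pi m p F (node x0 hx (i - 1)) hx x)
       + sqnorm1 x0 hx N (fun _ => E 0%nat)
       + sqnorm1 x0 hx N (fun i x => E 0%nat x - Pi m p E (node x0 hx (i - 1)) hx x))); [|lra].
    unfold sqnorm1. rewrite <- !sumr_plus, <- sumr_scal. apply sumr_le. intros i Hi.
    pose proof (CPi F (node x0 hx (i - 1))). pose proof (CPi E (node x0 hx (i - 1))).
    rewrite <- integral_plus, <- integral_plus, <- integral_scal by cts.
    apply integral_le; [| cts | apply node_le; (lra || lia) |].
    + apply (cont_pow (fun x : R => row e j y i x)), (cont2_l (e i j)). apply Ce; assumption.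
    + intros x _.
      replace (row e j y i x) with ((F 0%nat x - Pi m p F (node x0 hx (i - 1)) hx x) + E 0%nat x
         - (E 0%nat x - Pi m p E (node x0 hx (i - 1)) hx x)).
      2:{ unfold E at 3. rewrite (Pi_minus m p Bp) by assumption. unfold row, e, proj_cell2, Pi2. fold G. unfold F. ring. }
      set (u := F 0%nat x - _). set (w := E 0%nat x). set (z := w - _).
      pose proof (pow2_ge_0 (u - w)). pose proof (pow2_ge_0 (u + z)). pose proof (pow2_ge_0 (w + z)). nra.
  - rewrite (sumr_ext M _ (fun j => 3 * (C * hx ^ (2 * m + 4)) * RInt PA (node y0 hy (j - 1)) (node y0 hy j)
       + (3 * RInt (PB 0%nat j) (node y0 hy (j - 1)) (node y0 hy j)
       + 3 * (C * hx ^ 4) * RInt (PB 2%nat j) (node y0 hy (j - 1)) (node y0 hy j)))).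
    2:{ intros j Hj. pose proof (CPB 0%nat j). pose proof (CPB 2%nat j).
        rewrite integral_scal, integral_plus, integral_plus, !integral_scal by cts. rring. }
    rewrite !sumr_plus, !sumr_scal.
    pose proof (err_y_norm x0 hx N y0 hy M W hx0 hy0 N1 M1 SW PW C H 0 m (le_n m)) as H1.
    pose proof (err_y_norm x0 hx N y0 hy M W hx0 hy0 N1 M1 SW PW C H 2 (m - 2) ltac:(lia)) as H3.
    assert (H2 : sumr M (fun j => RInt PA (node y0 hy (j - 1)) (node y0 hy j)) = Sn (m + 2)%nat 0%nat).
    { apply (sum_slabs x0 hx N y0 hy M hx0 hy0 N1 M1 (fun x y => W (m + 2)%nat 0%nat x y ^ 2)).
      apply (cont_pow (fun q : R * R => W (m + 2)%nat 0%nat (fst q) (snd q))), CW. }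
    rewrite H2.
    change (sumr M (fun j => RInt (PB 0%nat j) (node y0 hy (j - 1)) (node y0 hy j)) <= C * hy ^ (2 * m + 4) * Sn 0%nat (m + 2)%nat) in H1.
    change (sumr M (fun j => RInt (PB 2%nat j) (node y0 hy (j - 1)) (node y0 hy j)) <= C * hy ^ (2 * (m - 2) + 4) * Sn 2%nat (m - 2 + 2)%nat) in H3.
    set (s := sumr M (fun j => RInt (PB 0%nat j) (node y0 hy (j - 1)) (node y0 hy j))) in *.
    set (s' := sumr M (fun j => RInt (PB 2%nat j) (node y0 hy (j - 1)) (node y0 hy j))) in *.
    assert (SP : forall a b, 0 <= Sn a b) by (intros; apply sobolev_sq_ge0; lra || assumption).
    assert (HP : forall n, 0 <= hx ^ n) by (intros; left; now apply pow_lt).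
    assert (HQ : forall n, 0 <= hy ^ n) by (intros; left; now apply pow_lt).
    assert (C2 : 0 <= C * C) by (left; now apply Rmult_lt_0_compat).
    set (t1 := hx ^ (2 * m + 4) * Sn (m + 2)%nat 0%nat).
    set (t2 := hy ^ (2 * m + 4) * Sn 0%nat (m + 2)%nat).
    set (t3 := hy ^ (2 * (m - 2) + 4) * Sn 2%nat (m - 2 + 2)%nat).
    assert (T1 : 0 <= t1) by (apply Rmult_le_pos; auto).
    assert (T2 : 0 <= t2) by (apply Rmult_le_pos; auto).
    assert (T3 : 0 <= hx ^ 4 * t3) by (apply Rmult_le_pos; [auto | apply Rmult_le_pos; auto]).
    assert (hx ^ 4 * s' <= hx ^ 4 * (C * t3)) by (apply Rmult_le_compat_l; [auto | unfold t3; lra]).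
    assert (C * (hx ^ 4 * s') <= C * (hx ^ 4 * (C * t3))) by (apply Rmult_le_compat_l; lra).
    assert (s <= C * t2) by (unfold t2; lra).
    assert (0 <= C * C * t1) by now apply Rmult_le_pos.
    assert (0 <= C * C * t2) by now apply Rmult_le_pos.
    assert (0 <= C * (hx ^ 4 * t3)) by (apply Rmult_le_pos; lra).
    replace (3 * (C * hx ^ (2 * m + 4)) * Sn (m + 2)%nat 0%nat) with (3 * (C * t1)) by (unfold t1; ring).
    lra.
Qed.
End Estimates.

(** * Integrals over the cells *)

Lemma dx_pos Om N : (1 <= N)%nat -> 0 < dx Om N.
Proof.
  intros N1. apply Rdiv_lt_0_compat; [pose proof (ax_lt_bx Om); lra | apply lt_0_INR; lia].
Qed.

Lemma dy_pos Om M : (1 <= M)%nat -> 0 < dy Om M.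
Proof.
  intros M1. apply Rdiv_lt_0_compat; [pose proof (ay_lt_by Om); lra | apply lt_0_INR; lia].
Qed.

Lemma N_dx Om N : (1 <= N)%nat -> INR N * dx Om N = bx Om - ax Om.
Proof. intros N1. unfold dx. field. apply not_0_INR. lia. Qed.

Lemma M_dy Om M : (1 <= M)%nat -> INR M * dy Om M = by_ Om - ay Om.
Proof. intros M1. unfold dy. field. apply not_0_INR. lia. Qed.

Section Mesh.
Variables (Om : rectangle) (N M : nat).
Hypotheses (N1 : (1 <= N)%nat) (M1 : (1 <= M)%nat).

Lemma xn_le i : (1 <= i)%nat -> xn Om N (i - 1) <= xn Om N i.
Proof. apply (node_le (ax Om) (dx Om N)), dx_pos, N1. Qed.

Lemma yn_le j : (1 <= j)%nat -> yn Om M (j - 1) <= yn Om M j.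
Proof. apply (node_le (ay Om) (dy Om M)), dy_pos, M1. Qed.

Definition cellint (f : R -> R -> R) (i j : nat) : R :=
  RInt (fun x => RInt (fun y => f x y) (yn Om M (j - 1)) (yn Om M j)) (xn Om N (i - 1)) (xn Om N i).

Lemma int_cells_eq f : int_cells Om N M f = sumr N (fun i => sumr M (fun j => cellint (f i j) i j)).
Proof. reflexivity. Qed.

Section Cell.
Variables (i j : nat).
Hypotheses (Hi : (1 <= i <= N)%nat) (Hj : (1 <= j <= M)%nat).

Lemma cont_inner f : cont2 f -> cont (fun x : R => RInt (fun y => f x y) (yn Om M (j - 1)) (yn Om M j)).
Proof. intros C. apply (cont_RInt f); [apply yn_le; lia | exact C]. Qed.

Lemma cellint_lin a b f g : cont2 f -> cont2 g ->
  cellint (fun x y => a * f x y + b * g x y) i j = a * cellint f i j + b * cellint g i j.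
Proof.
  intros Cf Cg. unfold cellint. pose proof (cont_inner f Cf) as F. pose proof (cont_inner g Cg) as G.
  rewrite <- !integral_scal by assumption. rewrite <- integral_plus by (apply cont_mult; [cts | assumption]).
  apply integral_ext. intros x. pose proof (cont2_r f x Cf). pose proof (cont2_r g x Cg).
  rewrite integral_plus, !integral_scal by cts. reflexivity.
Qed.

Lemma cellint_ge0 f : cont2 f -> (forall x y, 0 <= f x y) -> 0 <= cellint f i j.
Proof.
  intros Cf P. apply integral_ge0; [now apply cont_inner | apply xn_le; lia |]. intros x _.
  apply integral_ge0; [now apply (cont2_r f) | apply yn_le; lia |]. intros; apply P.
Qed.

Lemma cellint_fubini f : cont2 f -> cellint f i j
  = RInt (fun y => RInt (fun x => f x y) (xn Om N (i - 1)) (xn Om N i)) (yn Om M (j - 1)) (yn Om M j).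
Proof. intros Cf. apply fubini; [apply xn_le; lia | apply yn_le; lia | exact Cf]. Qed.
End Cell.

Lemma int_cells_ext f g :
  (forall i j x y, (1 <= i <= N)%nat -> (1 <= j <= M)%nat -> f i j x y = g i j x y) ->
  int_cells Om N M f = int_cells Om N M g.
Proof.
  intros E. rewrite !int_cells_eq. apply sumr_ext. intros i Hi. apply sumr_ext. intros j Hj.
  apply integral_ext. intros x. apply integral_ext. intros y. now apply E.
Qed.

Lemma int_cells_lin a b f g : broken_cont N M f -> broken_cont N M g ->
  int_cells Om N M (fun i j x y => a * f i j x y + b * g i j x y)
  = a * int_cells Om N M f + b * int_cells Om N M g.
Proof.
  intros Cf Cg. rewrite !int_cells_eq, <- !sumr_scal, <- sumr_plus. apply sumr_ext. intros i Hi.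
  rewrite <- !sumr_scal, <- sumr_plus. apply sumr_ext. intros j Hj.
  apply cellint_lin; auto.
Qed.

Lemma int_cells_ge0 f : broken_cont N M f -> (forall i j x y, 0 <= f i j x y) -> 0 <= int_cells Om N M f.
Proof.
  intros Cf P. rewrite int_cells_eq. apply sumr_ge0. intros i Hi. apply sumr_ge0. intros j Hj.
  apply cellint_ge0; auto.
Qed.

Lemma broken_cont_mult f g : broken_cont N M f -> broken_cont N M g -> broken_cont N M (fun i j x y => f i j x y * g i j x y).
Proof. intros Cf Cg i j Hi Hj. pose proof (Cf i j Hi Hj). pose proof (Cg i j Hi Hj). cts. Qed.

Lemma broken_cont_bcomb a b f g : broken_cont N M f -> broken_cont N M g -> broken_cont N M (bcomb a f b g).
Proof. intros Cf Cg i j Hi Hj. pose proof (Cf i j Hi Hj). pose proof (Cg i j Hi Hj). unfold bcomb. cts. Qed.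

Lemma inner_ext v v' w :
  (forall i j x y, (1 <= i <= N)%nat -> (1 <= j <= M)%nat -> v i j x y = v' i j x y) ->
  inner Om N M v w = inner Om N M v' w.
Proof. intros E. apply int_cells_ext. intros. now rewrite E. Qed.

Lemma inner_sym v w : inner Om N M v w = inner Om N M w v.
Proof. apply int_cells_ext. intros. ring. Qed.

Lemma inner_lin a b v w z : broken_cont N M v -> broken_cont N M w -> broken_cont N M z ->
  inner Om N M (bcomb a v b w) z = a * inner Om N M v z + b * inner Om N M w z.
Proof.
  intros Cv Cw Cz. unfold inner.
  rewrite <- int_cells_lin by now apply broken_cont_mult.
  apply int_cells_ext. intros. unfold bcomb. ring.
Qed.

Lemma inner_ge0 v : broken_cont N M v -> 0 <= inner Om N M v v.
Proof. intros Cv. apply int_cells_ge0; [now apply broken_cont_mult | intros; apply Rle_0_sqr]. Qed.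

Lemma inner_quad_ge0 v w : broken_cont N M v -> broken_cont N M w ->
  quad_ge0 (inner Om N M v v) (inner Om N M v w) (inner Om N M w w).
Proof.
  intros Cv Cw t. pose proof (broken_cont_bcomb t 1 v w Cv Cw) as Cb.
  pose proof (inner_ge0 _ Cb) as H.
  rewrite inner_lin, (inner_sym v), (inner_sym w), !inner_lin, (inner_sym w v) in H by assumption.
  lra.
Qed.

Lemma bnorm_ge0 v : 0 <= bnorm Om N M v.
Proof. apply sqrt_pos. Qed.

Lemma bnorm_sq v : broken_cont N M v -> bnorm Om N M v ^ 2 = inner Om N M v v.
Proof. intros Cv. unfold bnorm. simpl. rewrite Rmult_1_r. apply sqrt_sqrt, inner_ge0, Cv. Qed.

Lemma le_of_sq x y : 0 <= y -> x ^ 2 <= y ^ 2 -> x <= y.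
Proof. intros Hy H. apply Rnot_lt_le. intros C. nra. Qed.

Lemma Rabs_le_of_sq x y : 0 <= y -> x ^ 2 <= y ^ 2 -> Rabs x <= y.
Proof. intros Hy H. apply le_of_sq; [exact Hy|]. now rewrite pow2_abs. Qed.

Lemma cauchy_schwarz v w : broken_cont N M v -> broken_cont N M w ->
  Rabs (inner Om N M v w) <= bnorm Om N M v * bnorm Om N M w.
Proof.
  intros Cv Cw. apply Rabs_le_of_sq.
  - apply Rmult_le_pos; apply bnorm_ge0.
  - rewrite Rpow_mult_distr, !bnorm_sq by assumption. now apply quad_ge0_le, inner_quad_ge0.
Qed.

Lemma bnorm_bcomb a b v w : broken_cont N M v -> broken_cont N M w ->
  bnorm Om N M (bcomb a v b w) <= Rabs a * bnorm Om N M v + Rabs b * bnorm Om N M w.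
Proof.
  intros Cv Cw. pose proof (broken_cont_bcomb a b v w Cv Cw) as Cb.
  pose proof (bnorm_ge0 v) as V0. pose proof (bnorm_ge0 w) as W0.
  pose proof (Rabs_pos a) as A0. pose proof (Rabs_pos b) as B0.
  apply le_of_sq; [apply Rplus_le_le_0_compat; now apply Rmult_le_pos|].
  rewrite bnorm_sq, inner_lin, (inner_sym v), (inner_sym w), !inner_lin, (inner_sym w v) by assumption.
  rewrite <- !bnorm_sq by assumption.
  pose proof (cauchy_schwarz v w Cv Cw) as CS.
  assert (H : a * b * inner Om N M v w <= (Rabs a * Rabs b) * (bnorm Om N M v * bnorm Om N M w)).
  { eapply Rle_trans; [apply Rle_abs|]. rewrite !Rabs_mult.
    apply Rmult_le_compat_l; [now apply Rmult_le_pos | exact CS]. }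
  replace (a * (a * bnorm Om N M v ^ 2 + b * inner Om N M v w)
     + b * (a * inner Om N M v w + b * bnorm Om N M w ^ 2))
    with (a ^ 2 * bnorm Om N M v ^ 2 + b ^ 2 * bnorm Om N M w ^ 2 + 2 * (a * b * inner Om N M v w)) by ring.
  rewrite <- (pow2_abs a), <- (pow2_abs b). lra.
Qed.

Lemma bnorm_ext v w :
  (forall i j x y, (1 <= i <= N)%nat -> (1 <= j <= M)%nat -> v i j x y = w i j x y) ->
  bnorm Om N M v = bnorm Om N M w.
Proof.
  intros E. unfold bnorm. f_equal. apply int_cells_ext. intros. now rewrite E.
Qed.

Lemma inner_sqnorm2 v : broken_cont N M v ->
  inner Om N M v v = sqnorm2 (ax Om) (dx Om N) N (ay Om) (dy Om M) M v.
Proof.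
  intros Cv. rewrite sqnorm2_cells by ((apply dx_pos, N1) || (apply dy_pos, M1) || exact Cv).
  unfold inner. rewrite int_cells_eq. apply sumr_ext. intros i Hi. apply sumr_ext. intros j Hj.
  apply integral_ext. intros x. apply integral_ext. intros y. ring.
Qed.

(** * The bilinear form *)

Definition broken_C1 (v : broken) : Prop :=
  broken_cont N M v /\ broken_cont N M (bDx v) /\ broken_cont N M (bDy v) /\
  forall i j x y, (1 <= i <= N)%nat -> (1 <= j <= M)%nat ->
    is_derive (fun s => v i j s y) x (bDx v i j x y) /\
    is_derive (fun s => v i j x s) y (bDy v i j x y).

Lemma broken_C1_Qh k v : in_Qh N M k v -> broken_C1 v.
Proof.
  intros Q. split; [|split; [|split]].
  - intros i j Hi Hj. apply (is_Qk_cont2 k); auto.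
  - intros i j Hi Hj. apply (is_Qk_Derive_cont2 k); auto.
  - intros i j Hi Hj. apply (cont2_swap (fun y x => Derive (fun s => v i j x s) y)).
    apply (is_Qk_Derive_cont2 k (fun y x => v i j x y)), is_Qk_swap; auto.
  - intros i j x y Hi Hj. split.
    + apply (isP_is_derive k), is_Qk_slice. auto.
    + apply (isP_is_derive k (fun s => v i j x s)), (is_Qk_slice k (fun y x => v i j x y)), is_Qk_swap; auto.
Qed.

Lemma broken_C1_bcomb a b v w : broken_C1 v -> broken_C1 w -> broken_C1 (bcomb a v b w) /\
  (forall i j x y, (1 <= i <= N)%nat -> (1 <= j <= M)%nat ->
     bDx (bcomb a v b w) i j x y = bcomb a (bDx v) b (bDx w) i j x y /\
     bDy (bcomb a v b w) i j x y = bcomb a (bDy v) b (bDy w) i j x y).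
Proof.
  intros (Cv & Cvx & Cvy & Dv) (Cw & Cwx & Cwy & Dw).
  assert (DD : forall i j x y, (1 <= i <= N)%nat -> (1 <= j <= M)%nat ->
    is_derive (fun s => bcomb a v b w i j s y) x (bcomb a (bDx v) b (bDx w) i j x y) /\
    is_derive (fun s => bcomb a v b w i j x s) y (bcomb a (bDy v) b (bDy w) i j x y)).
  { intros i j x y Hi Hj. destruct (Dv i j x y Hi Hj). destruct (Dw i j x y Hi Hj).
    split; apply deriv_plus; apply deriv_scal; assumption. }
  assert (E : forall i j x y, (1 <= i <= N)%nat -> (1 <= j <= M)%nat ->
     bDx (bcomb a v b w) i j x y = bcomb a (bDx v) b (bDx w) i j x y /\
     bDy (bcomb a v b w) i j x y = bcomb a (bDy v) b (bDy w) i j x y).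
  { intros i j x y Hi Hj. split; apply is_derive_unique, DD; assumption. }
  split; [|exact E]. split; [|split; [|split]].
  - now apply broken_cont_bcomb.
  - intros i j Hi Hj. apply cont_ext with (fun q : R * R => bcomb a (bDx v) b (bDx w) i j (fst q) (snd q)).
    + intros q. symmetry. now apply E.
    + apply (broken_cont_bcomb a b _ _ Cvx Cwx i j Hi Hj).
  - intros i j Hi Hj. apply cont_ext with (fun q : R * R => bcomb a (bDy v) b (bDy w) i j (fst q) (snd q)).
    + intros q. symmetry. now apply E.
    + apply (broken_cont_bcomb a b _ _ Cvy Cwy i j Hi Hj).
  - intros i j x y Hi Hj. destruct (E i j x y Hi Hj) as [-> ->]. now apply DD.
Qed.

Lemma broken_C1_smooth W : smooth2 W -> broken_C1 (on_cells (W 0%nat 0%nat)) /\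
  (forall i j x y, bDx (on_cells (W 0%nat 0%nat)) i j x y = W 1%nat 0%nat x y) /\
  (forall i j x y, bDy (on_cells (W 0%nat 0%nat)) i j x y = W 0%nat 1%nat x y).
Proof.
  intros (C & DX & DY).
  assert (EX : forall i j x y, bDx (on_cells (W 0%nat 0%nat)) i j x y = W 1%nat 0%nat x y)
    by (intros; apply is_derive_unique, DX).
  assert (EY : forall i j x y, bDy (on_cells (W 0%nat 0%nat)) i j x y = W 0%nat 1%nat x y)
    by (intros; apply is_derive_unique, DY).
  split; [|now split]. split; [|split; [|split]].
  - intros i j _ _. apply C.
  - intros i j _ _. eapply cont_ext; [|apply (C 1%nat 0%nat)]. intros q; symmetry; apply EX.
  - intros i j _ _. eapply cont_ext; [|apply (C 0%nat 1%nat)]. intros q; symmetry; apply EY.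
  - intros i j x y _ _. rewrite EX, EY. split; [apply DX | apply DY].
Qed.

Notation AX := (form_x (ax Om) (dx Om N) N (ay Om) (dy Om M) M).
Notation AY := (form_x (ay Om) (dy Om M) M (ax Om) (dx Om N) N).

Lemma form_x_split x0 hx n y0 hy k w dw v dv : 0 < hx -> 0 < hy -> (1 <= n)%nat ->
  broken_cont n k w -> broken_cont n k dw -> broken_cont n k v -> broken_cont n k dv ->
  form_x x0 hx n y0 hy k w dw v dv =
  sumr k (fun j => sumr n (fun i => RInt (fun y => RInt (fun x => dw i j x y * dv i j x y)
      (node x0 hx (i - 1)) (node x0 hx i)) (node y0 hy (j - 1)) (node y0 hy j)))
  + sumr k (fun j => sumr n (fun i => RInt (fun y =>
      (trace_plus x0 hx n (row dw j y) i + trace_minus x0 hx (row dw j y) i) / 2 * (trace_plus x0 hx n (row v j y) i - trace_minus x0 hx (row v j y) i)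
      + (trace_plus x0 hx n (row dv j y) i + trace_minus x0 hx (row dv j y) i) / 2 * (trace_plus x0 hx n (row w j y) i - trace_minus x0 hx (row w j y) i))
      (node y0 hy (j - 1)) (node y0 hy j))).
Proof.
  intros hx0 hy0 n1 Cw Cdw Cv Cdv. rewrite <- sumr_plus. apply sumr_ext. intros j Hj. unfold form1.
  assert (C1 : forall i, (1 <= i <= n)%nat ->
     cont (fun y : R => RInt (fun x => dw i j x y * dv i j x y) (node x0 hx (i - 1)) (node x0 hx i))).
  { intros i Hi. apply (cont_RInt (fun y x => dw i j x y * dv i j x y)); [apply node_le; (lra || lia)|].
    apply (cont_mult (fun q : R * R => dw i j (snd q) (fst q)) (fun q => dv i j (snd q) (fst q))).
    + apply (cont2_swap (dw i j)). now apply Cdw.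
    + apply (cont2_swap (dv i j)). now apply Cdv. }
  assert (C2 : forall i, (1 <= i <= n)%nat -> cont (fun y : R =>
      (trace_plus x0 hx n (row dw j y) i + trace_minus x0 hx (row dw j y) i) / 2 * (trace_plus x0 hx n (row v j y) i - trace_minus x0 hx (row v j y) i)
      + (trace_plus x0 hx n (row dv j y) i + trace_minus x0 hx (row dv j y) i) / 2 * (trace_plus x0 hx n (row w j y) i - trace_minus x0 hx (row w j y) i))).
  { intros i Hi.
    pose proof (cont_mi x0 hx n k w j i Cw Hj Hi). pose proof (cont_mi x0 hx n k dw j i Cdw Hj Hi).
    pose proof (cont_mi x0 hx n k v j i Cv Hj Hi). pose proof (cont_mi x0 hx n k dv j i Cdv Hj Hi).
    pose proof (cont_pl x0 hx n k n1 w j i Cw Hj Hi). pose proof (cont_pl x0 hx n k n1 dw j i Cdw Hj Hi).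
    pose proof (cont_pl x0 hx n k n1 v j i Cv Hj Hi). pose proof (cont_pl x0 hx n k n1 dv j i Cdv Hj Hi).
    cts. }
  rewrite integral_plus, !integral_sum; [reflexivity | exact C2 | exact C1 | now apply cont_sum_n_m | now apply cont_sum_n_m].
Qed.

(** Only Fubini and exchanges of the cell sums are involved; the edge terms agree by definition of
    the traces. *)
Lemma bilinA_form_x w v : broken_C1 w -> broken_C1 v ->
  bilinA Om N M w v = AX w (bDx w) v (bDx v) + AY (flip_broken w) (flip_broken (bDy w)) (flip_broken v) (flip_broken (bDy v)).
Proof.
  intros (Cw & Cwx & Cwy & Dw) (Cv & Cvx & Cvy & Dv).
  rewrite (form_x_split (ax Om)) by ((apply dx_pos, N1) || (apply dy_pos, M1) || assumption).
  rewrite (form_x_split (ay Om)) by ((apply dx_pos, N1) || (apply dy_pos, M1) || assumption || (now apply broken_cont_tr)).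
  unfold bilinA.
  rewrite (int_cells_ext _ (fun i j x y => 1 * (bDx w i j x y * bDx v i j x y)
     + 1 * (bDy w i j x y * bDy v i j x y))) by (intros; ring).
  rewrite int_cells_lin by now apply broken_cont_mult.
  rewrite !int_cells_eq.
  rewrite (sumr_ext N (fun i => sumr M (fun j => cellint (fun x y => bDx w i j x y * bDx v i j x y) i j))
     (fun i => sumr M (fun j => RInt (fun y => RInt (fun x => bDx w i j x y * bDx v i j x y)
        (xn Om N (i - 1)) (xn Om N i)) (yn Om M (j - 1)) (yn Om M j)))).
  2:{ intros i Hi. apply sumr_ext. intros j Hj. apply cellint_fubini; [exact Hi | exact Hj |].
      now apply (broken_cont_mult (bDx w) (bDx v)). }
  rewrite (sumr_swap N M (fun i j => RInt (fun y => RInt (fun x => bDx w i j x y * bDx v i j x y)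
        (xn Om N (i - 1)) (xn Om N i)) (yn Om M (j - 1)) (yn Om M j))).
  unfold sum_cells.
  rewrite (sumr_swap N M (fun i j => RInt (fun y => xavg Om N (bDx w) i j y * xjump Om N v i j y +
     xavg Om N (bDx v) i j y * xjump Om N w i j y) (yn Om M (j - 1)) (yn Om M j))).
  unfold cellint, xavg, xjump, yavg, yjump, xplus, xminus, yplus, yminus, trace_plus, trace_minus, row, flip_broken.
  change xn with (fun Om N => node (ax Om) (dx Om N)). change yn with (fun Om M => node (ay Om) (dy Om M)).
  cbv beta. rring.
Qed.
End Mesh.

Lemma form1_ext x0 h N w dw w' dw' v dv v' dv' : (1 <= N)%nat ->
  (forall i x, (1 <= i <= N)%nat -> w i x = w' i x /\ dw i x = dw' i x /\ v i x = v' i x /\ dv i x = dv' i x) ->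
  form1 x0 h N w dw v dv = form1 x0 h N w' dw' v' dv'.
Proof.
  intros N1 E. unfold form1. f_equal.
  - apply sumr_ext. intros i Hi. apply integral_ext. intros x.
    destruct (E i x Hi) as (_ & -> & _ & ->). reflexivity.
  - apply sumr_ext. intros i Hi. unfold trace_plus, trace_minus.
    destruct (E i (node x0 h i) Hi) as (-> & -> & -> & ->).
    destruct (Nat.eqb_spec i N).
    + destruct (E 1%nat (node x0 h 0)) as (-> & -> & -> & ->); [lia | reflexivity].
    + destruct (E (S i) (node x0 h i)) as (-> & -> & -> & ->); [lia | reflexivity].
Qed.

Lemma form1_comb x0 h N a b (w dw w' dw' v dv : nat -> R -> R) :
  (forall i, (1 <= i <= N)%nat -> cont (dw i)) -> (forall i, (1 <= i <= N)%nat -> cont (dw' i)) ->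
  (forall i, (1 <= i <= N)%nat -> cont (dv i)) ->
  form1 x0 h N (fun i x => a * w i x + b * w' i x) (fun i x => a * dw i x + b * dw' i x) v dv
  = a * form1 x0 h N w dw v dv + b * form1 x0 h N w' dw' v dv.
Proof.
  intros C C' CV. unfold form1. rewrite !Rmult_plus_distr_l, <- !sumr_scal.
  match goal with |- _ = ?A + ?B + (?C + ?D) => transitivity ((A + C) + (B + D)); [|ring] end.
  f_equal; rewrite <- sumr_plus; apply sumr_ext.
  - intros i Hi. specialize (C i Hi). specialize (C' i Hi). specialize (CV i Hi).
    rewrite <- !integral_scal, <- integral_plus by cts. apply integral_ext; intros; ring.
  - intros i Hi. unfold trace_plus, trace_minus. destruct (Nat.eqb i N); field.
Qed.

Lemma form_x_ext x0 hx N y0 hy M w dw w' dw' v dv v' dv' : (1 <= N)%nat ->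
  (forall i j x y, (1 <= i <= N)%nat -> (1 <= j <= M)%nat ->
    w i j x y = w' i j x y /\ dw i j x y = dw' i j x y /\
    v i j x y = v' i j x y /\ dv i j x y = dv' i j x y) ->
  form_x x0 hx N y0 hy M w dw v dv = form_x x0 hx N y0 hy M w' dw' v' dv'.
Proof.
  intros N1 E. apply sumr_ext. intros j Hj. apply integral_ext. intros y.
  apply form1_ext; [exact N1|]. intros i x Hi. now apply E.
Qed.

Lemma form_x_comb x0 hx N y0 hy M a b w dw w' dw' v dv : (1 <= N)%nat -> 0 < hx ->
  broken_cont N M w -> broken_cont N M dw -> broken_cont N M w' -> broken_cont N M dw' -> broken_cont N M v -> broken_cont N M dv ->
  form_x x0 hx N y0 hy M (bcomb a w b w') (bcomb a dw b dw') v dv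
  = a * form_x x0 hx N y0 hy M w dw v dv + b * form_x x0 hx N y0 hy M w' dw' v dv.
Proof.
  intros N1 hx0 Cw Cdw Cw' Cdw' Cv Cdv. unfold form_x. rewrite <- !sumr_scal, <- sumr_plus.
  apply sumr_ext. intros j Hj.
  pose proof (cont_a1 x0 hx N M N1 hx0 w dw v dv j Cw Cdw Cv Cdv Hj) as C1.
  pose proof (cont_a1 x0 hx N M N1 hx0 w' dw' v dv j Cw' Cdw' Cv Cdv Hj) as C2.
  rewrite <- !integral_scal by assumption. rewrite <- integral_plus by (apply cont_mult; [cts | assumption]).
  apply integral_ext. intros y. apply form1_comb.
  - intros i Hi. apply (cont2_l (dw i j)). now apply Cdw.
  - intros i Hi. apply (cont2_l (dw' i j)). now apply Cdw'.
  - intros i Hi. apply (cont2_l (dv i j)). now apply Cdv.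
Qed.

Lemma form_x_smooth x0 hx N y0 hy M W v dv : (1 <= N)%nat -> 0 < hx -> 0 < hy ->
  smooth2 W -> periodic2 (INR N * hx) (INR M * hy) W -> broken_cont N M v -> broken_cont N M dv ->
  (forall i j x y, (1 <= i <= N)%nat -> (1 <= j <= M)%nat -> is_derive (fun s => v i j s y) x (dv i j x y)) ->
  form_x x0 hx N y0 hy M (on_cells (W 0%nat 0%nat)) (on_cells (W 1%nat 0%nat)) v dv
  = - sumr N (fun i => sumr M (fun j => RInt (fun x => RInt (fun y => W 2%nat 0%nat x y * v i j x y)
       (node y0 hy (j - 1)) (node y0 hy j)) (node x0 hx (i - 1)) (node x0 hx i))).
Proof.
  intros N1 hx0 hy0 SW PW Cv Cdv Dv. rewrite sumr_swap.
  replace (- sumr M (fun j => _)) with (-1 * sumr M (fun j => sumr N (fun i =>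
     RInt (fun x => RInt (fun y => W 2%nat 0%nat x y * v i j x y)
       (node y0 hy (j - 1)) (node y0 hy j)) (node x0 hx (i - 1)) (node x0 hx i)))) by ring.
  rewrite <- sumr_scal. apply sumr_ext. intros j Hj.
  assert (C : forall i, (1 <= i <= N)%nat -> cont2 (fun x y => W 2%nat 0%nat x y * v i j x y)).
  { intros i Hi. pose proof (proj1 SW 2%nat 0%nat). pose proof (Cv i j Hi Hj). cts. }
  assert (C' : forall i, (1 <= i <= N)%nat -> cont (fun y : R => RInt (fun x => W 2%nat 0%nat x y * v i j x y) (node x0 hx (i - 1)) (node x0 hx i))).
  { intros i Hi. apply (cont_RInt (fun y x => W 2%nat 0%nat x y * v i j x y)); [apply node_le; (lra || lia)|].
    now apply (cont2_swap (fun x y => W 2%nat 0%nat x y * v i j x y)), C. }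
  rewrite (sumr_ext N _ (fun i => RInt (fun y => RInt (fun x => W 2%nat 0%nat x y * v i j x y)
      (node x0 hx (i - 1)) (node x0 hx i)) (node y0 hy (j - 1)) (node y0 hy j))).
  2:{ intros i Hi. apply (fubini (fun x y => W 2%nat 0%nat x y * v i j x y)); [apply node_le; (lra || lia) | apply node_le; (lra || lia) | now apply C]. }
  rewrite <- (integral_sum (fun i y => RInt (fun x => W 2%nat 0%nat x y * v i j x y) (node x0 hx (i - 1)) (node x0 hx i))) by exact C'.
  rewrite <- integral_scal by now apply cont_sum_n_m.
  apply integral_ext. intros y.
  etransitivity; [apply (form1_smooth x0 hx N (fun a x => W a 0%nat x y) (row v j y) (row dv j y))|].
  - apply (smooth2_x W 0 y SW).
  - intros n x. apply PW.
  - intros i x Hi. now apply Dv.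
  - intros i Hi. apply (cont2_l (dv i j)). now apply Cdv.
  - unfold row; cbv beta; rring.
Qed.

Section Mesh.
Variables (Om : rectangle) (N M : nat).
Hypotheses (N1 : (1 <= N)%nat) (M1 : (1 <= M)%nat).

Notation Lx := (bx Om - ax Om).
Notation Ly := (by_ Om - ay Om).
Notation Sn := (sobolev_sq (ax Om) Lx (ay Om) Ly).

Lemma bilinA_sym w v : bilinA Om N M w v = bilinA Om N M v w.
Proof.
  unfold bilinA. f_equal; [f_equal|].
  - apply int_cells_ext. intros. ring.
  - apply sumr_ext. intros i Hi. apply sumr_ext. intros j Hj. apply integral_ext. intros. ring.
  - apply sumr_ext. intros i Hi. apply sumr_ext. intros j Hj. apply integral_ext. intros. ring.
Qed.

Lemma bilinA_lin a b w w' v : broken_C1 N M w -> broken_C1 N M w' -> broken_C1 N M v ->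
  bilinA Om N M (bcomb a w b w') v = a * bilinA Om N M w v + b * bilinA Om N M w' v.
Proof.
  intros Bw Bw' Bv. destruct (broken_C1_bcomb N M a b w w' Bw Bw') as [Bc E].
  rewrite !bilinA_form_x by assumption.
  rewrite (form_x_ext (ax Om) _ N _ _ M _ (bDx (bcomb a w b w')) (bcomb a w b w') (bcomb a (bDx w) b (bDx w')) v (bDx v) v (bDx v))
    by (assumption || (intros i j x y Hi Hj; destruct (E i j x y Hi Hj) as [-> _]; auto)).
  rewrite (form_x_ext (ay Om) _ M _ _ N (flip_broken (bcomb a w b w')) (flip_broken (bDy (bcomb a w b w')))
      (bcomb a (flip_broken w) b (flip_broken w')) (bcomb a (flip_broken (bDy w)) b (flip_broken (bDy w'))) (flip_broken v) (flip_broken (bDy v)) (flip_broken v) (flip_broken (bDy v)))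
    by (assumption || (intros j i y x Hj Hi; unfold flip_broken; destruct (E i j x y Hi Hj) as [_ ->]; auto)).
  destruct Bw as (Cw & Cwx & Cwy & _). destruct Bw' as (Cw' & Cwx' & Cwy' & _).
  destruct Bv as (Cv & Cvx & Cvy & _).
  pose proof (dx_pos Om N N1). pose proof (dy_pos Om M M1).
  rewrite !form_x_comb by (assumption || (apply broken_cont_tr; assumption)).
  ring.
Qed.

Section Smooth.
Variable W : nat -> nat -> R -> R -> R.
Hypotheses (SW : smooth2 W) (PW : periodic2 Lx Ly W).

Let PW' : periodic2 (INR N * dx Om N) (INR M * dy Om M) W.
Proof. now rewrite N_dx, M_dy. Qed.

(** [W] is smooth and periodic, so the integrations by parts in either direction leave no edge
    terms. This is what makes the scheme consistent. *)
Lemma bilinA_smooth v : broken_C1 N M v ->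
  bilinA Om N M (on_cells (W 0%nat 0%nat)) v
  = - inner Om N M (on_cells (fun x y => W 2%nat 0%nat x y + W 0%nat 2%nat x y)) v.
Proof.
  intros Bv. destruct (broken_C1_smooth N M W SW) as (BW & EX & EY).
  rewrite bilinA_form_x by assumption. destruct Bv as (Cv & Cvx & Cvy & Dv).
  pose proof (dx_pos Om N N1) as hx0. pose proof (dy_pos Om M M1) as hy0.
  rewrite (form_x_ext (ax Om) _ N _ _ M _ (bDx (on_cells (W 0%nat 0%nat))) (on_cells (W 0%nat 0%nat)) (on_cells (W 1%nat 0%nat)) v (bDx v) v (bDx v))
    by (assumption || (intros; rewrite EX; auto)).
  rewrite (form_x_ext (ay Om) _ M _ _ N (flip_broken (on_cells (W 0%nat 0%nat))) (flip_broken (bDy (on_cells (W 0%nat 0%nat))))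
     (on_cells (transpose W 0%nat 0%nat)) (on_cells (transpose W 1%nat 0%nat)) (flip_broken v) (flip_broken (bDy v)) (flip_broken v) (flip_broken (bDy v)))
    by (assumption || (intros; unfold flip_broken; rewrite EY; auto)).
  rewrite (form_x_smooth (ax Om) _ N _ _ M W v (bDx v) N1 hx0 hy0 SW PW' Cv Cvx
    (fun i j x y Hi Hj => proj1 (Dv i j x y Hi Hj))).
  rewrite (form_x_smooth (ay Om) _ M _ _ N (transpose W) (flip_broken v) (flip_broken (bDy v)) M1 hy0 hx0
    (smooth2_transpose W SW) (periodic2_tr _ _ W PW') (broken_cont_tr N M v Cv) (broken_cont_tr N M _ Cvy)
    (fun j i y x Hj Hi => proj2 (Dv i j x y Hi Hj))).
  unfold inner. rewrite (int_cells_ext Om N M _ (fun i j x y => 1 * (W 2%nat 0%nat x y * v i j x y)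
     + 1 * (W 0%nat 2%nat x y * v i j x y))) by (intros; unfold on_cells; ring).
  assert (C20 : broken_cont N M (fun i j x y => W 2%nat 0%nat x y * v i j x y))
    by (apply (broken_cont_mult N M (on_cells (W 2%nat 0%nat))); [intros i j _ _; apply SW | exact Cv]).
  assert (C02 : broken_cont N M (fun i j x y => W 0%nat 2%nat x y * v i j x y))
    by (apply (broken_cont_mult N M (on_cells (W 0%nat 2%nat))); [intros i j _ _; apply SW | exact Cv]).
  rewrite int_cells_lin by assumption.
  rewrite !int_cells_eq.
  rewrite (sumr_swap N M (fun i j => cellint Om N M (fun x y => W 0%nat 2%nat x y * v i j x y) i j)).
  rewrite (sumr_ext M (fun j => sumr N (fun i => cellint Om N M (fun x y => W 0%nat 2%nat x y * v i j x y) i j))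
    (fun j => sumr N (fun i => RInt (fun y => RInt (fun x => W 0%nat 2%nat x y * v i j x y)
       (xn Om N (i - 1)) (xn Om N i)) (yn Om M (j - 1)) (yn Om M j)))).
  2:{ intros j Hj. apply sumr_ext. intros i Hi. apply cellint_fubini; auto. }
  unfold cellint, transpose, flip_broken.
  change xn with (fun Om N => node (ax Om) (dx Om N)). change yn with (fun Om M => node (ay Om) (dy Om M)).
  cbv beta. rring.
Qed.
End Smooth.
End Mesh.

(** * The projection on the mesh of the rectangle *)

Section Projection.
Variables (m : nat) (p : nat -> R -> R).
Hypothesis Bp : onb m p.

Notation Lx Om := (bx Om - ax Om).
Notation Ly Om := (by_ Om - ay Om).
Notation Sn Om := (sobolev_sq (ax Om) (Lx Om) (ay Om) (Ly Om)).

Definition proj_mesh (Om : rectangle) (N M : nat) (W : nat -> nat -> R -> R -> R) : broken :=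
  proj_cell2 m p (ax Om) (dx Om N) (ay Om) (dy Om M) W.

Definition proj_error (Om : rectangle) (N M : nat) (W : nat -> nat -> R -> R -> R) : broken :=
  bcomb 1 (on_cells (W 0%nat 0%nat)) (-1) (proj_mesh Om N M W).

Lemma proj_mesh_Qh Om N M W : smooth2 W -> in_Qh N M (S m) (proj_mesh Om N M W).
Proof. intros SW i j _ _. now apply proj_cell2_Qk. Qed.

Lemma proj_error_breg Om N M W : smooth2 W -> broken_C1 N M (proj_error Om N M W).
Proof.
  intros SW. apply broken_C1_bcomb; [now apply broken_C1_smooth|].
  apply (broken_C1_Qh N M (S m)). now apply proj_mesh_Qh.
Qed.

Lemma proj_error_eq Om N M W i j x y : proj_error Om N M W i j x y = W 0%nat 0%nat x y - proj_mesh Om N M W i j x y.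
Proof. unfold proj_error, bcomb, on_cells. ring. Qed.

Lemma hx_le Om N M : 0 <= dx Om N -> 0 <= dy Om M -> forall n,
  dx Om N ^ n <= mesh_size Om N M ^ n /\ dy Om M ^ n <= mesh_size Om N M ^ n.
Proof.
  intros Hx Hy n. split; apply pow_incr; (split; [assumption|]); [apply Rmax_l | apply Rmax_r].
Qed.

(** All four norms have order [m + 4]; the last two come from the transposed estimate. *)
Definition consistency_sq Om W := Sn Om W (m + 4)%nat 0%nat + Sn Om W 2%nat (m + 2)%nat
  + Sn Om W 0%nat (m + 4)%nat + Sn Om W (m + 2)%nat 2%nat.
Definition approx_sq Om W := Sn Om W (m + 2)%nat 0%nat + Sn Om W 0%nat (m + 2)%nat
  + Sn Om W 2%nat (m - 2 + 2)%nat.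

Lemma A_consistency : exists C, 0 < C /\ forall Om N M W v,
  (1 <= N)%nat -> (1 <= M)%nat -> smooth2 W -> periodic2 (Lx Om) (Ly Om) W -> in_Qh N M (S m) v ->
  bilinA Om N M (proj_error Om N M W) v ^ 2
  <= C * mesh_size Om N M ^ (2 * m + 4) * consistency_sq Om W * inner Om N M v v.
Proof.
  destruct (form_x_consistency m p Bp) as (C & C0 & H). exists (2 * C). split; [lra|].
  intros Om N M W v N1 M1 SW PW Qv.
  pose proof (dx_pos Om N N1) as hx0. pose proof (dy_pos Om M M1) as hy0.
  destruct (hx_le Om N M (Rlt_le _ _ hx0) (Rlt_le _ _ hy0) (2 * m + 4)) as [Hx Hy].
  pose proof (broken_C1_Qh N M _ v Qv) as Bv. pose proof (proj_error_breg Om N M W SW) as Be.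
  assert (LX : 0 <= Lx Om) by (pose proof (ax_lt_bx Om); lra).
  assert (LY : 0 <= Ly Om) by (pose proof (ay_lt_by Om); lra).
  apply quad_ge0_le. rewrite (inner_sqnorm2 Om N M N1 M1) by apply Bv.
  rewrite (bilinA_form_x Om N M N1 M1) by assumption.
  assert (P' : periodic2 (INR N * dx Om N) (INR M * dy Om M) W) by now rewrite N_dx, M_dy.
  destruct (broken_C1_smooth N M W SW) as (_ & EX & EY).
  destruct Bv as (Cv & Cvx & Cvy & Dv).
  assert (H1 := H (ax Om) (dx Om N) N (ay Om) (dy Om M) M W v (bDx v) hx0 hy0 N1 M1 SW P' Qv
     (fun i j x y Hi Hj => proj1 (Dv i j x y Hi Hj))).
  assert (H2 := H (ay Om) (dy Om M) M (ax Om) (dx Om N) N (transpose W) (flip_broken v) (flip_broken (bDy v)) hy0 hx0 M1 N1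
     (smooth2_transpose W SW) (periodic2_tr _ _ W P')
     (fun j i Hj Hi => is_Qk_swap (S m) (v i j) (Qv i j Hi Hj))
     (fun j i y x Hj Hi => proj2 (Dv i j x y Hi Hj))).
  rewrite (sqnorm2_tr (ax Om) _ N (ay Om) _ M v hx0 hy0 Cv) in H2.
  rewrite !N_dx, !M_dy in H1 by assumption. rewrite !N_dx, !M_dy in H2 by assumption.
  rewrite !sobolev_sq_tr in H2 by assumption.
  pose proof (quad_ge0_add _ _ _ _ _ H1 H2) as H3. clear H1 H2.
  eapply quad_ge0_mono; [| | apply Rle_refl].
  - match type of H3 with quad_ge0 _ ?X _ => match goal with |- quad_ge0 _ ?Y _ => replace Y with X; [exact H3|] end end.
    f_equal.
    + apply form_x_ext; [exact N1|]. intros i j x y Hi Hj. split; [symmetry; apply proj_error_eq|]. split; [|auto].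
      symmetry. apply is_derive_unique.
      apply is_derive_ext with (fun s => W 0%nat 0%nat s y - proj_mesh Om N M W i j s y); [intros; symmetry; apply proj_error_eq|].
      apply deriv_minus; [apply SW | now apply deriv_proj_cell2].
    + apply form_x_ext; [exact M1|]. intros j i y x Hj Hi.
      assert (ET : forall x y, proj_cell2 m p (ay Om) (dy Om M) (ax Om) (dx Om N) (transpose W) j i y x = proj_mesh Om N M W i j x y)
        by (intros; now apply Pi2_transpose).
      unfold flip_broken. split; [rewrite proj_error_eq, ET; reflexivity|]. split; [|auto].
      symmetry. apply is_derive_unique.
      apply is_derive_ext with (fun s => transpose W 0%nat 0%nat s x - proj_cell2 m p (ay Om) (dy Om M) (ax Om) (dx Om N) (transpose W) j i s x);
        [intros; rewrite proj_error_eq, ET; reflexivity|].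
      apply deriv_minus; [apply (smooth2_transpose W SW) | now apply deriv_proj_cell2].
  - unfold consistency_sq.
    set (s1 := Sn Om W (m + 4)%nat 0%nat). set (s2 := Sn Om W 2%nat (m + 2)%nat).
    set (s3 := Sn Om W 0%nat (m + 4)%nat). set (s4 := Sn Om W (m + 2)%nat 2%nat).
    assert (P1 : 0 <= s1) by now apply sobolev_sq_ge0. assert (P2 : 0 <= s2) by now apply sobolev_sq_ge0.
    assert (P3 : 0 <= s3) by now apply sobolev_sq_ge0. assert (P4 : 0 <= s4) by now apply sobolev_sq_ge0.
    set (X := dx Om N ^ (2 * m + 4)) in *. set (Y := dy Om M ^ (2 * m + 4)) in *.
    set (Z := mesh_size Om N M ^ (2 * m + 4)) in *.
    assert (X * s1 <= Z * s1) by now apply Rmult_le_compat_r.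
    assert (Y * s2 <= Z * s2) by now apply Rmult_le_compat_r.
    assert (Y * s3 <= Z * s3) by now apply Rmult_le_compat_r.
    assert (X * s4 <= Z * s4) by now apply Rmult_le_compat_r.
    assert (C * (X * s1 + Y * s2 + (Y * s3 + X * s4)) <= C * (Z * (s1 + s2 + s3 + s4))); [|lra].
    apply Rmult_le_compat_l; lra.
Qed.

(** The constant depends on the rectangle, unlike that of [A_consistency]: for [m < 2] the mixed
    term carries an excess power of the mesh size, which is bounded by a power of [D]. *)
Lemma L2_error : forall Om, exists C, 0 < C /\ forall N M W,
  (1 <= N)%nat -> (1 <= M)%nat -> smooth2 W -> periodic2 (Lx Om) (Ly Om) W ->
  inner Om N M (proj_error Om N M W) (proj_error Om N M W) <= C * mesh_size Om N M ^ (2 * m + 4) * approx_sq Om W.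
Proof.
  intros Om. destruct (proj_cell2_L2_error m p Bp) as (C & C0 & H).
  assert (LX : 0 <= Lx Om) by (pose proof (ax_lt_bx Om); lra).
  assert (LY : 0 <= Ly Om) by (pose proof (ay_lt_by Om); lra).
  set (D := 1 + (Lx Om + Ly Om)).
  exists (C * D ^ 4). split; [apply Rmult_lt_0_compat; [exact C0 | apply pow_lt; unfold D; lra]|].
  intros N M W N1 M1 SW PW.
  pose proof (dx_pos Om N N1) as hx0. pose proof (dy_pos Om M M1) as hy0.
  pose proof (hx_le Om N M (Rlt_le _ _ hx0) (Rlt_le _ _ hy0)) as Hh.
  pose proof (proj_error_breg Om N M W SW) as Be.
  assert (P' : periodic2 (INR N * dx Om N) (INR M * dy Om M) W) by now rewrite N_dx, M_dy.
  rewrite (inner_sqnorm2 Om N M N1 M1) by apply Be.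
  pose proof (H (ax Om) (dx Om N) N (ay Om) (dy Om M) M W hx0 hy0 N1 M1 SW P') as H1.
  cbv zeta in H1. rewrite !N_dx, !M_dy in H1 by assumption.
  rewrite (sqnorm2_ext _ _ _ _ _ _ _ (fun i j x y => W 0%nat 0%nat x y - proj_mesh Om N M W i j x y))
    by (intros; apply proj_error_eq).
  eapply Rle_trans; [exact H1|]. unfold approx_sq.
  set (s1 := Sn Om W (m + 2)%nat 0%nat). set (s2 := Sn Om W 0%nat (m + 2)%nat).
  set (s3 := Sn Om W 2%nat (m - 2 + 2)%nat).
  assert (P1 : 0 <= s1) by now apply sobolev_sq_ge0. assert (P2 : 0 <= s2) by now apply sobolev_sq_ge0.
  assert (P3 : 0 <= s3) by now apply sobolev_sq_ge0.
  set (h := mesh_size Om N M) in *.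
  assert (hpos : 0 < h) by (apply Rlt_le_trans with (1 := hx0); apply Rmax_l).
  assert (I1 : forall n, (1 <= n)%nat -> 1 <= INR n) by (intros n Hn; apply (le_INR 1), Hn).
  assert (hD : h <= D).
  { unfold h, mesh_size, D. apply Rmax_lub.
    - pose proof (N_dx Om N N1). specialize (I1 N N1). nra.
    - pose proof (M_dy Om M M1). specialize (I1 M M1). nra. }
  assert (D1 : 1 <= D) by (unfold D; lra).
  set (Z := h ^ (2 * m + 4)). assert (Z0 : 0 <= Z) by (left; now apply pow_lt).
  assert (D4 : 1 <= D ^ 4) by now apply pow_R1_Rle.
  assert (E1 : dx Om N ^ (2 * m + 4) <= Z) by apply Hh.
  assert (E2 : dy Om M ^ (2 * m + 4) <= Z) by apply Hh.
  assert (E3 : dx Om N ^ 4 * dy Om M ^ (2 * (m - 2) + 4) <= D ^ 4 * Z).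
  { apply Rle_trans with (h ^ 4 * h ^ (2 * (m - 2) + 4)).
    - apply Rmult_le_compat; [left; now apply pow_lt | left; now apply pow_lt | apply Hh | apply Hh].
    - rewrite <- pow_add. unfold Z.
      (* The exponent in excess is 4, 2 or 0, for [m = 0], [m = 1] and [m >= 2]. *)
      replace (4 + (2 * (m - 2) + 4))%nat with ((8 + 2 * (m - 2) - (2 * m + 4)) + (2 * m + 4))%nat by lia.
      rewrite pow_add. apply Rmult_le_compat_r; [exact Z0|].
      apply Rle_trans with (D ^ (8 + 2 * (m - 2) - (2 * m + 4))).
      + apply pow_incr. lra.
      + apply Rle_pow; [exact D1 | lia]. }
  assert (T1 : dx Om N ^ (2 * m + 4) * s1 <= D ^ 4 * Z * s1).
  { apply Rmult_le_compat_r; [exact P1|]. nra. }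
  assert (T2 : dy Om M ^ (2 * m + 4) * s2 <= D ^ 4 * Z * s2).
  { apply Rmult_le_compat_r; [exact P2|]. nra. }
  assert (T3 : dx Om N ^ 4 * dy Om M ^ (2 * (m - 2) + 4) * s3 <= D ^ 4 * Z * s3)
    by now apply Rmult_le_compat_r.
  replace (C * D ^ 4 * Z * (s1 + s2 + s3)) with (C * (D ^ 4 * Z * s1 + D ^ 4 * Z * s2 + D ^ 4 * Z * s3)) by ring.
  apply Rmult_le_compat_l; lra.
Qed.
End Projection.

(** * Elliptic regularity of the periodic Laplacian *)

Lemma ibp_periodic (f df g dg : R -> R) x0 L :
  (forall x, is_derive f x (df x)) -> (forall x, is_derive g x (dg x)) -> cont df -> cont dg ->
  f (x0 + L) = f x0 -> g (x0 + L) = g x0 ->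
  RInt (fun x => df x * g x) x0 (x0 + L) = - RInt (fun x => f x * dg x) x0 (x0 + L).
Proof.
  intros Df Dg Cdf Cdg Pf Pg.
  assert (Cf : cont f) by now apply (cont_of_derive f df).
  assert (Cg : cont g) by now apply (cont_of_derive g dg).
  assert (E : RInt (fun x => df x * g x + f x * dg x) x0 (x0 + L) = f (x0 + L) * g (x0 + L) - f x0 * g x0).
  { apply (integral_ftc (fun x => f x * g x)); [intros; now apply deriv_mult | cts]. }
  rewrite integral_plus in E by cts. rewrite Pf, Pg in E. lra.
Qed.

(** By periodicity and the mean value theorem [F 1] vanishes at some [c]; from there Cauchy-Schwarz
    bounds its square everywhere by [L] times the integral of the square of [F 2]. *)
Lemma poincare_1d F x0 L : smooth1 F -> periodic1 L F -> 0 < L ->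
  RInt (fun x => F 1%nat x ^ 2) x0 (x0 + L) <= L ^ 2 * RInt (fun x => F 2%nat x ^ 2) x0 (x0 + L).
Proof.
  intros SF PF L0.
  pose proof (smooth1_cont F 0 SF) as C0. pose proof (smooth1_cont F 1 SF) as C1.
  pose proof (smooth1_cont F 2 SF) as C2.
  assert (CC : cont (fun x : R => F 2%nat x ^ 2)) by cts.
  destruct (MVT_gen (F 0%nat) x0 (x0 + L) (F 1%nat)) as (c & Hc & E).
  { intros; apply SF. }
  { intros x _. apply continuity_pt_filterlim, C0. }
  rewrite Rmin_left, Rmax_right in Hc by lra.
  rewrite PF in E. assert (Z : F 1%nat c = 0) by nra.
  set (Q := RInt (fun x => F 2%nat x ^ 2) x0 (x0 + L)).
  assert (B : forall u v, x0 <= u <= v -> v <= x0 + L -> (F 1%nat v - F 1%nat u) ^ 2 <= L * Q).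
  { intros u v Hu Hv.
    assert (Eu : F 1%nat v - F 1%nat u = RInt (fun x => 1 * F 2%nat x) u v).
    { symmetry. rewrite (integral_ext _ (F 2%nat)) by (intros; ring). apply integral_ftc; [intros; apply SF | exact C2]. }
    rewrite Eu.
    apply Rle_trans with (1 := integral_cauchy_schwarz (fun _ => 1) (F 2%nat) u v ltac:(lra) (cont_const 1) C2).
    rewrite integral_const.
    assert (P1 : 0 <= RInt (fun x => F 2%nat x ^ 2) x0 u)
      by (apply integral_ge0; [cts | lra | intros; apply pow2_ge_0]).
    assert (P2 : 0 <= RInt (fun x => F 2%nat x ^ 2) u v)
      by (apply integral_ge0; [cts | lra | intros; apply pow2_ge_0]).
    assert (P3 : 0 <= RInt (fun x => F 2%nat x ^ 2) v (x0 + L))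
      by (apply integral_ge0; [cts | lra | intros; apply pow2_ge_0]).
    pose proof (integral_chasles _ x0 u CC v). pose proof (integral_chasles _ x0 v CC (x0 + L)). fold Q in H0.
    replace ((v - u) * 1 ^ 2) with (v - u) by ring.
    apply Rmult_le_compat; lra. }
  apply Rle_trans with (RInt (fun _ => L * Q) x0 (x0 + L)).
  - apply integral_le; [cts | cts | lra |]. intros x Hx.
    destruct (Rle_dec c x).
    + replace (F 1%nat x) with (F 1%nat x - F 1%nat c) by lra. apply B; lra.
    + replace (F 1%nat x ^ 2) with ((F 1%nat c - F 1%nat x) ^ 2) by (rewrite Z; ring). apply B; lra.
  - rewrite integral_const. right. ring.
Qed.

Definition lap (W : nat -> nat -> R -> R -> R) : nat -> nat -> R -> R -> R :=
  fun a b x y => W (S (S a)) b x y + W a (S (S b)) x y.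

Definition shift (i j : nat) (W : nat -> nat -> R -> R -> R) : nat -> nat -> R -> R -> R :=
  fun a b => W (a + i)%nat (b + j)%nat.

Lemma smooth2_lap W : smooth2 W -> smooth2 (lap W).
Proof.
  intros (C & DX & DY). split; [|split]; intros; unfold lap.
  - pose proof (C (S (S a)) b). pose proof (C a (S (S b))). cts.
  - apply deriv_plus; apply DX.
  - apply deriv_plus; apply DY.
Qed.

Lemma smooth2_shift i j W : smooth2 W -> smooth2 (shift i j W).
Proof.
  intros (C & DX & DY). split; [|split]; intros; unfold shift.
  - apply C.
  - apply DX.
  - apply DY.
Qed.

Lemma smooth2_scal c W : smooth2 W -> smooth2 (fun a b x y => c * W a b x y).
Proof.
  intros (C & DX & DY). split; [|split]; intros.
  - pose proof (C a b). cts.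
  - apply deriv_scal, DX.
  - apply deriv_scal, DY.
Qed.

Lemma smooth2_minus W V : smooth2 W -> smooth2 V -> smooth2 (fun a b x y => W a b x y - V a b x y).
Proof.
  intros (C & DX & DY) (C' & DX' & DY'). split; [|split]; intros.
  - pose proof (C a b). pose proof (C' a b). cts.
  - apply deriv_minus; [apply DX | apply DX'].
  - apply deriv_minus; [apply DY | apply DY'].
Qed.

Lemma periodic2_lap Lx Ly W : periodic2 Lx Ly W -> periodic2 Lx Ly (lap W).
Proof.
  intros P a b x y. unfold lap.
  destruct (P (S (S a)) b x y) as [-> ->]. destruct (P a (S (S b)) x y) as [-> ->]. auto.
Qed.

Lemma periodic2_shift i j Lx Ly W : periodic2 Lx Ly W -> periodic2 Lx Ly (shift i j W).
Proof. intros P a b x y. apply P. Qed.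

Lemma sobolev_sq_ext x0 Lx y0 Ly W V a b : (forall x y, W a b x y ^ 2 = V a b x y ^ 2) ->
  sobolev_sq x0 Lx y0 Ly W a b = sobolev_sq x0 Lx y0 Ly V a b.
Proof. intros E. apply integral_ext. intros x. apply integral_ext. intros y. apply E. Qed.

Section Elliptic.
Variables (x0 Lx y0 Ly : R).
Hypotheses (Lx0 : 0 < Lx) (Ly0 : 0 < Ly).

Notation Sn := (sobolev_sq x0 Lx y0 Ly).
Notation II f := (RInt (fun x => RInt (fun y => f x y) y0 (y0 + Ly)) x0 (x0 + Lx)).

Lemma iterated_RInt_lin a b f g : cont2 f -> cont2 g ->
  II (fun x y => a * f x y + b * g x y) = a * II f + b * II g.
Proof.
  intros Cf Cg.
  assert (F : cont (fun x : R => RInt (fun y => f x y) y0 (y0 + Ly))) by (apply (cont_RInt f); [lra | exact Cf]).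
  assert (G : cont (fun x : R => RInt (fun y => g x y) y0 (y0 + Ly))) by (apply (cont_RInt g); [lra | exact Cg]).
  rewrite <- !integral_scal by assumption. rewrite <- integral_plus by (apply cont_mult; [cts | assumption]).
  apply integral_ext. intros x. pose proof (cont2_r f x Cf). pose proof (cont2_r g x Cg).
  rewrite integral_plus, !integral_scal by cts. reflexivity.
Qed.

(** Integration by parts in [x] gives minus the product of [W 1 0] and [W 1 2], and one in [y]
    restores the sign; periodicity removes the boundary terms. *)
Lemma mixed_ibp W : smooth2 W -> periodic2 Lx Ly W ->
  II (fun x y => W 2%nat 0%nat x y * W 0%nat 2%nat x y) = II (fun x y => W 1%nat 1%nat x y ^ 2).
Proof.
  intros (C & DX & DY) P.
  pose proof (C 2%nat 0%nat). pose proof (C 0%nat 2%nat). pose proof (C 1%nat 0%nat).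
  pose proof (C 1%nat 2%nat). pose proof (C 1%nat 1%nat).
  assert (Z : cont2 (fun x y => W 1%nat 0%nat x y * W 1%nat 2%nat x y)) by cts.
  rewrite (fubini (fun x y => W 2%nat 0%nat x y * W 0%nat 2%nat x y)) by (lra || cts).
  transitivity (RInt (fun y => -1 * RInt (fun x => W 1%nat 0%nat x y * W 1%nat 2%nat x y) x0 (x0 + Lx)) y0 (y0 + Ly)).
  { apply integral_ext. intros y. etransitivity.
    - apply (ibp_periodic (fun x => W 1%nat 0%nat x y) (fun x => W 2%nat 0%nat x y)
        (fun x => W 0%nat 2%nat x y) (fun x => W 1%nat 2%nat x y)).
      + intros; apply DX.
      + intros; apply DX.
      + apply (cont2_l (W 2%nat 0%nat)), C.
      + apply (cont2_l (W 1%nat 2%nat)), C.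
      + apply P.
      + apply P.
    - rring. }
  rewrite integral_scal.
  2:{ apply (cont_RInt (fun y x => W 1%nat 0%nat x y * W 1%nat 2%nat x y)); [lra|].
      now apply (cont2_swap (fun x y => W 1%nat 0%nat x y * W 1%nat 2%nat x y)). }
  rewrite <- (fubini (fun x y => W 1%nat 0%nat x y * W 1%nat 2%nat x y)) by (lra || exact Z).
  rewrite <- integral_scal by (apply (cont_RInt (fun x y => W 1%nat 0%nat x y * W 1%nat 2%nat x y)); [lra | exact Z]).
  apply integral_ext. intros x.
  assert (E : RInt (fun y => W 1%nat 1%nat x y * W 1%nat 1%nat x y) y0 (y0 + Ly)
     = - RInt (fun y => W 1%nat 0%nat x y * W 1%nat 2%nat x y) y0 (y0 + Ly)).
  { apply (ibp_periodic (fun y => W 1%nat 0%nat x y) (fun y => W 1%nat 1%nat x y)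
        (fun y => W 1%nat 1%nat x y) (fun y => W 1%nat 2%nat x y)).
    + intros; apply DY.
    + intros; apply DY.
    + apply (cont2_r (W 1%nat 1%nat)), C.
    + apply (cont2_r (W 1%nat 2%nat)), C.
    + apply P.
    + apply P. }
  rewrite (integral_ext (fun y => W 1%nat 1%nat x y ^ 2) (fun y => W 1%nat 1%nat x y * W 1%nat 1%nat x y)) by (intros; ring).
  rewrite E. rring.
Qed.

Lemma lap_norm W : smooth2 W -> periodic2 Lx Ly W ->
  Sn (lap W) 0 0 = Sn W 2 0 + Sn W 0 2 + 2 * Sn W 1 1.
Proof.
  intros SW P. pose proof (proj1 SW) as C.
  pose proof (C 2%nat 0%nat). pose proof (C 0%nat 2%nat). pose proof (C 1%nat 1%nat).
  unfold sobolev_sq at 4. rewrite <- mixed_ibp by assumption. unfold sobolev_sq, lap.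
  transitivity (II (fun x y => 1 * (1 * W 2%nat 0%nat x y ^ 2 + 1 * W 0%nat 2%nat x y ^ 2)
     + 2 * (W 2%nat 0%nat x y * W 0%nat 2%nat x y))).
  - apply integral_ext. intros x. apply integral_ext. intros y. ring.
  - rewrite (iterated_RInt_lin 1 2 (fun x y => 1 * W 2%nat 0%nat x y ^ 2 + 1 * W 0%nat 2%nat x y ^ 2)
       (fun x y => W 2%nat 0%nat x y * W 0%nat 2%nat x y)) by cts.
    rewrite (iterated_RInt_lin 1 1 (fun x y => W 2%nat 0%nat x y ^ 2) (fun x y => W 0%nat 2%nat x y ^ 2)) by cts.
    rring.
Qed.

(** In [lap_norm] the three squares enter with positive signs, so each second derivative is
    controlled by the Laplacian with constant 1. *)
Lemma lap_bound W a b : smooth2 W -> periodic2 Lx Ly W ->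
  Sn W (S (S a)) b <= Sn (lap W) a b /\ Sn W a (S (S b)) <= Sn (lap W) a b /\
  Sn W (S a) (S b) <= Sn (lap W) a b.
Proof.
  intros SW P.
  pose proof (lap_norm (shift a b W) (smooth2_shift a b W SW) (periodic2_shift a b _ _ W P)) as E.
  change (Sn (lap (shift a b W)) 0 0) with (Sn (lap W) a b) in E.
  change (Sn (shift a b W) 2 0) with (Sn W (S (S a)) b) in E.
  change (Sn (shift a b W) 0 2) with (Sn W a (S (S b))) in E.
  change (Sn (shift a b W) 1 1) with (Sn W (S a) (S b)) in E.
  assert (0 <= Sn W (S (S a)) b) by (apply sobolev_sq_ge0; lra || assumption).
  assert (0 <= Sn W a (S (S b))) by (apply sobolev_sq_ge0; lra || assumption).
  assert (0 <= Sn W (S a) (S b)) by (apply sobolev_sq_ge0; lra || assumption).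
  lra.
Qed.

(** The x derivative on the left guarantees a zero on every line, which [W a b] itself need not
    have. *)
Lemma poincare_x W a b : smooth2 W -> periodic2 Lx Ly W ->
  Sn W (S a) b <= Lx ^ 2 * Sn W (S (S a)) b.
Proof.
  intros SW P. pose proof (proj1 SW (S a) b) as C1. pose proof (proj1 SW (S (S a)) b) as C2.
  assert (Q1 : cont2 (fun x y => W (S a) b x y ^ 2)) by cts.
  assert (Q2 : cont2 (fun x y => W (S (S a)) b x y ^ 2)) by cts.
  unfold sobolev_sq. rewrite (fubini (fun x y => W (S a) b x y ^ 2)) by (lra || exact Q1).
  rewrite (fubini (fun x y => W (S (S a)) b x y ^ 2)) by (lra || exact Q2).
  assert (R1 : cont (fun y : R => RInt (fun x => W (S a) b x y ^ 2) x0 (x0 + Lx))).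
  { apply (cont_RInt (fun y x => W (S a) b x y ^ 2)); [lra | now apply (cont2_swap (fun x y => W (S a) b x y ^ 2))]. }
  assert (R2 : cont (fun y : R => RInt (fun x => W (S (S a)) b x y ^ 2) x0 (x0 + Lx))).
  { apply (cont_RInt (fun y x => W (S (S a)) b x y ^ 2)); [lra | now apply (cont2_swap (fun x y => W (S (S a)) b x y ^ 2))]. }
  rewrite <- integral_scal by exact R2.
  apply integral_le; [exact R1 | apply cont_mult; [cts | exact R2] | lra |]. intros y _.
  apply (poincare_1d (fun n x => W (n + a)%nat b x y)); [| | exact Lx0].
  - intros n x. apply SW.
  - intros n x. apply P.
Qed.
End Elliptic.

Lemma poincare_y x0 Lx y0 Ly W a b : 0 < Lx -> 0 < Ly -> smooth2 W -> periodic2 Lx Ly W ->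
  sobolev_sq x0 Lx y0 Ly W a (S b) <= Ly ^ 2 * sobolev_sq x0 Lx y0 Ly W a (S (S b)).
Proof.
  intros Lx0 Ly0 SW P.
  rewrite <- (sobolev_sq_tr x0 Lx y0 Ly W a (S b)), <- (sobolev_sq_tr x0 Lx y0 Ly W a (S (S b))) by (lra || assumption).
  apply poincare_x; [exact Ly0 | exact Lx0 | now apply smooth2_transpose | now apply periodic2_tr].
Qed.

(** * One time step *)

Lemma Rabs_convex th a b c : 0 <= th <= 1 -> Rabs a <= c -> Rabs b <= c ->
  Rabs ((1 - th) * a + th * b) <= c.
Proof.
  intros Ht Ha Hb. apply Rabs_le_between in Ha. apply Rabs_le_between in Hb.
  apply Rabs_le_between. split; nra.
Qed.

Lemma in_Qh_bcomb N M k a b v w : in_Qh N M k v -> in_Qh N M k w -> in_Qh N M k (bcomb a v b w).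
Proof.
  intros V W i j Hi Hj. apply is_Qk_plus; apply is_Qk_scal; auto.
Qed.

Section Step.
Variables (m : nat) (p : nat -> R -> R).
Hypothesis Bp : onb m p.
Variables (Om : rectangle) (N M : nat).
Hypotheses (N1 : (1 <= N)%nat) (M1 : (1 <= M)%nat).

Notation ip := (inner Om N M).
Notation A := (bilinA Om N M).
Notation nr := (bnorm Om N M).
Notation Qh := (in_Qh N M (S m)).
Notation e W := (proj_error m p Om N M W).
Notation "'cell0' W" := (on_cells (W 0%nat 0%nat)) (at level 10).

Definition disc_err (W : nat -> nat -> R -> R -> R) (vh : broken) : broken :=
  bcomb 1 (proj_mesh m p Om N M W) (-1) vh.

Lemma disc_err_Qh W vh : smooth2 W -> Qh vh -> Qh (disc_err W vh).
Proof. intros SW Q. apply in_Qh_bcomb; [now apply proj_mesh_Qh | exact Q]. Qed.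

Lemma ip_disc_err W vh phi : smooth2 W -> Qh vh -> Qh phi ->
  ip (disc_err W vh) phi = ip (cell0 W) phi - ip (e W) phi - ip vh phi.
Proof.
  intros SW Qv Qp.
  pose proof (proj1 (broken_C1_Qh N M _ _ (proj_mesh_Qh m p Bp Om N M W SW))) as C1.
  pose proof (proj1 (broken_C1_Qh N M _ _ Qv)) as C2. pose proof (proj1 (broken_C1_Qh N M _ _ Qp)) as C3.
  pose proof (proj1 (proj1 (broken_C1_smooth N M W SW))) as C4.
  unfold disc_err, proj_error. rewrite !inner_lin by assumption. ring.
Qed.

Lemma A_disc_err W vh phi : smooth2 W -> Qh vh -> Qh phi ->
  A (disc_err W vh) phi = A (cell0 W) phi - A (e W) phi - A vh phi.
Proof.
  intros SW Qv Qp.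
  pose proof (broken_C1_Qh N M _ _ (proj_mesh_Qh m p Bp Om N M W SW)) as C1.
  pose proof (broken_C1_Qh N M _ _ Qv) as C2. pose proof (broken_C1_Qh N M _ _ Qp) as C3.
  pose proof (proj1 (broken_C1_smooth N M W SW)) as C4.
  unfold disc_err, proj_error. rewrite !bilinA_lin by assumption. ring.
Qed.

(** The square [z ^ 2] absorbs [d * z] at the cost of [d ^ 2 / 4]. Dividing by [a'] then takes
    [a' > d], whence the maximum. The increment is proportional to [dt] and [a] keeps the
    coefficient 1, so that the error grows linearly in time rather than exponentially. *)
Lemma step_growth th dt d a a' x0 x1 c z : 1 / 2 <= th <= 1 -> 0 < dt -> 0 <= d -> 0 <= a -> 0 <= a' ->
  x0 = a ^ 2 -> x1 = a' ^ 2 -> 2 * c <= x0 + x1 ->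
  (((1 - th) * c + th * x1) - ((1 - th) * x0 + th * c)) / dt + z ^ 2
    <= d * ((1 - th) * a + th * a') + d * z ->
  a' <= Rmax d (a + 5 / 2 * dt * d).
Proof.
  intros Ht dt0 d0 Ha Ha' -> -> Hc H.
  set (L := ((1 - th) * c + th * a' ^ 2) - ((1 - th) * a ^ 2 + th * c)) in *.
  (* Here [theta >= 1 / 2] enters: [c] has the coefficient [1 - 2 * th <= 0], so it may be replaced
     by half the sum of the squares. *)
  assert (HL : (a' ^ 2 - a ^ 2) / 2 <= L) by (unfold L; nra).
  assert (HZ : d * z - z ^ 2 <= d ^ 2 / 4) by (pose proof (pow2_ge_0 (z - d / 2)); lra).
  assert (HL2 : L <= dt * (d * ((1 - th) * a + th * a') + d ^ 2 / 4)).
  { apply Rmult_le_reg_r with (/ dt); [now apply Rinv_0_lt_compat|].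
    replace (dt * (d * ((1 - th) * a + th * a') + d ^ 2 / 4) * / dt)
      with (d * ((1 - th) * a + th * a') + d ^ 2 / 4) by (field; lra).
    unfold Rdiv in H. lra. }
  destruct (Rle_dec a' d) as [l|l]; [apply Rle_trans with (1 := l), Rmax_l|].
  apply Rle_trans with (a + 5 / 2 * dt * d); [|apply Rmax_r].
  apply Rnot_le_lt in l.
  destruct (Rle_dec a' a) as [l'|l'].
  - assert (0 <= dt * d) by (apply Rmult_le_pos; lra). lra.
  - apply Rnot_le_lt in l'.
    assert (H1 : (1 - th) * a + th * a' <= a') by nra.
    assert (H2 : d * ((1 - th) * a + th * a') <= d * a') by (apply Rmult_le_compat_l; lra).
    (* Beyond [d] the square is at most [d * a' / 4]; with [d * a'] this makes the factor 5/4, and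
       the halved left side doubles it to 5/2. *)
    assert (H3 : d ^ 2 / 4 <= d * a' / 4) by nra.
    assert (H4 : L <= dt * (5 / 4 * (d * a'))).
    { apply Rle_trans with (1 := HL2). apply Rmult_le_compat_l; lra. }
    assert (H5 : a' * (a' - a) <= a' ^ 2 - a ^ 2) by nra.
    assert (a' - a <= 5 / 2 * dt * d); [|lra].
    apply Rmult_le_reg_l with a'; [lra|]. lra.
Qed.

Variables (th dt d : R) (W0 W1 Q0 Q1 V0 V1 : nat -> nat -> R -> R -> R) (uh0 uh1 qh0 qh1 : broken).
Hypotheses (Hth : 1 / 2 <= th <= 1) (dt0 : 0 < dt) (d0 : 0 <= d)
  (SW0 : smooth2 W0) (SW1 : smooth2 W1) (SQ0 : smooth2 Q0) (SQ1 : smooth2 Q1)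
  (Qu0 : Qh uh0) (Qu1 : Qh uh1) (Qq0 : Qh qh0) (Qq1 : Qh qh1)
  (scheme : forall phi, Qh phi ->
     ip (bcomb (/ dt) uh1 (- / dt) uh0) phi = - A (bcomb (1 - th) qh0 th qh1) phi)
  (aux0 : forall psi, Qh psi -> ip qh0 psi = A uh0 psi)
  (aux1 : forall psi, Qh psi -> ip qh1 psi = A uh1 psi)
  (exW0 : forall psi, Qh psi -> A (cell0 W0) psi = ip (cell0 Q0) psi)
  (exW1 : forall psi, Qh psi -> A (cell0 W1) psi = ip (cell0 Q1) psi)
  (exQ0 : forall psi, Qh psi -> A (cell0 Q0) psi = - ip (cell0 V0) psi)
  (exQ1 : forall psi, Qh psi -> A (cell0 Q1) psi = - ip (cell0 V1) psi)
  (bW0 : forall v, Qh v -> Rabs (A (e W0) v) <= d * nr v)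
  (bW1 : forall v, Qh v -> Rabs (A (e W1) v) <= d * nr v)
  (bQ0 : forall v, Qh v -> Rabs (A (e Q0) v) <= d * nr v)
  (bQ1 : forall v, Qh v -> Rabs (A (e Q1) v) <= d * nr v)
  (lQ0 : forall v, Qh v -> Rabs (ip (e Q0) v) <= d * nr v)
  (lQ1 : forall v, Qh v -> Rabs (ip (e Q1) v) <= d * nr v)
  (lW : forall v, Qh v -> Rabs ((ip (e W1) v - ip (e W0) v) / dt) <= d * nr v)
  (tau : forall v, Qh v -> Rabs ((ip (cell0 W1) v - ip (cell0 W0) v) / dt
     - ((1 - th) * ip (cell0 V0) v + th * ip (cell0 V1) v)) <= d * nr v).

(** [W], [Q] and [V] stand for u, q and u_t at the two ends of the step. The error identity has
    three terms tested with [phi] and two with [psi], each at most [d] times the norm of its test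
    function; [3 * d] covers both groups. *)
Lemma energy_step :
  nr (disc_err W1 uh1) <= Rmax (3 * d) (nr (disc_err W0 uh0) + 5 / 2 * dt * (3 * d)).
Proof.
  set (x0 := disc_err W0 uh0). set (x1 := disc_err W1 uh1).
  set (z0 := disc_err Q0 qh0). set (z1 := disc_err Q1 qh1).
  set (phi := bcomb (1 - th) x0 th x1). set (psi := bcomb (1 - th) z0 th z1).
  assert (Qx0 : Qh x0) by now apply disc_err_Qh. assert (Qx1 : Qh x1) by now apply disc_err_Qh.
  assert (Qz0 : Qh z0) by now apply disc_err_Qh. assert (Qz1 : Qh z1) by now apply disc_err_Qh.
  assert (Qphi : Qh phi) by now apply in_Qh_bcomb. assert (Qpsi : Qh psi) by now apply in_Qh_bcomb.
  pose proof (fun v Q => proj1 (broken_C1_Qh N M (S m) v Q)) as BC.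
  pose proof (broken_C1_Qh N M (S m)) as BR.
  assert (I0 := ip_disc_err W0 uh0 phi SW0 Qu0 Qphi). assert (I1 := ip_disc_err W1 uh1 phi SW1 Qu1 Qphi).
  assert (J0 := ip_disc_err Q0 qh0 psi SQ0 Qq0 Qpsi). assert (J1 := ip_disc_err Q1 qh1 psi SQ1 Qq1 Qpsi).
  assert (K0 := A_disc_err Q0 qh0 phi SQ0 Qq0 Qphi). assert (K1 := A_disc_err Q1 qh1 phi SQ1 Qq1 Qphi).
  assert (L0 := A_disc_err W0 uh0 psi SW0 Qu0 Qpsi). assert (L1 := A_disc_err W1 uh1 psi SW1 Qu1 Qpsi).
  fold x0 in I0, L0. fold x1 in I1, L1. fold z0 in J0, K0. fold z1 in J1, K1.
  rewrite (exQ0 phi Qphi) in K0. rewrite (exQ1 phi Qphi) in K1.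
  rewrite (exW0 psi Qpsi) in L0. rewrite (exW1 psi Qpsi) in L1.
  rewrite (aux0 psi Qpsi) in J0. rewrite (aux1 psi Qpsi) in J1.
  assert (Sc := scheme phi Qphi). rewrite inner_lin, bilinA_lin in Sc by auto.
  (* The auxiliary equation holds at both levels and can be averaged with the weights of the scheme;
     symmetry then identifies the two occurrences of the form. *)
  assert (Sym : (1 - th) * A z0 phi + th * A z1 phi = (1 - th) * A x0 psi + th * A x1 psi).
  { rewrite <- (bilinA_lin Om N M N1 M1 (1 - th) th z0 z1 phi), <- (bilinA_lin Om N M N1 M1 (1 - th) th x0 x1 psi) by auto.
    apply bilinA_sym; assumption. }
  assert (Pz : ip psi psi = (1 - th) * ip z0 psi + th * ip z1 psi)
    by (apply inner_lin; auto).
  assert (Px0 : ip x0 phi = (1 - th) * ip x0 x0 + th * ip x0 x1).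
  { rewrite inner_sym. unfold phi. rewrite inner_lin by auto. now rewrite (inner_sym Om N M x1 x0). }
  assert (Px1 : ip x1 phi = (1 - th) * ip x0 x1 + th * ip x1 x1).
  { rewrite inner_sym. unfold phi. rewrite inner_lin by auto. reflexivity. }
  assert (Id : (ip x1 phi - ip x0 phi) / dt + ip psi psi =
     ((ip (cell0 W1) phi - ip (cell0 W0) phi) / dt - ((1 - th) * ip (cell0 V0) phi + th * ip (cell0 V1) phi))
     - (ip (e W1) phi - ip (e W0) phi) / dt
     - ((1 - th) * A (e Q0) phi + th * A (e Q1) phi)
     - ((1 - th) * ip (e Q0) psi + th * ip (e Q1) psi)
     + ((1 - th) * A (e W0) psi + th * A (e W1) psi)).
  { rewrite Pz, J0, J1, I0, I1.
    assert (E0 : A qh0 phi = - ip (cell0 V0) phi - A (e Q0) phi - A z0 phi) by lra.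
    assert (E1 : A qh1 phi = - ip (cell0 V1) phi - A (e Q1) phi - A z1 phi) by lra.
    assert (F0 : A uh0 psi = ip (cell0 Q0) psi - A (e W0) psi - A x0 psi) by lra.
    assert (F1 : A uh1 psi = ip (cell0 Q1) psi - A (e W1) psi - A x1 psi) by lra.
    rewrite F0, F1. rewrite E0, E1 in Sc.
    assert (Sc' : (ip uh1 phi - ip uh0 phi) / dt
       = (1 - th) * (ip (cell0 V0) phi + A (e Q0) phi) + th * (ip (cell0 V1) phi + A (e Q1) phi)
         + ((1 - th) * A x0 psi + th * A x1 psi)).
    { rewrite <- Sym. unfold Rdiv. lra. }
    transitivity ((ip (cell0 W1) phi - ip (cell0 W0) phi) / dt - (ip (e W1) phi - ip (e W0) phi) / dt
      - (ip uh1 phi - ip uh0 phi) / dt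
      + ((1 - th) * (ip (cell0 Q0) psi - ip (e Q0) psi - (ip (cell0 Q0) psi - A (e W0) psi - A x0 psi)) +
       th * (ip (cell0 Q1) psi - ip (e Q1) psi - (ip (cell0 Q1) psi - A (e W1) psi - A x1 psi)))).
    - field. lra.
    - rewrite Sc'. ring. }
  assert (T1 := tau phi Qphi). assert (T2 := lW phi Qphi).
  assert (th01 : 0 <= th <= 1) by lra.
  assert (T3 := Rabs_convex th _ _ _ th01 (bQ0 phi Qphi) (bQ1 phi Qphi)).
  assert (T4 := Rabs_convex th _ _ _ th01 (lQ0 psi Qpsi) (lQ1 psi Qpsi)).
  assert (T5 := Rabs_convex th _ _ _ th01 (bW0 psi Qpsi) (bW1 psi Qpsi)).
  apply Rabs_le_between in T1, T2, T3, T4, T5.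
  assert (nphi : nr phi <= (1 - th) * nr x0 + th * nr x1).
  { eapply Rle_trans; [apply bnorm_bcomb; auto|]. rewrite !Rabs_pos_eq by lra. lra. }
  assert (P0 := bnorm_ge0 Om N M x0). assert (P1 := bnorm_ge0 Om N M x1).
  assert (P2 := bnorm_ge0 Om N M psi). assert (P3 := bnorm_ge0 Om N M phi).
  apply (step_growth th dt (3 * d) (nr x0) (nr x1) (ip x0 x0) (ip x1 x1) (ip x0 x1) (nr psi)); try assumption.
  - lra.
  - rewrite bnorm_sq; auto.
  - rewrite bnorm_sq; auto.
  - pose proof (inner_quad_ge0 Om N M N1 M1 x0 x1 (BC _ Qx0) (BC _ Qx1) (-1)) as H. lra.
  - rewrite <- Px1, <- Px0, bnorm_sq by auto. rewrite Id.
    assert (d * nr phi <= d * ((1 - th) * nr x0 + th * nr x1)) by (apply Rmult_le_compat_l; assumption).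
    assert (0 <= d * nr psi) by now apply Rmult_le_pos.
    lra.
Qed.
End Step.

(** * Space-time functions *)

(** A family of derivatives is determined by its first member, so identities between functions, such
    as the equation or periodicity, pass to all derivatives. *)
Lemma smooth2_eq_all W V : smooth2 W -> smooth2 V ->
  (forall x y, W 0%nat 0%nat x y = V 0%nat 0%nat x y) -> forall a b x y, W a b x y = V a b x y.
Proof.
  intros (_ & DX & DY) (_ & DX' & DY') E a b.
  assert (Ea : forall x y, W a 0%nat x y = V a 0%nat x y).
  { induction a as [|a IH]; [exact E|]. intros x y.
    rewrite <- (is_derive_unique _ _ _ (DX a 0%nat x y)), <- (is_derive_unique _ _ _ (DX' a 0%nat x y)).
    apply Derive_ext. intros; apply IH. }
  induction b as [|b IH]; [exact Ea|]. intros x y.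
  rewrite <- (is_derive_unique _ _ _ (DY a b x y)), <- (is_derive_unique _ _ _ (DY' a b x y)).
  apply Derive_ext. intros; apply IH.
Qed.

Lemma smooth2_translate W c d : smooth2 W -> smooth2 (fun a b x y => W a b (x + c) (y + d)).
Proof.
  intros (C & DX & DY). split; [|split]; intros.
  - pose proof (C a b). cts.
  - apply is_derive_ext with (fun s => W a b (c + 1 * s) (y + d)); [intros; f_equal; ring|].
    apply (deriv_val _ _ (1 * W (S a) b (x + c) (y + d))); [|ring].
    apply (deriv_affine (fun x => W a b x (y + d))). replace (c + 1 * x) with (x + c) by ring. apply DX.
  - apply is_derive_ext with (fun s => W a b (x + c) (d + 1 * s)); [intros; f_equal; ring|].
    apply (deriv_val _ _ (1 * W a (S b) (x + c) (y + d))); [|ring].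
    apply (deriv_affine (fun y => W a b (x + c) y)). replace (d + 1 * y) with (y + d) by ring. apply DY.
Qed.

Lemma periodic2_of_base Lx Ly W : smooth2 W ->
  (forall x y, W 0%nat 0%nat (x + Lx) y = W 0%nat 0%nat x y /\ W 0%nat 0%nat x (y + Ly) = W 0%nat 0%nat x y) ->
  periodic2 Lx Ly W.
Proof.
  intros SW P a b x y. split.
  - rewrite <- (Rplus_0_r y) at 1.
    apply (smooth2_eq_all (fun a b x y => W a b (x + Lx) (y + 0)) W (smooth2_translate W Lx 0 SW) SW).
    intros x' y'. rewrite Rplus_0_r. apply P.
  - rewrite <- (Rplus_0_r x) at 1.
    apply (smooth2_eq_all (fun a b x y => W a b (x + 0) (y + Ly)) W (smooth2_translate W 0 Ly SW) SW).
    intros x' y'. rewrite Rplus_0_r. apply P.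
Qed.

Lemma partial_eq W f a b x y : smooth2 W -> (forall x y, f x y = W 0%nat 0%nat x y) ->
  partial a b f x y = W a b x y.
Proof.
  intros (_ & DX & DY) E. unfold partial.
  assert (err_y : forall b x y, Derive_n (fun y' => f x y') b y = W 0%nat b x y).
  { intros b'. induction b' as [|b' IH]; intros x' y'; simpl; [apply E|].
    rewrite <- (is_derive_unique _ _ _ (DY 0%nat b' x' y')). apply Derive_ext. intros; apply IH. }
  revert x. induction a as [|a IH]; intros x; simpl; [apply err_y|].
  rewrite <- (is_derive_unique _ _ _ (DX a b x y)). apply Derive_ext. intros; apply IH.
Qed.

Lemma laplacian_eq W f x y : smooth2 W -> (forall x y, f x y = W 0%nat 0%nat x y) ->
  laplacian f x y = lap W 0%nat 0%nat x y.
Proof. intros SW E. unfold laplacian, lap. now rewrite !(partial_eq W f) by assumption. Qed.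

(** The equation is assumed at positive times; this carries it to the initial time. *)
Lemma eq_at_0 (f g : R -> R) : cont f -> cont g -> (forall t, 0 < t -> f t = g t) -> f 0 = g 0.
Proof.
  intros F G E. apply Rminus_diag_uniq.
  set (d := fun t => f t - g t). assert (C : cont d) by (unfold d; cts). change (d 0 = 0).
  destruct (Req_dec (d 0) 0) as [|nz]; [assumption | exfalso].
  assert (e0 : 0 < Rabs (d 0)) by now apply Rabs_pos_lt.
  destruct (proj1 (filterlim_locally _ _) (C 0) (mkposreal _ e0)) as [r Hr].
  assert (B : ball 0 r (r / 2)).
  { change (Rabs (r / 2 - 0) < r). destruct r as [r r0]; simpl.
    rewrite Rminus_0_r, Rabs_pos_eq; lra. }
  specialize (Hr _ B). change (Rabs (d (r / 2) - d 0) < Rabs (d 0)) in Hr.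
  replace (d (r / 2)) with 0 in Hr.
  - rewrite Rminus_0_l, Rabs_Ropp in Hr. lra.
  - unfold d. rewrite E; [ring|]. destruct r; simpl; lra.
Qed.

Lemma deriv_sumr N (f : nat -> R -> R) (d : nat -> R) x :
  (forall i, (1 <= i <= N)%nat -> is_derive (f i) x (d i)) ->
  is_derive (fun x => sumr N (fun i => f i x)) x (sumr N d).
Proof.
  intros H. induction N as [|N IH].
  - rewrite sumr0. apply is_derive_ext with (fun _ => 0); [intros; symmetry; apply sumr0 | apply deriv_const].
  - rewrite sumrS. apply is_derive_ext with (fun x => sumr N (fun i => f i x) + f (S N) x).
    + intros; symmetry; apply sumrS.
    + apply deriv_plus; [apply IH; intros; apply H; lia | apply H; lia].
Qed.

Section Time.
Variables (Om : rectangle) (u : R -> R -> R -> R) (D : nat -> nat -> nat -> R -> R -> R -> R).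
Hypotheses (SD : smooth_with_derivatives u D) (Per : periodic_in_space Om u)
  (PDE : forall t x y, 0 < t -> Derive (fun s => u s x y) t = - laplacian (laplacian (u t)) x y).

(* Constant extension to negative times, to have functions continuous on the whole line. *)
Definition slice (l : nat) (t : R) : nat -> nat -> R -> R -> R := fun a b => D l a b (Rmax 0 t).

Lemma slice_pos l t : 0 <= t -> slice l t = fun a b => D l a b t.
Proof. intros H. unfold slice. now rewrite Rmax_right. Qed.

Lemma slice_cont l a b : cont (fun q : R * R * R => slice l (fst (fst q)) a b (snd (fst q)) (snd q)).
Proof.
  destruct SD as (_ & C & _). intros q. unfold slice.
  set (g := fun q : R * R * R => ((Rmax 0 (fst (fst q)), snd (fst q)), snd q)).
  assert (Cm : cont (fun t : R => Rmax 0 t)).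
  { apply cont_ext with (fun t : R => (0 + t + Rabs (0 - t)) * / 2).
    - intros t. unfold Rmax, Rabs. destruct (Rle_dec 0 t); destruct (Rcase_abs (0 - t)); lra.
    - assert (cont (fun t : R => Rabs t)) by (intros t; apply continuity_pt_filterlim, Rcontinuity_abs). cts. }
  assert (Cg : continuous g q).
  { unfold g. apply (continuous_comp_2 (fun q : R * R * R => (Rmax 0 (fst (fst q)), snd (fst q)))
       (fun q => snd q) (fun a b => (a, b))).
    - apply (continuous_comp_2 (fun q : R * R * R => Rmax 0 (fst (fst q)))
       (fun q => snd (fst q)) (fun a b => (a, b))).
      + apply (cont_comp1 (fun t : R => Rmax 0 t) (fun q : R * R * R => fst (fst q))); [exact Cm | cts].
      + apply (cont_proj1 (fun p : R * R => snd p)). cts.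
      + apply continuous_ext with (fun z : R * R => z); [now intros [] | apply continuous_id].
    - apply cont_snd.
    - apply continuous_ext with (fun z : (R * R) * R => z); [now intros [] | apply continuous_id]. }
  specialize (C l a b (g q)). simpl in C. specialize (C (Rmax_l _ _)).
  intros P HP. specialize (C P HP). unfold filtermap, within in C.
  specialize (Cg _ C). unfold filtermap in *. revert Cg. apply filter_imp.
  intros z Hz. apply Hz. apply Rmax_l.
Qed.

Lemma slice_cfu {U : UniformSpace} l a b (f g h : U -> R) : cont f -> cont g -> cont h ->
  cont (fun z => slice l (f z) a b (g z) (h z)).
Proof.
  intros F G H.
  apply (cont_pair (fun q : (R * R) * R => slice l (fst (fst q)) a b (snd (fst q)) (snd q))
    (fun z => (f z, g z)) h); [apply slice_cont | | exact H].
  intros z. apply (continuous_comp_2 f g (fun a b => (a, b))); [apply F | apply G |].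
  apply continuous_ext with (fun z : R * R => z); [now intros [] | apply continuous_id].
Qed.

Lemma slice_smooth l t : smooth2 (slice l t).
Proof.
  destruct SD as (_ & _ & _ & DX & DY). split; [|split]; intros.
  - apply (slice_cfu l a b (fun _ : R * R => t) (fun q => fst q) (fun q => snd q)); cts.
  - apply DX, Rmax_l.
  - apply DY, Rmax_l.
Qed.

Lemma slice_derive l a b t x y : 0 < t -> is_derive (fun s => slice l s a b x y) t (slice (S l) t a b x y).
Proof.
  intros Ht. destruct SD as (_ & _ & DT & _).
  rewrite (slice_pos (S l)) by lra.
  apply is_derive_ext_loc with (fun s => D l a b s x y); [|now apply DT].
  apply (locally_interval _ t 0 p_infty); simpl; [lra | exact I |].
  intros s s0 _. rewrite slice_pos by lra. reflexivity.
Qed.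

Lemma slice_u t x y : 0 <= t -> slice 0 t 0%nat 0%nat x y = u t x y.
Proof. intros Ht. rewrite slice_pos by exact Ht. now apply SD. Qed.

Lemma slice_clamp l t : slice l t = slice l (Rmax 0 t).
Proof.
  unfold slice. rewrite (Rmax_right 0 (Rmax 0 t)) by apply Rmax_l. reflexivity.
Qed.

(** Both sides are constant in [t] at negative times, so the initial time is the only case not given
    by the equation; there continuity decides. *)
Lemma slice_pde_0 t x y : slice 1 t 0%nat 0%nat x y = - lap (lap (slice 0 t)) 0%nat 0%nat x y.
Proof.
  assert (P : forall t, 0 < t -> slice 1 t 0%nat 0%nat x y = - lap (lap (slice 0 t)) 0%nat 0%nat x y).
  { clear t. intros t Ht.
    rewrite <- (is_derive_unique _ _ _ (slice_derive 0 0 0 t x y Ht)).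
    rewrite (Derive_ext_loc _ (fun s => u s x y)).
    - rewrite PDE by exact Ht. f_equal.
      apply (laplacian_eq (lap (slice 0 t))); [apply smooth2_lap, slice_smooth|].
      intros x' y'. apply laplacian_eq; [apply slice_smooth|]. intros; symmetry; apply slice_u; lra.
    - apply (locally_interval _ t 0 p_infty); simpl; [lra | exact I |].
      intros s s0 _. apply slice_u. lra. }
  rewrite (slice_clamp 0 t), (slice_clamp 1 t).
  destruct (Rle_lt_or_eq_dec 0 (Rmax 0 t) (Rmax_l 0 t)) as [lt|<-]; [now apply P|].
  apply (eq_at_0 (fun t => slice 1 t 0%nat 0%nat x y) (fun t => - lap (lap (slice 0 t)) 0%nat 0%nat x y));
    [apply slice_cfu; cts | | exact P].
  unfold lap. apply cont_opp, cont_plus; apply cont_plus; apply slice_cfu; cts.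
Qed.

Lemma slice_pde t a b x y : slice 1 t a b x y = - lap (lap (slice 0 t)) a b x y.
Proof.
  pose proof (smooth2_scal (-1) _ (smooth2_lap _ (smooth2_lap _ (slice_smooth 0 t)))) as S1.
  rewrite (smooth2_eq_all _ _ (slice_smooth 1 t) S1); [ring|].
  intros x' y'. rewrite slice_pde_0. ring.
Qed.

(** The time derivative of the equation. Through it the norm of u_tt controls fourth-order
    derivatives of u_t. *)
Lemma slice_pde2 t a b x y : slice 2 t a b x y = - lap (lap (slice 1 t)) a b x y.
Proof.
  assert (P : forall t x y, 0 < t -> slice 2 t 0%nat 0%nat x y = - lap (lap (slice 1 t)) 0%nat 0%nat x y).
  { clear t a b x y. intros t x y Ht.
    rewrite <- (is_derive_unique _ _ _ (slice_derive 1 0 0 t x y Ht)).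
    apply is_derive_unique.
    apply is_derive_ext with (fun t => - lap (lap (slice 0 t)) 0%nat 0%nat x y); [intros; symmetry; apply slice_pde_0|].
    unfold lap. apply deriv_opp, deriv_plus; apply deriv_plus; now apply slice_derive. }
  assert (P0 : forall x y, slice 2 t 0%nat 0%nat x y = - lap (lap (slice 1 t)) 0%nat 0%nat x y).
  { intros x' y'. rewrite (slice_clamp 1 t), (slice_clamp 2 t).
    destruct (Rle_lt_or_eq_dec 0 (Rmax 0 t) (Rmax_l 0 t)) as [lt|<-]; [now apply P|].
    apply (eq_at_0 (fun t => slice 2 t 0%nat 0%nat x' y') (fun t => - lap (lap (slice 1 t)) 0%nat 0%nat x' y'));
      [apply slice_cfu; cts | | intros; now apply P].
    unfold lap. apply cont_opp, cont_plus; apply cont_plus; apply slice_cfu; cts. }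
  pose proof (smooth2_scal (-1) _ (smooth2_lap _ (smooth2_lap _ (slice_smooth 1 t)))) as S1.
  rewrite (smooth2_eq_all _ _ (slice_smooth 2 t) S1); [ring|].
  intros x' y'. rewrite P0. ring.
Qed.

Notation Lx := (bx Om - ax Om).
Notation Ly := (by_ Om - ay Om).
Notation Sn := (sobolev_sq (ax Om) Lx (ay Om) Ly).

Lemma slice0_periodic t : periodic2 Lx Ly (slice 0 t).
Proof.
  apply periodic2_of_base; [apply slice_smooth|]. intros x y.
  rewrite (slice_clamp 0 t), !slice_u by apply Rmax_l. apply Per, Rmax_l.
Qed.

(** Periodicity is assumed for [u]; for its time derivative it is read off from the equation. *)
Lemma slice1_periodic t : periodic2 Lx Ly (slice 1 t).
Proof.
  intros a b x y. rewrite !slice_pde.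
  destruct (periodic2_lap _ _ _ (periodic2_lap _ _ _ (slice0_periodic t)) a b x y) as [-> ->]. auto.
Qed.

Lemma Lx_pos : 0 < Lx. Proof. pose proof (ax_lt_bx Om); lra. Qed.
Lemma Ly_pos : 0 < Ly. Proof. pose proof (ay_lt_by Om); lra. Qed.

(** * Pairings with fixed functions, suprema in time and time averages *)

Definition pairing (xl xr yl yr : R) (l a b : nat) (psi : R -> R -> R) (t : R) : R :=
  RInt (fun x => RInt (fun y => slice l t a b x y * psi x y) yl yr) xl xr.

Section Pairing.
Variables (xl xr yl yr : R) (a b : nat) (psi : R -> R -> R).
Hypotheses (H1 : xl <= xr) (H2 : yl <= yr) (Cpsi : cont2 psi).

Let inner_cont l : cont2 (fun t x => RInt (fun y => slice l t a b x y * psi x y) yl yr).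
Proof.
  apply (cont_RInt (fun (q : R * R) (y : R) => slice l (fst q) a b (snd q) y * psi (snd q) y)); [exact H2|].
  apply (cont_mult (fun z : (R * R) * R => slice l (fst (fst z)) a b (snd (fst z)) (snd z))); [apply slice_cont|].
  apply (cont_comp2 psi (fun z : (R * R) * R => snd (fst z)) (fun z => snd z)); cts.
Qed.

Lemma pairing_cont l : cont (pairing xl xr yl yr l a b psi).
Proof.
  apply (cont_RInt (fun t x => RInt (fun y => slice l t a b x y * psi x y) yl yr)); [exact H1 | apply inner_cont].
Qed.

Lemma pairing_derive l t : 0 < t ->
  is_derive (pairing xl xr yl yr l a b psi) t (pairing xl xr yl yr (S l) a b psi t).
Proof.
  intros Ht.
  assert (L : locally t (fun s => 0 < s)).
  { apply (locally_interval _ t 0 p_infty); simpl; [lra | exact I | intros; lra]. }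
  apply (integral_derive_param (fun t x => RInt (fun y => slice l t a b x y * psi x y) yl yr)
    (fun t x => RInt (fun y => slice (S l) t a b x y * psi x y) yl yr)); [exact H1 | | | apply inner_cont].
  - revert L. apply filter_imp. intros s Hs x.
    apply (integral_derive_param (fun t y => slice l t a b x y * psi x y) (fun t y => slice (S l) t a b x y * psi x y));
      [exact H2 | | |].
    + assert (L' : locally s (fun r => 0 < r)).
      { apply (locally_interval _ s 0 p_infty); simpl; [lra | exact I | intros; lra]. }
      revert L'. apply filter_imp. intros r Hr y.
      apply (deriv_val _ _ (slice (S l) r a b x y * psi x y + slice l r a b x y * 0)); [|ring].
      apply (deriv_mult (fun r => slice l r a b x y) (fun _ => psi x y)); [now apply slice_derive | apply deriv_const].
    + intros r. apply cont_mult; [apply slice_cfu; cts | now apply (cont2_r psi)].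
    + apply (cont_mult (fun q : R * R => slice (S l) (fst q) a b x (snd q))); [apply slice_cfu; cts|].
      apply (cont_comp2 psi (fun _ : R * R => x) (fun q => snd q)); cts.
  - intros s. apply (cont2_r (fun t x => RInt (fun y => slice l t a b x y * psi x y) yl yr) s), inner_cont.
Qed.
End Pairing.

Lemma sobolev_sq_cont l a b : cont (fun t : R => Sn (slice l t) a b).
Proof.
  apply (cont_RInt (fun t x => RInt (fun y => slice l t a b x y ^ 2) (ay Om) (ay Om + Ly))); [pose proof Lx_pos; lra|].
  apply (cont_RInt (fun (q : R * R) (y : R) => slice l (fst q) a b (snd q) y ^ 2)); [pose proof Ly_pos; lra|].
  apply (cont_pow (fun z : (R * R) * R => slice l (fst (fst z)) a b (snd (fst z)) (snd z))), slice_cont.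
Qed.

Lemma L2norm_sq W a b : smooth2 W -> L2norm Om (W a b) ^ 2 = Sn W a b.
Proof.
  intros SW. unfold L2norm.
  pose proof (sobolev_sq_ge0 (ax Om) Lx (ay Om) Ly W a b (Rlt_le _ _ Lx_pos) (Rlt_le _ _ Ly_pos) SW) as H.
  unfold sobolev_sq in *.
  replace (ax Om + Lx) with (bx Om) in * by ring. replace (ay Om + Ly) with (by_ Om) in * by ring.
  now apply pow2_sqrt.
Qed.

(** [real] sends an infinite supremum to 0, so finiteness has to be established. It comes from the
    continuity of the square [g] on the compact interval. *)
Lemma sup_upto_sq (f g : R -> R) T t : cont g ->
  (forall t, 0 <= t <= T -> 0 <= f t /\ f t ^ 2 = g t) -> 0 <= t <= T ->
  0 <= sup_upto T f /\ g t <= sup_upto T f ^ 2.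
Proof.
  intros Cg H Ht. destruct (cont_bounded g 0 T Cg) as (B & B0 & HB).
  unfold sup_upto.
  destruct (Lub_Rbar_correct (fun z => exists t, 0 <= t <= T /\ z = f t)) as [ub lub].
  (* A nonnegative number is at most 1 plus its square. *)
  assert (U : Rbar_le (Lub_Rbar (fun z => exists t, 0 <= t <= T /\ z = f t)) (1 + B)).
  { apply lub. intros z (s & Hs & ->). simpl. destruct (H s Hs) as [P E].
    specialize (HB s Hs). rewrite <- E in HB. rewrite Rabs_pos_eq in HB by apply pow2_ge_0. nra. }
  assert (L : Rbar_le (f t) (Lub_Rbar (fun z => exists t, 0 <= t <= T /\ z = f t))).
  { apply ub. now exists t. }
  destruct (Lub_Rbar _) as [l| |]; simpl in U, L |- *; [| contradiction | contradiction].
  destruct (H t Ht) as [P E]. rewrite <- E. split; [lra|]. change (f t ^ 2 <= l ^ 2).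
  apply pow_incr. lra.
Qed.

Lemma sup_Hnorm_bound k T t a b : 0 <= t <= T -> (a + b <= k)%nat ->
  let s := sup_upto T (fun t => Hnorm Om k (D 1%nat 0%nat 0%nat t)) in
  0 <= s /\ Sn (slice 1 t) a b <= s ^ 2.
Proof.
  intros Ht ab s.
  set (g := fun t => sum0 k (fun a => sum0 (k - a) (fun b => Sn (slice 1 t) a b))).
  assert (P : forall t a b, 0 <= Sn (slice 1 t) a b).
  { intros. apply sobolev_sq_ge0; [left; apply Lx_pos | left; apply Ly_pos | apply slice_smooth]. }
  destruct (sup_upto_sq (fun t => Hnorm Om k (D 1%nat 0%nat 0%nat t)) g T t) as [S0 Sg]; [| | exact Ht |].
  - apply (cont_sum0 k (fun a t => sum0 (k - a) (fun b => Sn (slice 1 t) a b))). intros i _.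
    apply (cont_sum0 (k - i) (fun b t => Sn (slice 1 t) i b)). intros j _. apply sobolev_sq_cont.
  - intros r Hr. split; [apply sqrt_pos|]. unfold Hnorm. rewrite pow2_sqrt.
    + unfold g. apply sum0_ext. intros i _. apply sum0_ext. intros j _.
      rewrite <- L2norm_sq by apply slice_smooth. f_equal. unfold L2norm. f_equal.
      apply integral_ext. intros x. apply integral_ext. intros y. f_equal.
      apply (partial_eq (slice 1 r)); [apply slice_smooth|]. intros. now rewrite slice_pos by apply Hr.
    + apply sum0_ge0. intros i _. apply sum0_ge0. intros j _. apply pow2_ge_0.
  - split; [exact S0|]. apply Rle_trans with (2 := Sg). unfold g.
    apply Rle_trans with (sum0 (k - a) (fun b => Sn (slice 1 t) a b)).
    + apply (sum0_term (k - a) (fun b => Sn (slice 1 t) a b)); [lia | intros; apply P].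
    + apply (sum0_term k (fun a => sum0 (k - a) (fun b => Sn (slice 1 t) a b))); [lia|].
      intros. apply sum0_ge0. intros; apply P.
Qed.

Lemma sup_L2norm_bound l T t : 0 <= t <= T ->
  let s := sup_upto T (fun t => L2norm Om (D l 0%nat 0%nat t)) in
  0 <= s /\ Sn (slice l t) 0 0 <= s ^ 2.
Proof.
  intros Ht s. apply (sup_upto_sq _ (fun t => Sn (slice l t) 0 0)); [apply sobolev_sq_cont | | exact Ht].
  intros r Hr. split; [apply sqrt_pos|].
  rewrite <- L2norm_sq by apply slice_smooth. now rewrite slice_pos by apply Hr.
Qed.

(** Derivatives at positive times suffice, so the interval may start at the initial time. *)
Lemma mvt (f df : R -> R) a b : cont f -> 0 <= a -> a < b ->
  (forall t, 0 < t -> is_derive f t (df t)) -> exists c, a <= c <= b /\ f b - f a = df c * (b - a).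
Proof.
  intros C a0 ab Df. destruct (MVT_gen f a b df) as (c & Hc & E).
  - rewrite Rmin_left by lra. intros x Hx. apply Df. lra.
  - intros x _. apply continuity_pt_filterlim, C.
  - rewrite Rmin_left, Rmax_right in Hc by lra. now exists c.
Qed.

(* Duality: the square norm of a time average [Z] is the average of the pairing of
   the time derivative with [Z]. *)
Lemma average_norm t0 t1 a b B : 0 <= t0 -> t0 < t1 ->
  (forall t, t0 <= t <= t1 -> Sn (slice 1 t) a b <= B) ->
  Sn (fun a b x y => / (t1 - t0) * (slice 0 t1 a b x y - slice 0 t0 a b x y)) a b <= B.
Proof.
  intros T0 T1 HB. set (Z := fun a b x y => / (t1 - t0) * (slice 0 t1 a b x y - slice 0 t0 a b x y)).
  assert (SZ : smooth2 Z) by (apply smooth2_scal, smooth2_minus; apply slice_smooth).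
  pose proof Lx_pos as Lx0. pose proof Ly_pos as Ly0.
  pose proof (proj1 SZ a b) as CZ.
  set (F := fun l => pairing (ax Om) (ax Om + Lx) (ay Om) (ay Om + Ly) l a b (Z a b)).
  destruct (mvt (F 0%nat) (F 1%nat) t0 t1) as (c & Hc & E).
  - refine (pairing_cont (ax Om) (ax Om + Lx) (ay Om) (ay Om + Ly) a b (Z a b) _ _ CZ 0); lra.
  - exact T0.
  - exact T1.
  - intros t Ht.
    refine (pairing_derive (ax Om) (ax Om + Lx) (ay Om) (ay Om + Ly) a b (Z a b) _ _ CZ 0 t Ht); lra.
  - assert (E2 : F 0%nat t1 - F 0%nat t0 = (t1 - t0) * Sn Z a b).
    { unfold F, pairing, sobolev_sq.
      pose proof (proj1 (slice_smooth 0 t1) a b) as C1. pose proof (proj1 (slice_smooth 0 t0) a b) as C0.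
      assert (K1 : cont2 (fun x y => slice 0 t1 a b x y * Z a b x y)) by cts.
      assert (K2 : cont2 (fun x y => slice 0 t0 a b x y * Z a b x y)) by cts.
      assert (K3 : cont2 (fun x y => Z a b x y ^ 2)) by cts.
      pose proof (iterated_RInt_lin (ax Om) Lx (ay Om) Ly Ly0 1 (-1) _ _ K1 K2) as L1.
      pose proof (iterated_RInt_lin (ax Om) Lx (ay Om) Ly Ly0 (t1 - t0) 0 _ _ K3 K3) as L2.
      cbv beta in L1, L2.
      rewrite Rmult_0_l, Rplus_0_r in L2. rewrite <- L2.
      match type of L1 with _ = ?r => transitivity r; [rring|] end. rewrite <- L1.
      apply integral_ext. intros x. apply integral_ext. intros y. unfold Z. field. lra. }
    (* Pairing with [Z] has made the problem scalar, so a single intermediate time [c] serves;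
       Cauchy-Schwarz and division by the square norm of [Z] finish. *)
    assert (E3 : Sn Z a b = F 1%nat c) by (rewrite E2 in E; nra).
    pose proof (proj1 (slice_smooth 1 c) a b) as Cc.
    assert (CS : F 1%nat c ^ 2 <= Sn (slice 1 c) a b * Sn Z a b).
    { apply quad_ge0_le. unfold F, pairing, sobolev_sq.
      assert (R1 : forall f, cont2 f -> cont (fun x : R => RInt (fun y => f x y) (ay Om) (ay Om + Ly)))
        by (intros f Cf; apply (cont_RInt f); [lra | exact Cf]).
      apply quad_ge0_int; [lra | | | |].
      - apply (R1 (fun x y => slice 1 c a b x y ^ 2)). cts.
      - apply (R1 (fun x y => slice 1 c a b x y * Z a b x y)). cts.
      - apply (R1 (fun x y => Z a b x y ^ 2)). cts.
      - intros x _. pose proof (cont2_r _ x Cc) as K1. pose proof (cont2_r _ x CZ) as K2.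
        apply quad_ge0_int; [lra | cts | cts | cts |].
        intros y _. apply le_quad_ge0; [apply pow2_ge_0 | apply pow2_ge_0 | right; ring]. }
    rewrite <- E3 in CS. specialize (HB c Hc).
    assert (P1 : 0 <= Sn Z a b) by (apply sobolev_sq_ge0; lra || exact SZ).
    destruct (Req_dec (Sn Z a b) 0) as [Z0|nz].
    + rewrite Z0. apply Rle_trans with (2 := HB). apply sobolev_sq_ge0; [lra | lra | apply slice_smooth].
    + assert (Sn Z a b <= Sn (slice 1 c) a b); [|lra].
      apply Rmult_le_reg_r with (Sn Z a b); [lra|]. lra.
Qed.

Section Mesh.
Variables (N M : nat) (v : broken).
Hypotheses (N1 : (1 <= N)%nat) (M1 : (1 <= M)%nat) (Cv : broken_cont N M v).

Definition slice_pairing (l : nat) (t : R) : R := inner Om N M (on_cells (slice l t 0%nat 0%nat)) v.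

Lemma slice_pairing_cont l : cont (slice_pairing l).
Proof.
  apply (cont_sum_n_m (fun i t => sumr M (fun j => cellint Om N M (fun x y => slice l t 0%nat 0%nat x y * v i j x y) i j))).
  intros i Hi.
  apply (cont_sum_n_m (fun j t => cellint Om N M (fun x y => slice l t 0%nat 0%nat x y * v i j x y) i j)).
  intros j Hj.
  exact (pairing_cont (xn Om N (i - 1)) (xn Om N i) (yn Om M (j - 1)) (yn Om M j) 0 0 (v i j)
    (xn_le Om N N1 i (proj1 Hi)) (yn_le Om M M1 j (proj1 Hj)) (Cv i j Hi Hj) l).
Qed.

Lemma slice_pairing_derive l t : 0 < t -> is_derive (slice_pairing l) t (slice_pairing (S l) t).
Proof.
  intros Ht.
  apply (deriv_sumr N (fun i t => sumr M (fun j => cellint Om N M (fun x y => slice l t 0%nat 0%nat x y * v i j x y) i j))).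
  intros i Hi.
  apply (deriv_sumr M (fun j t => cellint Om N M (fun x y => slice l t 0%nat 0%nat x y * v i j x y) i j)).
  intros j Hj.
  exact (pairing_derive (xn Om N (i - 1)) (xn Om N i) (yn Om M (j - 1)) (yn Om M j) 0 0 (v i j)
    (xn_le Om N N1 i (proj1 Hi)) (yn_le Om M M1 j (proj1 Hj)) (Cv i j Hi Hj) l t Ht).
Qed.

Lemma inner_cell0 W : smooth2 W ->
  inner Om N M (on_cells (W 0%nat 0%nat)) (on_cells (W 0%nat 0%nat)) = Sn W 0 0.
Proof.
  intros SW. pose proof (proj1 SW 0%nat 0%nat) as C.
  pose proof (dx_pos Om N N1) as hx0. pose proof (dy_pos Om M M1) as hy0.
  rewrite (inner_sqnorm2 Om N M N1 M1) by (intros i j _ _; exact C).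
  pose proof (sum_slabs (ax Om) (dx Om N) N (ay Om) (dy Om M) M hx0 hy0 N1 M1
    (fun x y => W 0%nat 0%nat x y ^ 2) (cont_pow _ 2 C)) as E.
  rewrite N_dx, M_dy in E by assumption. unfold sobolev_sq. rewrite <- E.
  apply sumr_ext. intros j Hj. apply integral_ext. intros y.
  pose proof (cont2_l _ y C) as Cy.
  rewrite <- (N_dx Om N N1). apply (sqnorm1_cells (fun x => W 0%nat 0%nat x y ^ 2)). cts.
Qed.

Lemma slice_pairing_bound l t s : 0 <= s -> Sn (slice l t) 0 0 <= s ^ 2 -> Rabs (slice_pairing l t) <= s * bnorm Om N M v.
Proof.
  intros s0 H. pose proof (bnorm_ge0 Om N M v) as V0.
  assert (Cw : broken_cont N M (on_cells (slice l t 0%nat 0%nat))) by (intros i j _ _; apply slice_smooth).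
  eapply Rle_trans; [apply (cauchy_schwarz Om N M N1 M1); assumption|].
  apply Rmult_le_compat_r; [exact V0|].
  apply le_of_sq; [exact s0|]. rewrite (bnorm_sq Om N M N1 M1) by exact Cw.
  rewrite inner_cell0 by apply slice_smooth. exact H.
Qed.
End Mesh.
End Time.

(** * Error estimate *)

(** The largest demand is [consistency_sq] of [lap W]: order [m + 6] in [W], the [m + 2] derivatives
    controlled for [V] plus the four of the operator. In [E], the 4 counts the terms of
    [consistency_sq]. The three terms of [approx_sq] for [W] itself lack two derivatives; two uses
    of Poincare's inequality supply them, for two terms in x and for one in y. *)
Lemma elliptic_bounds m Om W V B :
  let Sn := sobolev_sq (ax Om) (bx Om - ax Om) (ay Om) (by_ Om - ay Om) in
  let E := 4 + 2 * (bx Om - ax Om) ^ 4 + (by_ Om - ay Om) ^ 4 in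
  smooth2 W -> periodic2 (bx Om - ax Om) (by_ Om - ay Om) W ->
  (forall a b x y, V a b x y = - lap (lap W) a b x y) ->
  (forall a b, (a + b <= m + 2)%nat -> Sn V a b <= B) ->
  consistency_sq m Om W <= E * B /\ approx_sq m Om W <= E * B /\ consistency_sq m Om (lap W) <= E * B /\ approx_sq m Om (lap W) <= E * B.
Proof.
  intros Sn E SW PW EV HB.
  assert (Lx0 : 0 < bx Om - ax Om) by (pose proof (ax_lt_bx Om); lra).
  assert (Ly0 : 0 < by_ Om - ay Om) by (pose proof (ay_lt_by Om); lra).
  assert (SL := smooth2_lap _ SW). assert (PL := periodic2_lap _ _ _ PW).
  assert (SLL := smooth2_lap _ SL).
  assert (LB : forall a b, (a + b <= m + 2)%nat -> Sn (lap (lap W)) a b <= B).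
  { intros a b ab. unfold Sn. rewrite (sobolev_sq_ext _ _ _ _ _ V); [now apply HB|]. intros. rewrite EV. ring. }
  assert (P0 : forall a b, 0 <= Sn W a b) by (intros; apply sobolev_sq_ge0; lra || assumption).
  assert (P1 : forall a b, 0 <= Sn (lap W) a b) by (intros; apply sobolev_sq_ge0; lra || assumption).
  assert (B0 : 0 <= B).
  { apply Rle_trans with (2 := LB 0%nat 0%nat ltac:(lia)). apply sobolev_sq_ge0; lra || assumption. }
  assert (U : forall a b, Sn W (S (S a)) b <= Sn (lap W) a b /\ Sn W a (S (S b)) <= Sn (lap W) a b).
  { intros a b. destruct (lap_bound (ax Om) _ (ay Om) _ Lx0 Ly0 W a b SW PW) as (H1 & H2 & _). now split. }
  assert (U' : forall a b, (a + b <= m + 2)%nat -> Sn (lap W) (S (S a)) b <= B /\ Sn (lap W) a (S (S b)) <= B).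
  { intros a b ab. destruct (lap_bound (ax Om) _ (ay Om) _ Lx0 Ly0 (lap W) a b SL PL) as (H1 & H2 & _).
    specialize (LB a b ab). split; eapply Rle_trans; eassumption. }
  set (X := bx Om - ax Om) in *. set (Y := by_ Om - ay Om) in *.
  assert (X4 : 0 < X ^ 4) by now apply pow_lt. assert (Y4 : 0 < Y ^ 4) by now apply pow_lt.
  assert (X2 : 0 < X ^ 2) by now apply pow_lt. assert (Y2 : 0 < Y ^ 2) by now apply pow_lt.
  assert (Q : forall a b, (a + b <= m + 2)%nat -> Sn W (S (S a)) (S (S b)) <= B).
  { intros a b ab. exact (Rle_trans _ _ _ (proj1 (U a (S (S b)))) (proj2 (U' a b ab))). }
  assert (Q1 : forall a b, (a + b <= m + 2)%nat -> Sn W (S (S (S (S a)))) b <= B).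
  { intros a b ab. exact (Rle_trans _ _ _ (proj1 (U (S (S a)) b)) (proj1 (U' a b ab))). }
  assert (Q2 : forall a b, (a + b <= m + 2)%nat -> Sn W a (S (S (S (S b)))) <= B).
  { intros a b ab. exact (Rle_trans _ _ _ (proj2 (U a (S (S b)))) (proj2 (U' a b ab))). }
  assert (R1 : forall a b, (a + b <= m + 2)%nat -> Sn W (S (S a)) b <= X ^ 4 * B).
  { intros a b ab.
    pose proof (poincare_x (ax Om) X (ay Om) Y Lx0 Ly0 W (S a) b SW PW) as H1.
    pose proof (poincare_x (ax Om) X (ay Om) Y Lx0 Ly0 W (S (S a)) b SW PW) as H2.
    specialize (Q1 a b ab). fold Sn in H1, H2.
    apply Rle_trans with (1 := H1). replace (X ^ 4 * B) with (X ^ 2 * (X ^ 2 * B)) by ring.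
    apply Rmult_le_compat_l; [lra|]. apply Rle_trans with (1 := H2).
    apply Rmult_le_compat_l; lra. }
  assert (R2 : forall a b, (a + b <= m + 2)%nat -> Sn W a (S (S b)) <= Y ^ 4 * B).
  { intros a b ab.
    pose proof (poincare_y (ax Om) X (ay Om) Y W a (S b) Lx0 Ly0 SW PW) as H1.
    pose proof (poincare_y (ax Om) X (ay Om) Y W a (S (S b)) Lx0 Ly0 SW PW) as H2.
    specialize (Q2 a b ab). fold Sn in H1, H2.
    apply Rle_trans with (1 := H1). replace (Y ^ 4 * B) with (Y ^ 2 * (Y ^ 2 * B)) by ring.
    apply Rmult_le_compat_l; [lra|]. apply Rle_trans with (1 := H2).
    apply Rmult_le_compat_l; lra. }
  assert (XB : 0 <= X ^ 4 * B) by (apply Rmult_le_pos; lra).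
  assert (YB : 0 <= Y ^ 4 * B) by (apply Rmult_le_pos; lra).
  unfold consistency_sq, approx_sq. fold X Y. fold Sn. unfold E.
  replace (m + 4)%nat with (S (S (S (S m)))) by lia. replace (m + 2)%nat with (S (S m)) in * by lia.
  pose proof (Q1 m 0%nat ltac:(lia)). pose proof (Q2 0%nat m ltac:(lia)).
  pose proof (Q 0%nat m ltac:(lia)). pose proof (Q m 0%nat ltac:(lia)).
  pose proof (R1 m 0%nat ltac:(lia)). pose proof (R2 0%nat m ltac:(lia)).
  pose proof (R1 0%nat (m - 2 + 2)%nat ltac:(lia)).
  destruct (U' (S (S m)) 0%nat ltac:(lia)) as [? ?]. destruct (U' 0%nat (S (S m)) ltac:(lia)) as [? ?].
  destruct (U' m 0%nat ltac:(lia)) as [? ?]. destruct (U' 0%nat m ltac:(lia)) as [? ?].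
  destruct (U' 0%nat (m - 2 + 2)%nat ltac:(lia)) as [? ?].
  repeat split; lra.
Qed.

(** The end of the step is made variable: the residual [r] vanishes at [t0], and its derivative is
    [t - t0] times a second derivative of [F 0] with factor [1 - 2 * th], plus [th] times a
    difference of second derivatives. The former disappears for [th = 1 / 2], the latter costs a
    third derivative and gains another [dt]. *)
Lemma theta_rule th (F : nat -> R -> R) t0 dt B2 B3 : 1 / 2 <= th <= 1 -> 0 <= t0 -> 0 < dt ->
  (forall l, cont (F l)) -> (forall l t, 0 < t -> is_derive (F l) t (F (S l) t)) ->
  (forall t, t0 <= t <= t0 + dt -> Rabs (F 2%nat t) <= B2 /\ Rabs (F 3%nat t) <= B3) ->
  Rabs ((F 0%nat (t0 + dt) - F 0%nat t0) / dt - ((1 - th) * F 1%nat t0 + th * F 1%nat (t0 + dt)))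
  <= (2 * th - 1) * dt * B2 + dt ^ 2 * B3.
Proof.
  intros Ht T0 dt0 C DF HB.
  assert (B20 : 0 <= B2) by (eapply Rle_trans; [apply Rabs_pos | apply (HB t0); lra]).
  assert (B30 : 0 <= B3) by (eapply Rle_trans; [apply Rabs_pos | apply (HB t0); lra]).
  set (r := fun t => F 0%nat t - F 0%nat t0 - (t - t0) * ((1 - th) * F 1%nat t0 + th * F 1%nat t)).
  set (r' := fun t => (1 - th) * (F 1%nat t - F 1%nat t0) - th * ((t - t0) * F 2%nat t)).
  assert (Cr : cont r).
  { pose proof (C 0%nat). pose proof (C 1%nat). unfold r. cts. }
  assert (Dr : forall t, 0 < t -> is_derive r t (r' t)).
  { intros t Hp. unfold r, r'.
    apply (deriv_val _ _ ((F 1%nat t - 0) - ((1 - 0) * ((1 - th) * F 1%nat t0 + th * F 1%nat t)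
       + (t - t0) * (0 + th * F 2%nat t)))); [|ring].
    apply deriv_minus; [apply deriv_minus; [now apply DF | apply deriv_const]|].
    apply (deriv_mult (fun t => t - t0) (fun t => (1 - th) * F 1%nat t0 + th * F 1%nat t)).
    - apply deriv_minus; [apply deriv_id | apply deriv_const].
    - apply deriv_plus; [apply deriv_const | apply deriv_scal; now apply DF]. }
  assert (Br : forall t, t0 <= t <= t0 + dt -> Rabs (r' t) <= dt * ((2 * th - 1) * B2 + dt * B3)).
  { intros t [H1 H2].
    assert (P1 : 0 <= (2 * th - 1) * B2) by (apply Rmult_le_pos; lra).
    assert (P2 : 0 <= dt * B3) by (apply Rmult_le_pos; lra).
    destruct (Req_dec t t0) as [->|ne].
    { unfold r'. replace (_ - _) with 0 by ring. rewrite Rabs_R0. apply Rmult_le_pos; lra. }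
    destruct (mvt (F 1%nat) (F 2%nat) t0 t (C 1%nat) T0 ltac:(lra) (DF 1%nat)) as (c & Hc & Ec).
    assert (D2 : Rabs (F 2%nat c - F 2%nat t) <= dt * B3).
    { destruct (Req_dec c t) as [->|nc].
      - rewrite Rminus_diag, Rabs_R0. exact P2.
      - destruct (mvt (F 2%nat) (F 3%nat) c t (C 2%nat) ltac:(lra) ltac:(lra) (DF 2%nat)) as (c' & Hc' & Ec').
        rewrite Rabs_minus_sym, Ec', Rabs_mult, Rmult_comm, (Rabs_pos_eq (t - c)) by lra.
        apply Rmult_le_compat; [lra | apply Rabs_pos | lra | apply (HB c'); lra]. }
    unfold r'. rewrite Ec.
    replace ((1 - th) * (F 2%nat c * (t - t0)) - th * ((t - t0) * F 2%nat t))
      with ((t - t0) * (- (2 * th - 1) * F 2%nat c + th * (F 2%nat c - F 2%nat t))) by ring.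
    rewrite Rabs_mult, (Rabs_pos_eq (t - t0)) by lra.
    apply Rmult_le_compat; [lra | apply Rabs_pos | lra |].
    apply Rle_trans with (1 := Rabs_triang _ _). rewrite !Rabs_mult, Rabs_Ropp.
    rewrite (Rabs_pos_eq (2 * th - 1)), (Rabs_pos_eq th) by lra.
    apply Rplus_le_compat.
    - apply Rmult_le_compat_l; [lra|]. apply (HB c); lra.
    - pose proof (Rabs_pos (F 2%nat c - F 2%nat t)).
      apply Rle_trans with (1 * Rabs (F 2%nat c - F 2%nat t)); [apply Rmult_le_compat_r; lra | lra]. }
  destruct (mvt r r' t0 (t0 + dt) Cr T0 ltac:(lra) Dr) as (c & Hc & Ec).
  replace ((F 0%nat (t0 + dt) - F 0%nat t0) / dt - ((1 - th) * F 1%nat t0 + th * F 1%nat (t0 + dt)))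
    with (r' c).
  - apply Rle_trans with (1 := Br c Hc). right; ring.
  - replace (t0 + dt - t0) with dt in Ec by ring.
    apply Rmult_eq_reg_r with dt; [|lra]. rewrite <- Ec. unfold r. field. lra.
Qed.

(** Linearity of the projection: with [c = / dt], the difference quotient of projection errors
    becomes the projection error of the time average of u_t. *)
Lemma proj_error_average m p Om N M W0 W1 c : onb m p -> smooth2 W0 -> smooth2 W1 -> forall i j x y,
  proj_error m p Om N M (fun a b x y => c * (W1 a b x y - W0 a b x y)) i j x y
  = c * (proj_error m p Om N M W1 i j x y - proj_error m p Om N M W0 i j x y).
Proof.
  intros Bp S0 S1 i j x y. rewrite !proj_error_eq. unfold proj_mesh, proj_cell2, Pi2.
  set (ax' := node (ax Om) (dx Om N) (i - 1)). set (ay' := node (ay Om) (dy Om M) (j - 1)).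
  rewrite <- !(eval_PiL m p Bp).
  rewrite (eval_ext m p _ (Piy m p (fun a b x y => c * (W1 a b x y - W0 a b x y)) ay' (dy Om M) y)
    (fun n x => c * (Piy m p W1 ay' (dy Om M) y n x - Piy m p W0 ay' (dy Om M) y n x))).
  - assert (K1 := Piy_smooth m p Bp W1 ay' (dy Om M) y S1).
    assert (K0 := Piy_smooth m p Bp W0 ay' (dy Om M) y S0).
    rewrite (eval_scal m p Bp) by now apply smooth1_minus.
    rewrite (eval_minus m p Bp) by assumption. ring.
  - intros n x'. unfold Piy. rewrite <- !(eval_PiL m p Bp).
    rewrite (eval_scal m p Bp _ c (fun b y => W1 n b x' y - W0 n b x' y)), (eval_minus m p Bp);
      [reflexivity | | |].
    + apply (smooth2_y W1 n x' S1).
    + apply (smooth2_y W0 n x' S0).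
    + apply smooth1_minus; [apply (smooth2_y W1 n x' S1) | apply (smooth2_y W0 n x' S0)].
Qed.

Lemma inner_opp Om N M f g v : (1 <= N)%nat -> (1 <= M)%nat -> cont2 g -> broken_cont N M v ->
  (forall x y, f x y = - g x y) ->
  inner Om N M (on_cells f) v = - inner Om N M (on_cells g) v.
Proof.
  intros N1 M1 Cg Cv E.
  assert (Cb : broken_cont N M (on_cells g)) by (intros i j _ _; exact Cg).
  rewrite (inner_ext Om N M _ (bcomb (-1) (on_cells g) 0 (on_cells g))).
  - rewrite inner_lin by assumption. ring.
  - intros. unfold bcomb, on_cells. rewrite E. ring.
Qed.

Theorem theorem3p4 :
  forall (Om : rectangle) (k : nat), (1 <= k)%nat ->
  exists c0 c1 : R -> R -> R -> R,
  forall (theta : R), 1 / 2 <= theta <= 1 ->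
  forall (u : R -> R -> R -> R) (D : nat -> nat -> nat -> R -> R -> R -> R)
         (u0 : R -> R -> R),
    smooth_with_derivatives u D ->
    periodic_in_space Om u ->
    (forall t x y, 0 < t ->
       Derive (fun s => u s x y) t = - laplacian (laplacian (u t)) x y) ->
    (forall x y, u 0 x y = u0 x y) ->
  forall (T : R), 0 < T ->
  forall (N M : nat) (dt : R), (1 <= N)%nat -> (1 <= M)%nat -> 0 < dt ->
  forall (uh qh : nat -> broken),
    fully_discrete_solution Om N M k theta dt u0 uh qh ->
  forall (n : nat), INR n * dt <= T ->
    let s1 := sup_upto T (fun t => Hnorm Om (k + 1) (D 1%nat 0%nat 0%nat t)) in
    let s2 := sup_upto T (fun t => L2norm Om (D 2%nat 0%nat 0%nat t)) in
    let s3 := sup_upto T (fun t => L2norm Om (D 3%nat 0%nat 0%nat t)) in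
    bnorm Om N M (fun i j x y => u (INR n * dt) x y - uh n i j x y)
    <= (c0 s1 s2 s3 + c1 s1 s2 s3 * T)
       * ((mesh_size Om N M) ^ (k + 1) + (theta - 1 / 2) * dt + dt ^ 2).
Proof.
  (* The local projection is built from polynomials of degree [m = k - 1], the degree of the
     derivatives. *)
  intros Om k k1. destruct k as [|m]; [lia|]. clear k1.
  destruct (onb_exists m) as [p Bp].
  destruct (A_consistency m p Bp) as (CA & CA0 & HA).
  destruct (L2_error m p Bp Om) as (CL & CL0 & HL).
  set (Lx := bx Om - ax Om) in *. set (Ly := by_ Om - ay Om) in *.
  set (E := 4 + 2 * Lx ^ 4 + Ly ^ 4).
  assert (E4 : 4 <= E).
  { unfold E. pose proof (pow2_ge_0 (Lx ^ 2)). pose proof (pow2_ge_0 (Ly ^ 2)).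
    replace (Lx ^ 4) with ((Lx ^ 2) ^ 2) by ring. replace (Ly ^ 4) with ((Ly ^ 2) ^ 2) by ring. lra. }
  (* [K >= 1] exceeds both constants, so [K ^ 2] dominates them and their square roots are
     avoided. *)
  set (K := 1 + CA * E + CL * E).
  assert (KA : CA * E <= K ^ 2).
  { assert (0 < CA * E) by (apply Rmult_lt_0_compat; lra). assert (0 < CL * E) by (apply Rmult_lt_0_compat; lra).
    unfold K. nra. }
  assert (KL : CL * E <= K ^ 2).
  { assert (0 < CA * E) by (apply Rmult_lt_0_compat; lra). assert (0 < CL * E) by (apply Rmult_lt_0_compat; lra).
    unfold K. nra. }
  assert (K0 : 0 <= K).
  { assert (0 < CA * E) by (apply Rmult_lt_0_compat; lra). assert (0 < CL * E) by (apply Rmult_lt_0_compat; lra).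
    unfold K. lra. }
  (* In terms of [d] below, [3 * d] bounds the discrete error before growth and one more [d] the
     projection error at the final time; the growth is [5 / 2 * (3 * d)] per unit of time. *)
  exists (fun s1 s2 s3 => 4 * (K + 2) * (s1 + s2 + s3)).
  exists (fun s1 s2 s3 => 15 / 2 * (K + 2) * (s1 + s2 + s3)).
  intros th Hth u D u0 SD Per PDE U0 T T0 N M dt N1 M1 dt0 uh qh (Pr & Qhn & Sch & Aux) n nT s1 s2 s3.
  set (h := mesh_size Om N M).
  assert (h0 : 0 < h) by (apply Rlt_le_trans with (1 := dx_pos Om N N1); apply Rmax_l).
  set (H := h ^ (S m + 1)). assert (H0 : 0 < H) by now apply pow_lt.
  assert (HH : h ^ (2 * m + 4) = H ^ 2) by (unfold H; rewrite <- pow_mult; f_equal; lia).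
  set (U := slice D 0). set (V := slice D 1). set (Q := fun t a b x y => -1 * lap (U t) a b x y).
  assert (B1 : forall t a b, 0 <= t <= T -> (a + b <= m + 2)%nat ->
     0 <= s1 /\ sobolev_sq (ax Om) Lx (ay Om) Ly (V t) a b <= s1 ^ 2)
    by (intros t a b Ht ab; apply (sup_Hnorm_bound Om u D SD); [exact Ht | lia]).
  assert (B2 : forall t, 0 <= t <= T -> 0 <= s2 /\ sobolev_sq (ax Om) Lx (ay Om) Ly (slice D 2 t) 0 0 <= s2 ^ 2)
    by (intros; now apply (sup_L2norm_bound Om u D SD)).
  assert (B3 : forall t, 0 <= t <= T -> 0 <= s3 /\ sobolev_sq (ax Om) Lx (ay Om) Ly (slice D 3 t) 0 0 <= s3 ^ 2)
    by (intros; now apply (sup_L2norm_bound Om u D SD)).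
  assert (s10 : 0 <= s1) by (refine (proj1 (B1 0 0%nat 0%nat _ _)); [lra | lia]).
  assert (s20 : 0 <= s2) by (refine (proj1 (B2 0 _)); lra). assert (s30 : 0 <= s3) by (refine (proj1 (B3 0 _)); lra).
  set (s := s1 + s2 + s3). assert (s0 : 0 <= s) by (unfold s; lra).
  assert (s1s : s1 ^ 2 <= s ^ 2) by (apply pow_incr; unfold s; lra).
  assert (s2s : s2 ^ 2 <= s ^ 2) by (apply pow_incr; unfold s; lra).
  assert (SU : forall t, smooth2 (U t)) by (intros; now apply (slice_smooth u)).
  assert (SV : forall t, smooth2 (V t)) by (intros; now apply (slice_smooth u)).
  assert (SQ : forall t, smooth2 (Q t)) by (intros; apply smooth2_scal, smooth2_lap, SU).
  assert (PU : forall t, periodic2 Lx Ly (U t)) by (intros; now apply (slice0_periodic Om u)).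
  assert (PV : forall t, periodic2 Lx Ly (V t)) by (intros; now apply (slice1_periodic Om u)).
  assert (PQ : forall t, periodic2 Lx Ly (Q t)).
  { intros t a b x y. unfold Q. destruct (periodic2_lap _ _ _ (PU t) a b x y) as [-> ->]. auto. }
  assert (EV : forall t a b x y, V t a b x y = - lap (lap (U t)) a b x y) by (intros; now apply (slice_pde u D)).
  assert (EB : forall t, 0 <= t <= T -> consistency_sq m Om (U t) <= E * s ^ 2 /\ approx_sq m Om (U t) <= E * s ^ 2 /\
      consistency_sq m Om (Q t) <= E * s ^ 2 /\ approx_sq m Om (Q t) <= E * s ^ 2).
  { intros t Ht.
    assert (SQL : consistency_sq m Om (Q t) = consistency_sq m Om (lap (U t)) /\ approx_sq m Om (Q t) = approx_sq m Om (lap (U t))).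
    { assert (X : forall a b, sobolev_sq (ax Om) Lx (ay Om) Ly (Q t) a b = sobolev_sq (ax Om) Lx (ay Om) Ly (lap (U t)) a b)
        by (intros; apply sobolev_sq_ext; intros; unfold Q; ring).
      unfold consistency_sq, approx_sq. fold Lx Ly. rewrite !X. auto. }
    destruct SQL as [-> ->].
    apply (elliptic_bounds m Om (U t) (V t)); auto.
    intros a b ab. exact (Rle_trans _ _ _ (proj2 (B1 t a b Ht ab)) s1s). }
  assert (KsH : 0 <= K * s * H) by (apply Rmult_le_pos; [now apply Rmult_le_pos | lra]).
  assert (bA : forall W v, smooth2 W -> periodic2 Lx Ly W -> consistency_sq m Om W <= E * s ^ 2 -> in_Qh N M (S m) v ->
     Rabs (bilinA Om N M (proj_error m p Om N M W) v) <= K * s * H * bnorm Om N M v).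
  { intros W v SW PW HS Qv.
    assert (Cv := proj1 (broken_C1_Qh N M _ _ Qv)).
    apply Rabs_le_of_sq; [apply Rmult_le_pos; [exact KsH | apply bnorm_ge0]|].
    apply Rle_trans with (1 := HA Om N M W v N1 M1 SW PW Qv). fold h. rewrite HH.
    rewrite Rpow_mult_distr, bnorm_sq by assumption.
    apply Rmult_le_compat_r; [now apply inner_ge0|].
    apply Rle_trans with (CA * H ^ 2 * (E * s ^ 2)).
    - apply Rmult_le_compat_l; [|exact HS]. apply Rmult_le_pos; [lra | apply pow2_ge_0].
    - replace (CA * H ^ 2 * (E * s ^ 2)) with ((CA * E) * (s * H) ^ 2) by ring.
      replace ((K * s * H) ^ 2) with (K ^ 2 * (s * H) ^ 2) by ring.
      apply Rmult_le_compat_r; [apply pow2_ge_0 | exact KA]. }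
  assert (bN : forall W, smooth2 W -> periodic2 Lx Ly W -> approx_sq m Om W <= E * s ^ 2 ->
     bnorm Om N M (proj_error m p Om N M W) <= K * s * H).
  { intros W SW PW HS.
    apply le_of_sq; [exact KsH|].
    rewrite bnorm_sq by (assumption || apply (proj_error_breg m p Bp Om N M W SW)).
    apply Rle_trans with (1 := HL N M W N1 M1 SW PW). fold h. rewrite HH.
    apply Rle_trans with (CL * H ^ 2 * (E * s ^ 2)).
    - apply Rmult_le_compat_l; [|exact HS]. apply Rmult_le_pos; [lra | apply pow2_ge_0].
    - replace (CL * H ^ 2 * (E * s ^ 2)) with ((CL * E) * (s * H) ^ 2) by ring.
      replace ((K * s * H) ^ 2) with (K ^ 2 * (s * H) ^ 2) by ring.
      apply Rmult_le_compat_r; [apply pow2_ge_0 | exact KL]. }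
  assert (bI : forall W v, smooth2 W -> periodic2 Lx Ly W -> approx_sq m Om W <= E * s ^ 2 -> in_Qh N M (S m) v ->
     Rabs (inner Om N M (proj_error m p Om N M W) v) <= K * s * H * bnorm Om N M v).
  { intros W v SW PW HS Qv.
    eapply Rle_trans; [apply (cauchy_schwarz Om N M N1 M1)|].
    - apply (proj_error_breg m p Bp Om N M W SW).
    - apply (broken_C1_Qh N M _ _ Qv).
    - apply Rmult_le_compat_r; [apply bnorm_ge0 | now apply bN]. }
  set (G := H + (th - 1 / 2) * dt + dt ^ 2).
  assert (tt0 : 0 <= (th - 1 / 2) * dt) by (apply Rmult_le_pos; lra).
  assert (dt2 : 0 < dt ^ 2) by now apply pow_lt.
  (* One bound for all consistency errors: [K] for those in space, 2 for the one in time, where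
     [2 * th - 1] is twice [th - 1 / 2]. *)
  set (d := (K + 2) * s * G).
  assert (d0 : 0 <= d).
  { unfold d, G. apply Rmult_le_pos; [apply Rmult_le_pos; lra | lra]. }
  assert (dKsH : K * s * H <= d).
  { unfold d, G. apply Rmult_le_compat; [now apply Rmult_le_pos | lra | | lra].
    apply Rmult_le_compat_r; lra. }
  assert (dle : forall x v, x <= K * s * H * bnorm Om N M v -> x <= d * bnorm Om N M v).
  { intros x v Hx. apply Rle_trans with (1 := Hx). apply Rmult_le_compat_r; [apply bnorm_ge0 | exact dKsH]. }
  set (tn := fun n : nat => INR n * dt).
  assert (tn0 : forall n, 0 <= tn n) by (intros; apply Rmult_le_pos; [apply pos_INR | lra]).
  assert (tnS : forall n, tn (S n) = tn n + dt) by (intros; unfold tn; rewrite S_INR; ring).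
  assert (exU : forall t v, in_Qh N M (S m) v ->
     bilinA Om N M (on_cells (U t 0%nat 0%nat)) v = inner Om N M (on_cells (Q t 0%nat 0%nat)) v).
  { intros t v Qv. rewrite (bilinA_smooth Om N M N1 M1 (U t) (SU t) (PU t)) by now apply (broken_C1_Qh N M (S m)).
    symmetry. apply inner_opp; [exact N1 | exact M1 | | now apply (broken_C1_Qh N M (S m)) |].
    - apply (proj1 (smooth2_lap _ (SU t)) 0%nat 0%nat).
    - intros x y. unfold Q, lap. ring. }
  assert (exQ : forall t v, in_Qh N M (S m) v ->
     bilinA Om N M (on_cells (Q t 0%nat 0%nat)) v = - inner Om N M (on_cells (V t 0%nat 0%nat)) v).
  { intros t v Qv. rewrite (bilinA_smooth Om N M N1 M1 (Q t) (SQ t) (PQ t)) by now apply (broken_C1_Qh N M (S m)).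
    f_equal. apply inner_ext; try assumption. intros i j x y _ _. unfold on_cells. rewrite EV.
    unfold Q, lap. ring. }
  set (xi := fun n => disc_err m p Om N M (U (tn n)) (uh n)).
  assert (Growth : forall n, tn n <= T -> bnorm Om N M (xi n) <= 3 * d + 15 / 2 * d * tn n).
  { clear n nT. induction n as [|n IH]; intros nT.
    - unfold tn. simpl. rewrite Rmult_0_l.
      set (x := xi 0%nat).
      assert (Qx : in_Qh N M (S m) x) by (apply (disc_err_Qh m p Bp); [apply SU | apply Qhn]).
      assert (Cx := proj1 (broken_C1_Qh N M _ _ Qx)).
      (* The initial data are the L2 projection of u, so the initial discrete error, tested with
         itself, sees only the projection error. *)
      assert (Ix : bnorm Om N M x ^ 2 = - inner Om N M (proj_error m p Om N M (U (tn 0%nat))) x).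
      { rewrite bnorm_sq by assumption. unfold x at 1, xi.
        rewrite (ip_disc_err m p Bp Om N M N1 M1) by (apply SU || apply Qhn || exact Qx).
        rewrite (proj2 Pr x Qx).
        rewrite (inner_ext Om N M (on_cells u0) (on_cells (U (tn 0%nat) 0%nat 0%nat))); [ring|].
        intros i j x' y' _ _. unfold on_cells, U, tn. simpl. rewrite Rmult_0_l.
        rewrite (slice_u u D SD) by lra. now rewrite U0. }
      pose proof (EB (tn 0%nat) (conj (tn0 0%nat) nT)) as (_ & EB2 & _ & _).
      pose proof (bI (U (tn 0%nat)) x (SU _) (PU _) EB2 Qx) as Hx.
      pose proof (bnorm_ge0 Om N M x) as Nx.
      assert (bnorm Om N M x ^ 2 <= d * bnorm Om N M x).
      { rewrite Ix. apply dle. apply Rle_trans with (2 := Hx). rewrite <- Rabs_Ropp. apply Rle_abs. }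
      nra.
    - assert (nT' : tn n <= T) by (rewrite tnS in nT; lra). specialize (IH nT').
      assert (In0 : 0 <= tn n <= T) by now split. assert (In1 : 0 <= tn (S n) <= T) by now split.
      destruct (EB _ In0) as (Ea1 & Ea2 & Ea3 & Ea4). destruct (EB _ In1) as (Eb1 & Eb2 & Eb3 & Eb4).
      assert (St : bnorm Om N M (xi (S n)) <= Rmax (3 * d) (bnorm Om N M (xi n) + 5 / 2 * dt * (3 * d))).
      { apply (energy_step m p Bp Om N M N1 M1 th dt d (U (tn n)) (U (tn (S n))) (Q (tn n)) (Q (tn (S n)))
          (V (tn n)) (V (tn (S n))) (uh n) (uh (S n)) (qh n) (qh (S n))); try (apply SU || apply SQ || apply Qhn || assumption).
        - apply (Sch n).
        - apply (Aux n).
        - apply (Aux (S n)).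
        - intros; now apply exU.
        - intros; now apply exU.
        - intros; now apply exQ.
        - intros; now apply exQ.
        - intros v Qv. apply dle, bA; auto.
        - intros v Qv. apply dle, bA; auto.
        - intros v Qv. apply dle, bA; auto.
        - intros v Qv. apply dle, bA; auto.
        - intros v Qv. apply dle, bI; auto.
        - intros v Qv. apply dle, bI; auto.
        - intros v Qv. apply dle.
          (* [Z] is the time average of u_t over the step; its norms are bounded by [average_norm],
             uniformly in [dt]. *)
          set (Z := fun a b x y => / dt * (U (tn (S n)) a b x y - U (tn n) a b x y)).
          assert (SZ : smooth2 Z) by (apply smooth2_scal, smooth2_minus; apply SU).
          assert (PZ : periodic2 Lx Ly Z).
          { intros a b x y. unfold Z. destruct (PU (tn n) a b x y) as [-> ->].
            destruct (PU (tn (S n)) a b x y) as [-> ->]. auto. }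
          assert (AV : forall a b B, (forall t, 0 <= t <= T -> sobolev_sq (ax Om) Lx (ay Om) Ly (V t) a b <= B) ->
              sobolev_sq (ax Om) Lx (ay Om) Ly Z a b <= B).
          { intros a b B HB.
            pose proof (average_norm Om u D SD (tn n) (tn (S n)) a b B (tn0 n)) as AN.
            replace (tn (S n) - tn n) with dt in AN by (rewrite tnS; ring).
            apply AN; [rewrite tnS; lra|].
            intros t Ht. apply HB. lra. }
          replace ((inner Om N M (proj_error m p Om N M (U (tn (S n)))) v - inner Om N M (proj_error m p Om N M (U (tn n))) v) / dt)
            with (inner Om N M (proj_error m p Om N M Z) v).
          + apply bI; [exact SZ | exact PZ | | exact Qv].
            unfold approx_sq. fold Lx Ly.
            assert (Z1 : sobolev_sq (ax Om) Lx (ay Om) Ly Z (m + 2) 0 <= s ^ 2).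
            { apply AV. intros t Ht. refine (Rle_trans _ _ _ (proj2 (B1 t _ _ Ht _)) s1s). lia. }
            assert (Z2 : sobolev_sq (ax Om) Lx (ay Om) Ly Z 0 (m + 2) <= s ^ 2).
            { apply AV. intros t Ht. refine (Rle_trans _ _ _ (proj2 (B1 t _ _ Ht _)) s1s). lia. }
            assert (Z3 : sobolev_sq (ax Om) Lx (ay Om) Ly Z 2 (m - 2 + 2) <= s ^ 2).
            { apply AV. intros t Ht.
              destruct (Nat.le_gt_cases 2 m) as [m2|m2].
              - refine (Rle_trans _ _ _ (proj2 (B1 t _ _ Ht _)) s1s). lia.
              - (* [s1] controls too few derivatives, but [u_tt] controls those of order 4 of [u_t]. *)
                replace (m - 2 + 2)%nat with 2%nat by lia.
                assert (X0 : 0 < Lx) by (unfold Lx; pose proof (ax_lt_bx Om); lra).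
                assert (Y0 : 0 < Ly) by (unfold Ly; pose proof (ay_lt_by Om); lra).
                apply Rle_trans with (2 := s2s). apply Rle_trans with (2 := proj2 (B2 t Ht)).
                rewrite (sobolev_sq_ext _ _ _ _ (slice D 2 t) (lap (lap (V t))))
                  by (intros; rewrite (slice_pde2 u D SD PDE); unfold V; ring).
                apply Rle_trans with (sobolev_sq (ax Om) Lx (ay Om) Ly (lap (V t)) 0 2).
                + exact (proj1 (lap_bound (ax Om) Lx (ay Om) Ly X0 Y0 (V t) 0 2 (SV t) (PV t))).
                + exact (proj1 (proj2 (lap_bound (ax Om) Lx (ay Om) Ly X0 Y0 (lap (V t)) 0 0 (smooth2_lap _ (SV t)) (periodic2_lap _ _ _ (PV t))))). }
            pose proof (pow2_ge_0 s). nra.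
          + assert (c0 := proj1 (proj_error_breg m p Bp Om N M _ (SU (tn n)))).
            assert (c1 := proj1 (proj_error_breg m p Bp Om N M _ (SU (tn (S n))))).
            rewrite (inner_ext Om N M _ (bcomb (/ dt) (proj_error m p Om N M (U (tn (S n)))) (- / dt) (proj_error m p Om N M (U (tn n))))).
            * rewrite inner_lin by (assumption || apply (broken_C1_Qh N M _ _ Qv)). field. lra.
            * intros i j x y _ _. unfold Z. rewrite proj_error_average by auto. unfold bcomb. ring.
        - intros v Qv. assert (Cv := proj1 (broken_C1_Qh N M _ _ Qv)). pose proof (bnorm_ge0 Om N M v) as Nv.
          rewrite !tnS.
          apply Rle_trans with ((2 * th - 1) * dt * (s2 * bnorm Om N M v) + dt ^ 2 * (s3 * bnorm Om N M v)).
          + apply (theta_rule th (fun l t => slice_pairing Om D N M v l t)); [exact Hth | apply tn0 | exact dt0 | | |].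
            * intros l. now apply (slice_pairing_cont Om u D SD N M v).
            * intros l t Ht. now apply (slice_pairing_derive Om u D SD N M v).
            * intros t Ht. rewrite <- tnS in Ht. assert (It : 0 <= t <= T) by lra.
              split; apply (slice_pairing_bound Om u D SD N M v N1 M1 Cv); [exact s20 | exact (proj2 (B2 t It)) | exact s30 | exact (proj2 (B3 t It))].
          + replace ((2 * th - 1) * dt * (s2 * bnorm Om N M v) + dt ^ 2 * (s3 * bnorm Om N M v))
              with ((2 * ((th - 1 / 2) * dt) * s2 + dt ^ 2 * s3) * bnorm Om N M v) by field.
            apply Rmult_le_compat_r; [exact Nv|].
            assert (s2 <= s) by (unfold s; lra). assert (s3 <= s) by (unfold s; lra).
            assert (2 * ((th - 1 / 2) * dt) * s2 <= 2 * ((th - 1 / 2) * dt) * s) by (apply Rmult_le_compat_l; lra).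
            assert (dt ^ 2 * s3 <= dt ^ 2 * s) by (apply Rmult_le_compat_l; lra).
            assert (0 <= s * H) by (apply Rmult_le_pos; lra).
            assert (0 <= s * dt ^ 2) by (apply Rmult_le_pos; lra).
            assert (0 <= K * (s * G)) by (apply Rmult_le_pos; [exact K0 | apply Rmult_le_pos; [exact s0 | unfold G; lra]]).
            unfold d. replace ((K + 2) * s * G) with (K * (s * G) + 2 * s * G) by ring.
            apply Rle_trans with (2 * s * G); [unfold G; lra | lra]. }
      (* The first branch of the maximum is the constant already present and does not accumulate;
         the second adds [15 / 2 * d * dt]. *)
      apply Rle_trans with (1 := St). rewrite tnS. apply Rmax_lub.
      + assert (0 <= d * (tn n + dt)) by (apply Rmult_le_pos; [exact d0 | pose proof (tn0 n); lra]). lra.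
      + lra. }
  specialize (Growth n nT).
  destruct (EB (tn n) (conj (tn0 n) nT)) as (_ & EB2 & _ & _).
  pose proof (bN (U (tn n)) (SU _) (PU _) EB2) as He.
  rewrite (bnorm_ext Om N M _ (bcomb 1 (proj_error m p Om N M (U (tn n))) 1 (xi n))).
  - eapply Rle_trans; [apply (bnorm_bcomb Om N M N1 M1)|].
    + apply (proj_error_breg m p Bp Om N M _ (SU (tn n))).
    + apply (broken_C1_Qh N M (S m)). apply (disc_err_Qh m p Bp); [apply SU | apply Qhn].
    + rewrite Rabs_R1. fold h. change (h ^ (S m + 1)) with H. fold s. fold G.
      replace ((4 * (K + 2) * s + 15 / 2 * (K + 2) * s * T) * G) with (4 * d + 15 / 2 * d * T) by (unfold d; ring).
      assert (d * tn n <= d * T) by (apply Rmult_le_compat_l; assumption).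
      lra.
  - intros i j x y _ _. unfold bcomb at 1. rewrite proj_error_eq. unfold xi, disc_err, bcomb.
    unfold U at 1. rewrite (slice_u u D SD) by apply tn0. fold (tn n). ring.
Qed.
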